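(* Let $(M,g)$ be an $n$-dimensional compact and connected Riemannian manifold that admits a non-trivial concircular vector field $\boldsymbol{u}$ with potential function $f$ and connecting function $\rho$ such that $\rho(p)\neq 0$ for each $p\in M$ and the vector field $\boldsymbol{u}$ has exactly two zeros. Then $M$ is homeomorphic to an $n$-sphere.
   Context: A smooth vector field $\boldsymbol{u}$ on a Riemannian manifold $(M,g)$ is called concircular if there is a smooth function $f:M\to\mathbb{R}$ such that $\nabla_X\boldsymbol{u}=fX$ for every smooth vector field $X$ on $M$, where $\nabla$ is the Levi-Civita connection of $g$. The function $f$ is called the potential function of $\boldsymbol{u}$. The concircular vector field is called non-trivial if $f\neq 0$, i.e. $f$ is not identically zero. The connecting function of a non-trivial concircular vector field $\boldsymbol{u}$ with potential function $f$ on a connected Riemannian manifold is the unique smooth function $\rho:M\to\mathbb{R}$ with $\nabla f=\rho\,\boldsymbol{u}$, where $\nabla f$ is the gradient of $f$. *)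

(* Defs.v *)
From HB Require Import structures.
From mathcomp Require Import all_boot all_order all_algebra.
From mathcomp Require Import all_classical all_reals all_analysis.
From mathcomp Require Import ring.

Set Implicit Arguments.
Unset Strict Implicit.
Unset Printing Implicit Defensive.

Import Order.TTheory GRing.Theory Num.Theory.
Import numFieldNormedType.Exports.

Local Open Scope classical_set_scope.
Local Open Scope ring_scope.

Section EuclideanSmoothness.
Variables (R : realType) (n : nat).

Fixpoint Ck (W : normedModType R) (k : nat) (U : set 'rV[R]_n)
    (F : 'rV[R]_n -> W) : Prop :=
  (forall x, U x -> {for x, continuous F}) /\
  if k is k'.+1 then
    forall i : 'I_n, (forall x, U x -> derivable F x (delta_mx 0 i)) /\
                     Ck k' U (fun x => 'D_(delta_mx 0 i) F x)
  else True.

(* Only meant for open U: continuity and derivatives are taken in 'rV[R]_n. *)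
Definition smooth_on (W : normedModType R) (U : set 'rV[R]_n)
    (F : 'rV[R]_n -> W) : Prop := forall k, Ck k U F.

Lemma Ck_ext (W : normedModType R) k (U : set 'rV[R]_n)
    (F G : 'rV[R]_n -> W) :
  open U -> (forall x, U x -> F x = G x) -> Ck k U F -> Ck k U G.
Proof.
move=> Uo.
have nFG F' G' x : (forall y, U y -> F' y = G' y) -> U x ->
    \forall y \near x, F' y = G' y :> W.
  move=> FG Ux; apply: filterS (open_nbhs_nbhs (conj Uo Ux)) => y; exact: FG.
have cG F' G' : (forall y, U y -> F' y = G' y) ->
    (forall x, U x -> {for x, continuous F'}) ->
    forall x, U x -> {for x, continuous (G' : _ -> W)}.
  move=> FG cF x Ux; rewrite /prop_for /continuous_at -FG//.
  apply: cvg_trans (cF _ Ux).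
  by apply: (@near_eq_cvg _ _ (nbhs x)); exact: (nFG F' G').
elim: k F G => [|k IHk] F G FG /= [cF dF]; split=> //; try exact: cG cF.
move=> i; have [dFi CFi] := dF i; split.
  by move=> x Ux; apply: near_eq_derivable (dFi x Ux); exact: (nFG F G).
by apply: IHk CFi => x Ux; apply: near_eq_derive; exact: (nFG F G).
Qed.

Lemma Ck_le (W : normedModType R) k (U : set 'rV[R]_n) (F : 'rV[R]_n -> W) :
  Ck k.+1 U F -> Ck k U F.
Proof.
elim: k F => [|k IHk] F /= [cF dF]; split=> //.
by move=> i; have [dFi CFi] := dF i; split=> //; exact: IHk.
Qed.

Lemma Ck_cst (W : normedModType R) k (U : set 'rV[R]_n) (a : W) :
  open U -> Ck k U (fun=> a).
Proof.
move=> Uo; elim: k a => [|k IHk] a /=; split=> //; try by move=> x _; exact: cst_continuous.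
move=> i; split=> [x _|]; first exact: derivable_cst.
by apply: (Ck_ext Uo) (IHk 0) => x _; rewrite derive_cst.
Qed.

Lemma CkD (W : normedModType R) k (U : set 'rV[R]_n) (F G : 'rV[R]_n -> W) :
  open U -> Ck k U F -> Ck k U G -> Ck k U (F \+ G).
Proof.
move=> Uo; elim: k F G => [|k IHk] F G /= [cF dF] [cG dG]; split=> //;
  try by move=> x Ux; apply: continuousD; [exact: cF|exact: cG].
move=> i; have [dFi CFi] := dF i; have [dGi CGi] := dG i; split.
  by move=> x Ux; apply: derivableD; [exact: dFi|exact: dGi].
apply: (Ck_ext Uo) (IHk _ _ CFi CGi) => x Ux /=.
by rewrite deriveD//; [exact: dFi|exact: dGi].
Qed.

Lemma CkM k (U : set 'rV[R]_n) (F G : 'rV[R]_n -> R^o) :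
  open U -> Ck k U F -> Ck k U G -> Ck k U (F \* G).
Proof.
move=> Uo; elim: k F G => [|k IHk] F G CF CG; move: (CF) (CG);
  rewrite /= => -[cF dF] [cG dG]; split=> //;
  try by move=> x Ux; apply: continuousM; [exact: cF|exact: cG].
move=> i; have [dFi CFi] := dF i; have [dGi CGi] := dG i; split.
  by move=> x Ux; apply: derivableM; [exact: dFi|exact: dGi].
have C := CkD Uo (IHk _ _ (Ck_le CF) CGi) (IHk _ _ (Ck_le CG) CFi).
apply: (Ck_ext Uo) C => x Ux /=.
by rewrite deriveM//; [exact: dFi|exact: dGi].
Qed.

End EuclideanSmoothness.

Section Manifolds.
Variables (R : realType) (n : nat).

Record chart (T : topologicalType) := Chart {
  chart_dom : set T;
  chart_map : T -> 'rV[R]_n;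
  chart_inv : 'rV[R]_n -> T;
  chart_dom_open : open chart_dom;
  chart_img_open : open (chart_map @` chart_dom);
  chart_mapK : forall p, chart_dom p -> chart_inv (chart_map p) = p;
  chart_map_continuous : {within chart_dom, continuous chart_map};
  chart_inv_continuous :
    {within chart_map @` chart_dom, continuous chart_inv} }.

(* The atlas need not be maximal. *)
Record manifold := Manifold {
  carrier :> topologicalType;
  atlas : set (chart carrier);
  manifold_hausdorff : hausdorff_space carrier;
  manifold_second_countable : @second_countable carrier;
  atlas_cover : forall p, exists2 c, atlas c & chart_dom c p;
  atlas_smooth : forall c d, atlas c -> atlas d ->
      smooth_on (chart_map c @` (chart_dom c `&` chart_dom d))
                (chart_map d \o chart_inv c) }.

End Manifolds.

Section SmoothFunctions.
Variables (R : realType) (n : nat) (M : manifold R n).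

Definition smooth (h : M -> R^o) : Prop := forall c, atlas c ->
  smooth_on (chart_map c @` chart_dom c) (h \o chart_inv c).

Definition smooth_pred : {pred (M -> R^o)} := fun h => `[< smooth h >].

Record smooth_fun :=
  SmoothFun { sfun_val :> M -> R^o; _ : sfun_val \in smooth_pred }.

Lemma smooth_cst (a : R^o) : smooth (fun=> a).
Proof. by move=> c _ k; apply: Ck_cst; exact: chart_img_open. Qed.

Lemma smoothM (h l : M -> R^o) : smooth h -> smooth l -> smooth (h \* l).
Proof.
by move=> sh sl c Ac k; apply: CkM; [exact: chart_img_open|exact: sh|exact: sl].
Qed.

Lemma smoothD (h l : M -> R^o) : smooth h -> smooth l -> smooth (h \+ l).
Proof.
by move=> sh sl c Ac k; apply: CkD; [exact: chart_img_open|exact: sh|exact: sl].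
Qed.

Lemma smooth_subring_closed : subring_closed smooth_pred.
Proof.
split; first by apply/asboolP; exact: smooth_cst.
- move=> h l /asboolP sh /asboolP sl; apply/asboolP.
  suff -> : h - l = h \+ ((fun=> -1) \* l).
    by apply: smoothD => //; apply: smoothM => //; exact: smooth_cst.
  by apply/funext => p; rewrite /= mulN1r.
- by move=> h l /asboolP sh /asboolP sl; apply/asboolP; exact: smoothM.
Qed.

Lemma smooth_scaler_closed : scaler_closed smooth_pred.
Proof.
move=> a h /asboolP sh; apply/asboolP.
by apply: (@smoothM (fun=> a) h) => //; exact: smooth_cst.
Qed.

HB.instance Definition _ :=
  GRing.isSubringClosed.Build _ smooth_pred smooth_subring_closed.
HB.instance Definition _ :=
  GRing.isScaleClosed.Build R _ smooth_pred smooth_scaler_closed.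

HB.instance Definition _ := [isSub for sfun_val].
HB.instance Definition _ := [Choice of smooth_fun by <:].
HB.instance Definition _ := 
  GRing.SubChoice_isSubComPzRing.Build _ _ smooth_fun smooth_subring_closed.
HB.instance Definition _ := [SubZmodule_isSubLmodule of smooth_fun by <:].

End SmoothFunctions.

Section TangentSpace.
Variables (R : realType) (n : nat) (M : manifold R n) (p : M).

Definition derivation_at (v : smooth_fun M -> R^o) : Prop :=
  linear v /\ forall h k, v (h * k) = v h * k p + h p * v k.

Definition derivation_at_pred : {pred (smooth_fun M -> R^o)} :=
  fun v => `[< derivation_at v >].

Record tangent :=
  Tangent { tangent_val :> smooth_fun M -> R^o;
            _ : tangent_val \in derivation_at_pred }.

Lemma derivation_at_submod_closed : submod_closed derivation_at_pred.
Proof.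
split.
  apply/asboolP; split=> [a h k|h k].
    by change (0 = a * 0 + 0 :> R); rewrite mulr0 addr0.
  by change (0 = 0 * k p + h p * 0 :> R); rewrite mul0r mulr0 addr0.
move=> a v w /asboolP[linv dv] /asboolP[linw dw]; apply/asboolP.
split=> [b h k|h k].
  change (a * v (b *: h + k) + w (b *: h + k) =
    b * (a * v h + w h) + (a * v k + w k)).
  by rewrite linv linw /GRing.scale/= !mulrDr [a * (b * _)]mulrCA addrACA.
change (a * v (h * k) + w (h * k) =
  (a * v h + w h) * k p + h p * (a * v k + w k)).
rewrite dv dw mulrDl !mulrDr mulrA addrACA.
by rewrite [h p * (a * v k)]mulrCA.
Qed.

HB.instance Definition _ :=
  GRing.isSubmodClosed.Build R _ derivation_at_pred derivation_at_submod_closed.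

HB.instance Definition _ := [isSub for tangent_val].
HB.instance Definition _ := [Choice of tangent by <:].
HB.instance Definition _ := [SubChoice_isSubLmodule of tangent by <:].

End TangentSpace.

Section VectorFields.
Variables (R : realType) (n : nat) (M : manifold R n).
Local Notation C := (smooth_fun M).

Definition vfield_pred : {pred (C -> C^o)} :=
  fun X => `[< forall p : M, derivation_at p (fun h => (X h : C) p) >].

Record vfield :=
  VField { vfield_val :> C -> C^o; _ : vfield_val \in vfield_pred }.

Lemma vfield_submod_closed : submod_closed vfield_pred.
Proof.
split.
  apply/asboolP => p; split=> [a h k|h k].
    by change (0 = a * 0 + 0 :> R); rewrite mulr0 addr0.
  by change (0 = 0 * k p + h p * 0 :> R); rewrite mul0r mulr0 addr0.
move=> f X Y /asboolP dX /asboolP dY; apply/asboolP => p.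
have [linX lX] := dX p; have [linY lY] := dY p.
split=> [a h k|h k] /=.
  change (f p * X (a *: h + k) p + Y (a *: h + k) p =
    a * (f p * X h p + Y h p) + (f p * X k p + Y k p)).
  by rewrite linX linY /GRing.scale/= !mulrDr [f p * (a * _)]mulrCA addrACA.
change (f p * X (h * k) p + Y (h * k) p =
  (f p * X h p + Y h p) * k p + h p * (f p * X k p + Y k p)).
rewrite lX lY mulrDl !mulrDr mulrA addrACA.
by rewrite [h p * (f p * _)]mulrCA.
Qed.

HB.instance Definition _ :=
  GRing.isSubmodClosed.Build C _ vfield_pred vfield_submod_closed.

HB.instance Definition _ := [isSub for vfield_val].
HB.instance Definition _ := [Choice of vfield by <:].
HB.instance Definition _ := [SubChoice_isSubLmodule of vfield by <:].

Lemma vfield_derivation_at (X : vfield) (p : M) :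
  (fun h => (X h : C) p) \in derivation_at_pred p.
Proof. by case: X => X /= /asboolP dX; apply/asboolP. Qed.

Definition vfield_at (X : vfield) (p : M) : tangent p :=
  Tangent (vfield_derivation_at X p).

Lemma lie_bracket_subproof (X Y : vfield) :
  (fun h : C => X (Y h) - Y (X h) : C^o) \in vfield_pred.
Proof.
apply/asboolP => p.
have lin (Z : vfield) a (h k : C) : Z (a *: h + k) = a *: (Z h : C) + Z k.
  apply/val_inj/funext => q.
  by have /asboolP[linZ _] := vfield_derivation_at Z q; exact: linZ.
have lM (Z : vfield) (h k : C) : Z (h * k) = Z h * k + h * Z k.
  apply/val_inj/funext => q.
  by have /asboolP[_ dZ] := vfield_derivation_at Z q; exact: dZ.
have lD (Z : vfield) (h k : C) : Z (h + k) = Z h + Z k.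
  by have := lin Z 1 h k; rewrite !scale1r.
split=> [a h k|h k].
  rewrite !lin.
  change (a * X (Y h) p + X (Y k) p - (a * Y (X h) p + Y (X k) p) =
    a * (X (Y h) p - Y (X h) p) + (X (Y k) p - Y (X k) p)).
  by rewrite opprD addrACA mulrBr.
rewrite !lM !lD !lM.
change ((X (Y h) p * k p + Y h p * X k p + (X h p * Y k p + h p * X (Y k) p))
  - (Y (X h) p * k p + X h p * Y k p + (Y h p * X k p + h p * Y (X k) p)) =
  (X (Y h) p - Y (X h) p) * k p + h p * (X (Y k) p - Y (X k) p)).
by ring.
Qed.

Definition lie_bracket (X Y : vfield) : vfield :=
  VField (lie_bracket_subproof X Y).

End VectorFields.

Section Riemannian.
Variables (R : realType) (n : nat) (M : manifold R n).
Local Notation C := (smooth_fun M).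

Record metric := Metric {
  inner : forall p : M, tangent p -> tangent p -> R^o;
  inner_linear : forall (p : M) (w : tangent p),
    linear (fun v : tangent p => inner v w);
  inner_sym : forall (p : M) (v w : tangent p), inner v w = inner w v;
  inner_gt0 : forall (p : M) (v : tangent p), v != 0 -> 0 < inner v v;
  inner_smooth : forall X Y : vfield M,
    (fun p => inner (vfield_at X p) (vfield_at Y p)) \in @smooth_pred R n M }.

Variable g : metric.

Definition inner_vfield (X Y : vfield M) : C := SmoothFun (inner_smooth g X Y).

(* R-homogeneity in the second argument is the Leibniz rule for constants. *)
Definition affine_connection
    (nabla : vfield M -> vfield M -> vfield M) : Prop :=
  [/\ forall Y, linear (nabla^~ Y),
      forall X Y Z, nabla X (Y + Z) = nabla X Y + nabla X Z &
      forall (X : vfield M) (f : C) (Y : vfield M),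
        nabla X (f *: Y) = (X f : C) *: Y + f *: nabla X Y].

Definition levi_civita (nabla : vfield M -> vfield M -> vfield M) : Prop :=
  [/\ affine_connection nabla,
      forall X Y, nabla X Y - nabla Y X = lie_bracket X Y &
      forall X Y Z : vfield M, X (inner_vfield Y Z) =
        inner_vfield (nabla X Y) Z + inner_vfield Y (nabla X Z)].

Definition is_gradient (f : C) (G : vfield M) : Prop :=
  forall X : vfield M, inner_vfield G X = X f.

Definition concircular (nabla : vfield M -> vfield M -> vfield M)
    (u : vfield M) (f : C) : Prop := forall X, nabla X u = f *: X.

(* On a connected manifold with u non-trivial this determines rho. *)
Definition is_connecting_function (u : vfield M) (f rho : C) : Prop :=
  is_gradient f (rho *: u).

Definition zeros (u : vfield M) : set M := [set p | vfield_at u p = 0].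

End Riemannian.

Definition sphere (R : realType) (n : nat) : set 'rV[R]_n.+1 :=
  [set x | \sum_i x 0 i ^+ 2 = 1].
Arguments sphere : clear implicits.

Definition homeomorphic (S T : topologicalType) : Prop :=
  exists F : S -> T, exists G : T -> S,
    [/\ cancel F G, cancel G F, continuous F & continuous G].

(* Main.v *)
Require Import Defs.
From HB Require Import structures.
From mathcomp Require Import all_boot all_order all_algebra.
From mathcomp Require Import all_classical all_reals all_analysis.
From mathcomp Require Import ring lra.

Import Order.TTheory GRing.Theory Num.Theory.
Import numFieldNormedType.Exports.

Set Implicit Arguments.
Unset Strict Implicit.
Unset Printing Implicit Defensive.

Local Open Scope classical_set_scope.
Local Open Scope ring_scope.

(* Let p, q be the zeros of u. Since [nabla u = f Id], torsion-freeness shows that the linear part of u at p is f(p) Id, and a Gronwall argument for the energy g(u,u) + f^2 along coordinate segments gives f(p) <> 0: otherwise the energy would vanish near p and u would have infinitely many zeros. Hence, up to the sign of time, p is a radial sink of the (complete) flow psi of u. Along psi the function f has derivative a sign times rho g(u,u), where rho has constant sign, so +-f is a Lyapunov function that is stationary only at p and q. Therefore every other orbit runs from q to p and crosses a small coordinate sphere around p exactly once. Sending a point with crossing time T and crossing direction v to (T, v) / sqrt(1 + T^2), and q, p to the two poles, is a continuous bijection from the compact space M onto the Hausdorff sphere. *)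

(** * Differential calculus in R^n *)

(** Tangent vectors are derivations of global smooth functions, so coordinates cannot be
    differentiated directly. Everything local is multiplied by a bump exp(-1/t) of the squared
    distance, and Hadamard's lemma shows that a derivation is determined by its values on the
    localised coordinates and on the bump. The same bump later defines the cross-section: it lives
    on all of M, is nonnegative, and is nondecreasing along the flow everywhere, so crossing times
    exist and are unique without following orbits inside the chart. The energy is the right quantity
    because X g(u,u) = 2 f g(u,X) and X f = rho g(u,X) are both multiples of g(u,X): the sum
    controls its own derivative, which neither summand does. The linear part of u is studied at p
    only. At q, continuity of the flow is enough: orbits that start near q stay below the level for
    a long time. That every other orbit joins q to p comes from compactness, since the Lyapunov
    function grows at a positive rate off neighbourhoods of p and q. *)

Section MeanValue.
Variable R : realType.

Lemma is_derive_continuous (W : normedModType R) (f : R -> W) (t : R) df :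
  is_derive t 1 f df -> {for t, continuous f}.
Proof.
by move=> [fd _]; apply: differentiable_continuous; exact/derivable1_diffP.
Qed.

Lemma mean_value_le (f df : R -> R^o) (a b C : R) : a <= b ->
  (forall t : R, a <= t <= b -> is_derive t 1 f (df t)) ->
  (forall t : R, a <= t <= b -> `|df t| <= C) ->
  `|f b - f a| <= C * (b - a).
Proof.
move=> ab fd dfC.
have [||c cab ->] := @MVT_segment R f df a b ab.
- by move=> x; rewrite in_itv/= => /andP[/ltW ax /ltW xb]; apply: fd; rewrite ax.
- apply: continuous_in_subspaceT => x; rewrite inE/= in_itv/= => xab.
  exact: is_derive_continuous (fd _ xab).
- by rewrite normrM (ger0_norm (_ : 0 <= b - a)) ?subr_ge0//
    ler_wpM2r ?subr_ge0//; apply: dfC; rewrite in_itv/= in cab.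
Qed.

Lemma mean_value_le0 (f df : R -> R^o) (b C : R) :
  (forall t : R, `|t| <= `|b| -> is_derive t 1 f (df t)) ->
  (forall t : R, `|t| <= `|b| -> `|df t| <= C) ->
  `|f b - f 0| <= C * `|b|.
Proof.
move=> fd dfC; have [b0|b0] := leP 0 b.
  rewrite -[b in X in _ <= X]subr0 (ger0_norm (_ : 0 <= b - 0)) ?subr0//.
  rewrite -[in X in _ <= X](subr0 b); apply: (mean_value_le (df := df)) => // t /andP[t0 tb].
    by apply: fd; rewrite !ger0_norm.
  by apply: dfC; rewrite !ger0_norm.
rewrite distrC (ltr0_norm b0) -[- b]sub0r; apply: (mean_value_le (df := df)).
- exact: ltW.
- by move=> t /andP[bt t0]; apply: fd; rewrite (ltr0_norm b0) ler0_norm// lerN2.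
- by move=> t /andP[bt t0]; apply: dfC; rewrite (ltr0_norm b0) ler0_norm// lerN2.
Qed.

Lemma is_derive_line (V W : normedModType R) (F : V -> W) (x v : V) (t : R) :
  derivable F (t *: v + x) v ->
  is_derive t 1 (fun s => F (s *: v + x)) ('D_v F (t *: v + x)).
Proof.
move=> Fd.
have E : (fun h : R => h^-1 *: (((fun s => F (s *: v + x)) \o shift t) (h *: (1 : R^o))
    - F (t *: v + x))) =
    (fun h => h^-1 *: ((F \o shift (t *: v + x)) (h *: v) - F (t *: v + x))).
  apply/funext => h /=; congr (_ *: (F _ - _)).
  by rewrite [h *: 1]mulr1 scalerDl addrA.
by split; rewrite /derivable /derive E.
Qed.

End MeanValue.

Section RowNorm.
Variables (R : realType) (n : nat).
Implicit Types v : 'rV[R]_n.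

Lemma coord_le_norm v i : `|v 0 i| <= `|v|.
Proof.
rewrite [leRHS]/Num.Def.normr/= mx_normrE.
exact: (le_bigmax _ (fun ij => `|v ij.1 ij.2|) (0, i)).
Qed.

Lemma norm_le_coord v e : 0 <= e -> (forall i, `|v 0 i| <= e) -> `|v| <= e.
Proof.
move=> e0 ve; rewrite [leLHS]/Num.Def.normr/= mx_normrE.
by apply: bigmax_le => // -[i j] _ /=; rewrite (ord1 i).
Qed.

End RowNorm.

Section CkTheory.
Variables (R : realType) (n : nat).
Local Notation e_ i := (delta_mx 0 i : 'rV[R]_n).
Implicit Types (U V : set 'rV[R]_n) (W : normedModType R).

Lemma Ck_sub W k U V (F : 'rV[R]_n -> W) : V `<=` U -> Ck k U F -> Ck k V F.
Proof.
move=> VU; elim: k F => [|k IH] F /= [cF dF]; split => //; try by move=> x /VU; exact: cF.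
move=> i; have [dFi CFi] := dF i; split; first by move=> x /VU; exact: dFi.
exact: IH.
Qed.

Lemma CkU W k U V (F : 'rV[R]_n -> W) : Ck k U F -> Ck k V F -> Ck k (U `|` V) F.
Proof.
elim: k F => [|k IH] F /= [cU dU] [cV dV]; split => //;
  try by move=> x [/cU|/cV].
move=> i; have [dUi CUi] := dU i; have [dVi CVi] := dV i.
by split; [move=> x [/dUi|/dVi]|exact: IH].
Qed.

Lemma Ck_mono W j k U (F : 'rV[R]_n -> W) : (j <= k)%N -> Ck k U F -> Ck j U F.
Proof.
move=> /subnK <-; elim: (k - j)%N => // m IH.
by rewrite addSn => /Ck_le; exact: IH.
Qed.

Lemma Ck_continuous W k U (F : 'rV[R]_n -> W) x : Ck k U F -> U x -> {for x, continuous F}.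
Proof. by case: k => [|k] [+ _]; apply. Qed.

Lemma Ck_sum k U (I : Type) (r : seq I) (F : I -> 'rV[R]_n -> R^o) :
  open U -> (forall i, Ck k U (F i)) -> Ck k U (fun x => \sum_(i <- r) F i x).
Proof.
move=> Uo CF; elim: r => [|i r IH].
  by under eq_fun do rewrite big_nil; exact: Ck_cst.
under eq_fun do rewrite big_cons.
exact: (CkD Uo (CF i) IH).
Qed.

(** The derivative is -F' times the square of 1/F, which involves the inverse only at the lower
    order, so induction on [k] closes. *)
Lemma Ck_inv k U (F : 'rV[R]_n -> R^o) : open U -> (forall x, U x -> F x != 0) ->
  Ck k U F -> Ck k U (fun x => (F x)^-1 : R^o).
Proof.
move=> Uo F0; elim: k => [|k IH] CF; (split; [move=> x Ux; apply: continuousV;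
  [exact: F0|exact: Ck_continuous CF Ux]|]) => // i.
have [cF /(_ i)[dFi CFi]] := CF; split.
  by move=> x Ux; apply: derivableV; [exact: F0|exact: dFi].
have CI := IH (Ck_le CF).
have := CkM Uo (CkM Uo (Ck_cst k (-1 : R^o) Uo) CFi) (CkM Uo CI CI).
apply: Ck_ext => // x Ux /=; rewrite deriveV//; [|exact: F0|exact: dFi].
rewrite -[RHS]/(- (F x) ^- 2 * 'D_(e_ i) F x) -exprVn expr2.
by ring.
Qed.

Lemma is_derive_coord (V : normedModType R) (G : V -> 'rV[R]_n) x v dG j :
  is_derive x v G dG -> is_derive x v (fun y => G y 0 j : R^o) (dG 0 j).
Proof.
move=> [dGx <-]; split; first by move/derivable_mxP : dGx; apply.
by rewrite derive_mx// mxE.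
Qed.

Lemma Ck_coord0 k U i : open U -> Ck k U (fun x => x 0 i : R^o).
Proof.
move=> Uo; have D x v : is_derive x v (fun y : 'rV[R]_n => y 0 i : R^o) (v 0 i).
  exact: (@is_derive_coord _ id).
case: k => [|k]; (split; first by move=> x _; exact: coord_continuous) => // j.
split; first by move=> x _; have [] := D x (e_ j).
by apply: (Ck_ext Uo) (Ck_cst k (e_ j 0 i : R^o) Uo) => x _; rewrite derive_val.
Qed.

Lemma derive_at_line W (F : 'rV[R]_n -> W) x v dF :
  is_derive x v F dF <-> is_derive (0 : R) 1 (fun h => F (h *: v + x)) dF.
Proof.
split=> [[dFx <-]|[dFx <-]].
  have := @is_derive_line _ _ _ F x v 0; rewrite scale0r add0r; exact.
have dF' : derivable F x v := (derivable1P F x v).2 dFx.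
split=> //.
by have := @is_derive_line _ _ _ F x v 0; rewrite scale0r add0r => /(_ dF') [_ ->].
Qed.

(** Differentiating [g m \o F] produces [g m.+1 \o F], so the induction has to carry the whole
    sequence of derivatives of the outer function, with [m] varying. *)
Lemma Ck_comp1 k U (g : nat -> R -> R^o) m (F : 'rV[R]_n -> R^o) : open U ->
  (forall j (t : R), is_derive t 1 (g j) (g j.+1 t)) ->
  Ck k U F -> Ck k U (g m \o F).
Proof.
move=> Uo dg; elim: k m => [|k IH] m CF; (split; [by move=> x Ux; apply: continuous_comp;
  [exact: Ck_continuous CF Ux|apply: is_derive_continuous]|]) => // i.
have [cF /(_ i)[dFi CFi]] := CF.
have D x : U x -> is_derive x (e_ i) (g m \o F) ('D_(e_ i) F x * g m.+1 (F x)).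
  move=> Ux; apply/derive_at_line.
  have /derive_at_line D1 : is_derive x (e_ i) F ('D_(e_ i) F x) by split => //; exact: dFi.
  have := @is_derive1_comp R (g m) (fun h => F (h *: e_ i + x)) 0 (g m.+1 (F x)) _ _ D1.
  by rewrite scale0r add0r mulrC; apply.
split; first by move=> x /D [].
have := CkM Uo CFi (IH m.+1 (Ck_le CF)).
by apply: Ck_ext => // x /D Dx /=; rewrite derive_val.
Qed.

End CkTheory.

Section C1.
Variables (R : realType) (n : nat).
Local Notation e_ i := (delta_mx 0 i : 'rV[R]_n).

(** The increment is telescoped through the points [w k], which keep the first [k] coordinates of
    [v] and set the others to 0. Each step moves along one axis, where the one-variable mean value
    inequality applies. *)
Lemma C1_estimate (U : set 'rV[R]_n) (F : 'rV[R]_n -> R^o) x (e : R) :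
  open U -> U x -> Ck 1 U F -> 0 < e ->
  \forall v \near (0 : 'rV[R]_n),
    `|F (v + x) - F x - \sum_j v 0 j * 'D_(e_ j) F x| <= e * `|v|.
Proof.
move=> Uo Ux [_ FD] e0.
(* The [n] coordinate steps each cost [e1] times the norm; [n.+1] also keeps the denominator
   nonzero. *)
pose e1 := e / n.+1%:R.
have e10 : 0 < e1 by rewrite divr_gt0.
have : \forall y \near x, U y /\ forall j, `|'D_(e_ j) F y - 'D_(e_ j) F x| <= e1.
  apply: filterI; first exact: open_nbhs_nbhs.
  apply: (@filter_forall _ 'I_n _ (nbhs x) (nbhs_filter x)) => j.
  have [_ [/(_ _ Ux) cj _]] := FD j.
  have /cvgrPdist_le/(_ _ e10) := cj; apply: filterS => y.
  by rewrite distrC.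
move=> /nbhs_ballP[d /= d0 Hd].
near=> v.
have vd : `|v| < d.
  near: v; have := nbhsx_ballx (0 : 'rV[R]_n) _ d0.
  by apply: filterS => w; rewrite -ball_normE/= sub0r normrN.
pose w k : 'rV[R]_n := \row_j (if (j < k)%N then v 0 j else 0).
have key k : (k <= n)%N ->
    `|F (w k + x) - F x - \sum_(j < n | (j < k)%N) v 0 j * 'D_(e_ j) F x| <= k%:R * e1 * `|v|.
  elim: k => [_|k IH kn].
    rewrite (_ : w 0%N = 0) ?add0r ?subrr ?sub0r ?big_pred0 ?normr0 ?oppr0 ?mul0r ?normr0//.
    by apply/rowP => j; rewrite !mxE.
  pose kk := Ordinal kn.
  have wS : w k.+1 = v 0 kk *: e_ kk + w k.
    apply/rowP => j; rewrite !mxE eqxx/= ltnS leq_eqVlt -val_eqE/=.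
    case: (eqVneq (j : nat) k) => [jk|jk] /=; last by rewrite mulr0 add0r.
    by rewrite jk ltnn mulr1 addr0; congr (v 0 _); exact: val_inj.
  rewrite (bigD1 kk) //= [X in _ - (_ + X)](_ : _ = \sum_(j < n | (j < k)%N) v 0 j * 'D_(e_ j) F x); last first.
    apply: eq_bigl => j; rewrite ltnS leq_eqVlt -val_eqE/=.
    by case: (ltngtP (j : nat) k) => // ->; rewrite ltnn.
  rewrite wS -(addrA _ (w k) x).
  (* With the linear part subtracted, the derivative of [phi] is the variation of one partial
     derivative between nearby points, hence at most [e1]. *)
  pose phi (t : R) : R^o := F (t *: e_ kk + (w k + x)) - t * 'D_(e_ kk) F x.
  have inb t : `|t| <= `|v 0 kk| -> ball x d (t *: e_ kk + (w k + x)).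
    move=> tv; rewrite -ball_normE/= addrA opprD addrCA subrr addr0 normrN.
    apply: le_lt_trans vd; apply: norm_le_coord => // j; rewrite !mxE eqxx/=.
    case: (eqVneq j kk) => [->|jk] /=.
      by rewrite ltnn mulr1 addr0 (le_trans tv)// coord_le_norm.
    by rewrite mulr0 add0r; case: ifP => _; rewrite ?normr0// coord_le_norm.
  have phiE : `|phi (v 0 kk) - phi 0| <= e1 * `|v 0 kk|.
    apply: (@mean_value_le0 _ _ (fun t => 'D_(e_ kk) F (t *: e_ kk + (w k + x)) - 'D_(e_ kk) F x)).
      move=> t tv; apply: is_deriveB.
        apply: is_derive_line; have [Hu _] := Hd _ (inb _ tv).
        by have [+ _] := FD kk; apply.
      rewrite -[X in is_derive _ _ _ X]mulr1 [X in is_derive _ _ _ X]mulrC.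
      rewrite (_ : *%R^~ _ = ('D_(e_ kk) F x : R) *: (id : R -> R^o)); last first.
        by apply/funext => s; rewrite /GRing.scale/= mulrC.
      have := @is_deriveZ R _ _ id ('D_(e_ kk) F x) t 1 1 _.
      by rewrite [1 * _]mulrC; apply.
    by move=> t tv; have [_ ->] := Hd _ (inb _ tv).
  rewrite /phi scale0r mul0r subr0 add0r in phiE.
  have := IH (ltnW kn) => IHk.
  rewrite [X in `|X|](_ : _ = (F (v 0 kk *: e_ kk + (w k + x)) - v 0 kk * 'D_(e_ kk) F x - F (w k + x))
    + (F (w k + x) - F x - \sum_(j < n | (j < k)%N) v 0 j * 'D_(e_ j) F x)); last by ring.
  rewrite -natr1 !mulrDl mul1r [leRHS]addrC.
  apply: (le_trans (ler_normD _ _)); rewrite lerD//.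
  by apply: (le_trans phiE); apply: ler_wpM2l; [exact: ltW|exact: coord_le_norm].
have := key n (leqnn n).
rewrite (_ : w n = v); last by apply/rowP => j; rewrite !mxE ltn_ord.
have -> : \sum_(j < n | (j < n)%N) v 0 j * 'D_(e_ j) F x = \sum_j v 0 j * 'D_(e_ j) F x.
  by apply: eq_bigl => j; rewrite ltn_ord.
move=> /le_trans; apply; rewrite ler_wpM2r//.
by rewrite /e1 mulrCA ler_piMr ?ltW// ltr_pdivrMr// mul1r ltr_nat.
Unshelve. all: by end_near. Qed.

Definition partials (F : 'rV[R]_n -> R^o) x (v : 'rV[R]_n) : R^o :=
  \sum_j v 0 j * 'D_(e_ j) F x.

Lemma partials_is_linear F x : linear (partials F x).
Proof.
move=> a v w; rewrite /partials /GRing.scale/= mulr_sumr -big_split/=.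
by apply: eq_bigr => j _; rewrite !mxE mulrDl mulrA.
Qed.

HB.instance Definition _ F x := GRing.isLinear.Build R 'rV[R]_n R^o _ (partials F x)
  (partials_is_linear F x).

Lemma C1_differentiable (U : set 'rV[R]_n) (F : 'rV[R]_n -> R^o) x :
  open U -> U x -> Ck 1 U F ->
  differentiable F x /\ 'd F x = partials F x :> ('rV[R]_n -> R^o).
Proof.
move=> Uo Ux CF.
have pc : continuous (partials F x).
  move=> y; apply: (@Ck_continuous _ _ _ 0 setT) => //.
  apply: (@Ck_sum _ _ 0 setT _ _ (fun j (v : 'rV[R]_n) => v 0 j * 'D_(e_ j) F x)) => [|j]; first exact: openT.
  by apply: CkM; [exact: openT|apply: Ck_coord0; exact: openT|apply: Ck_cst; exact: openT].
have E (e : {posnum R}) : \forall v \near (0 : 'rV[R]_n), `|(F \o shift x - (cst (F x) + partials F x)) v| <= e%:num * `|v|.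
  apply: filterS (C1_estimate Uo Ux CF (gt0 e)) => v /=.
  by rewrite -addrA -opprD.
have D : 'd F x = partials F x :> ('rV[R]_n -> R^o).
  by apply: diff_unique => //; apply/eqaddoP => _/posnumP[e]; exact: E.
split=> //; apply/diff_locallyP; rewrite D; split => //.
by apply/eqaddoP => _/posnumP[e]; exact: E.
Qed.

Lemma Ck1_is_derive (U : set 'rV[R]_n) (F : 'rV[R]_n -> R^o) (c : R -> 'rV[R]_n) (t : R) dc :
  open U -> U (c t) -> Ck 1 U F -> is_derive t 1 c dc ->
  is_derive t 1 (F \o c) (\sum_j dc 0 j * 'D_(e_ j) F (c t)).
Proof.
move=> Uo Uc CF [/derivable1_diffP dc' <-].
have [dF dFE] := C1_differentiable Uo Uc CF.
split.
  by apply/derivable1_diffP; exact: differentiable_comp.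
rewrite deriveE; last exact: differentiable_comp.
by rewrite diff_comp//= dFE deriveE.
Qed.

End C1.

Section CkComp.
Variables (R : realType) (n m : nat).

Lemma Ck_coord k U (G : 'rV[R]_n -> 'rV[R]_m) j : open U ->
  Ck k U G -> Ck k U (fun x => G x 0 j : R^o).
Proof.
move=> Uo; elim: k G => [|k IH] G [cG dG]; (split;
  [by move=> x Ux; apply: (@continuous_comp _ _ _ G (fun v : 'rV[R]_m => v 0 j)); [exact: cG|exact: coord_continuous]|]) => // i.
have [dGi CGi] := dG i.
have D x : U x -> is_derive x (delta_mx 0 i) (fun x => G x 0 j : R^o) ('D_(delta_mx 0 i) G x 0 j).
  by move=> Ux; apply: is_derive_coord; split => //; exact: dGi.
split; first by move=> x /D [].
by apply: (Ck_ext Uo) (IH _ CGi) => x /D Dx; rewrite derive_val.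
Qed.

Lemma Ck_comp k U V (F : 'rV[R]_m -> R^o) (G : 'rV[R]_n -> 'rV[R]_m) :
  open U -> open V -> (forall x, U x -> V (G x)) ->
  Ck k V F -> Ck k U G -> Ck k U (F \o G).
Proof.
move=> Uo Vo UV; elim: k F => [|k IH] F CF CG; (split;
  [by move=> x Ux; apply: continuous_comp;
    [exact: Ck_continuous CG Ux|exact: Ck_continuous CF (UV _ Ux)]|]) => // i.
have D x : U x -> is_derive x (delta_mx 0 i) (F \o G)
   (\sum_j 'D_(delta_mx 0 i) G x 0 j * 'D_(delta_mx 0 j) F (G x)).
  move=> Ux; apply/derive_at_line.
  have /derive_at_line D1 : is_derive x (delta_mx 0 i) G ('D_(delta_mx 0 i) G x).
    by have [_ /(_ i)[dGi _]] := CG; split => //; exact: dGi.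
  have := @Ck1_is_derive _ _ V F _ 0 _ Vo _ (Ck_mono _ CF) D1.
  by rewrite scale0r add0r; apply => //; exact: UV.
split; first by move=> x /D [].
have [_ /(_ i)[dGi CGi]] := CG.
have C : Ck k U (fun x => \sum_j ('D_(delta_mx 0 i) G x 0 j : R^o) * 'D_(delta_mx 0 j) F (G x)).
  apply: (@Ck_sum _ _ _ _ _ _ (fun j x => ('D_(delta_mx 0 i) G x 0 j : R^o) * 'D_(delta_mx 0 j) F (G x))) => // j.
  apply: CkM => //; first exact: Ck_coord.
  by have [_ /(_ j)[_ CFj]] := CF; apply: IH CFj (Ck_le CG).
by apply: (Ck_ext Uo) C => x /D Dx; rewrite derive_val.
Qed.

End CkComp.

(** * Flat functions and Hadamard's lemma *)

Section FlatFunction.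
Variable R : realType.

Lemma is_derive0_square (f : R -> R^o) (C : R) :
  (forall t, `|f t| <= C * t ^+ 2) -> is_derive (0 : R) 1 f 0.
Proof.
move=> fC.
have f0 : f 0 = 0 by apply/eqP; rewrite -normr_le0 (le_trans (fC 0))// expr0n/= mulr0.
have L : (fun h : R => h^-1 *: ((f \o shift 0) (h *: (1 : R^o)) - f 0)) @ 0^' --> (0 : R^o).
  apply/cvgrPdist_le => e e0.
  have C0 : 0 <= C by have := le_trans (normr_ge0 _) (fC 1); rewrite expr1n mulr1.
  near=> h.
  have h0 : h != 0 by near: h; exact: nbhs_dnbhs_neq.
  rewrite /= f0 subr0 sub0r normrN addr0 [h *: 1]mulr1 normrM normfV.
  rewrite ler_pdivrMl ?normr_gt0// (le_trans (fC h))//.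
  rewrite -(ger0_norm (sqr_ge0 h)) expr2 normrM mulrCA ler_wpM2l//.
  have : `|h| < e / (C + 1) by near: h; apply: dnbhs0_lt; rewrite divr_gt0// ltr_wpDl.
  rewrite ltr_pdivlMr ?ltr_wpDl// => /ltW; apply: le_trans.
  by rewrite mulrDr mulr1 mulrC lerDl.
by split; [apply/cvg_ex; exists 0|apply: cvg_lim].
Unshelve. all: by end_near. Qed.

(** The polynomial factor makes this family closed under differentiation, so all derivatives of
    exp(-1/t) are handled by one lemma. *)
Definition flat (P : {poly R}) (t : R) : R^o :=
  if 0 < t then P.[t^-1] * expR (- t^-1) else 0.

(** Each monomial is compared with one term of the exponential series; the factorial in the constant
    is larger than necessary. *)
Lemma expR_poly_bound (P : {poly R}) :
  exists C, forall y, 0 < y -> `|P.[y]| * expR (- y) <= C.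
Proof.
exists (\sum_(i < size P) `|P`_i| * i.+1`!%:R) => y y0.
rewrite horner_coef.
apply: (@le_trans _ _ ((\sum_(i < size P) `|P`_i| * y ^+ i) * expR (- y))).
  rewrite ler_wpM2r ?expR_ge0// (le_trans (ler_norm_sum _ _ _))//.
  by apply: ler_sum => i _; rewrite normrM normrX (ger0_norm (ltW y0)).
rewrite mulr_suml; apply: ler_sum => i _; rewrite -mulrA ler_wpM2l//.
rewrite expRN ler_pdivrMr ?expR_gt0//.
case: (nat_of_ord i) => [|k].
  rewrite expr0 mul1r; apply: le_trans (expR_ge1Dx y).
  by rewrite lerDl ltW.
have := expR_ge1Dxn k (ltW y0) => h.
have : y ^+ k.+1 / k.+1`!%:R <= expR y by apply: le_trans h; rewrite lerDr.
rewrite ler_pdivrMr ?ltr0n ?fact_gt0// => /le_trans; apply.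
rewrite mulrC ler_wpM2r ?expR_ge0// ler_nat.
by rewrite [leqRHS]factS leq_pmull.
Qed.

Lemma is_derive_flat (P : {poly R}) (t : R) :
  is_derive t 1 (flat P) (flat ('X^2 * (P - P^`())) t).
Proof.
have [t0|t0|<-] := ltgtP 0 t.
- have tn0 : t != 0 by rewrite gt_eqF.
  apply: (@near_eq_is_derive _ _ _ (fun s : R => P.[s^-1] * expR (- s^-1) : R^o)).
    near=> s; rewrite /flat ifT//; near: s; exact: lt_nbhsr.
  rewrite /flat t0.
  have dV : is_derive t 1 (fun s : R => s^-1 : R^o) (- t ^- 2).
    split; first exact: derivableV.
    by rewrite deriveV// derive_id [_ *: _]mulr1.
  have dP : is_derive t 1 (fun s : R => P.[s^-1] : R^o) (P^`().[t^-1] * - t ^- 2).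
    by apply: (@is_derive1_comp _ (horner P) (fun s : R => s^-1 : R^o)).
  have dE : is_derive t 1 (fun s : R => expR (- s^-1) : R^o) (expR (- t^-1) * t ^- 2).
    apply: (@is_derive1_comp _ expR (fun s : R => - s^-1 : R^o)).
    by rewrite -[t ^- 2]opprK; exact: is_deriveN.
  have := is_deriveM dP dE.
  rewrite /GRing.scale/= => H; apply: (is_derive_eq H).
  by rewrite hornerM hornerXn hornerD hornerN exprVn; ring.
- apply: (@near_eq_is_derive _ _ _ (cst (0 : R^o))).
    near=> s; rewrite /flat ifF//; apply/negbTE; rewrite -leNgt ltW//.
    near: s; exact: lt_nbhsl.
  by rewrite /flat ltNge (ltW t0)/=; exact: is_derive_cst.
(* With y = 1/s, the extra factor ['X^2] turns the bound into |P(1/s)| exp(-1/s) <= C s^2, and a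
   function of quadratic size has derivative 0 at the origin. *)
- have [C HC] := expR_poly_bound ('X^2 * P).
  rewrite {2}/flat ltxx; apply: (@is_derive0_square _ (Num.max C 0)) => s.
  rewrite /flat; case: ifP => [s0|_]; last first.
    by rewrite normr0 mulr_ge0 ?sqr_ge0// le_max lexx orbT.
  have := HC s^-1; rewrite invr_gt0 => /(_ s0).
  rewrite hornerM hornerXn normrM exprVn normfV (ger0_norm (sqr_ge0 s)) => h.
  rewrite normrM (ger0_norm (expR_ge0 _)).
  have : `|P.[s^-1]| * expR (- s^-1) <= C * s ^+ 2.
    by rewrite -ler_pdivrMr ?exprn_gt0// mulrC mulrA.
  move=> /le_trans; apply; rewrite ler_wpM2r ?sqr_ge0// le_max lexx//.
Unshelve. all: by end_near. Qed.

Fixpoint flat_poly (k : nat) : {poly R} :=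
  if k is k'.+1 then 'X^2 * (flat_poly k' - (flat_poly k')^`()) else 1.

Definition theta (t : R) : R^o := flat (flat_poly 0) t.

Lemma thetaE t : theta t = if 0 < t then expR (- t^-1) else 0.
Proof. by rewrite /theta /flat hornerC mul1r. Qed.

Lemma theta_gt0 t : 0 < t -> 0 < theta t.
Proof. by move=> t0; rewrite thetaE t0 expR_gt0. Qed.

Lemma theta_ge0 t : 0 <= theta t.
Proof. by rewrite thetaE; case: ifP => // _; exact: expR_ge0. Qed.

Lemma theta_eq0 t : t <= 0 -> theta t = 0.
Proof. by rewrite thetaE ltNge => ->. Qed.

Lemma theta_lt s t : 0 < s -> s < t -> theta s < theta t.
Proof.
move=> s0 st; have t0 := lt_trans s0 st.
by rewrite !thetaE s0 t0 ltr_expR ltrN2 ltf_pV2.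
Qed.

Lemma theta_inj s t : 0 < theta s -> theta s = theta t -> s = t.
Proof.
rewrite !thetaE; case: ifPn => [s0 _|_]; last by rewrite ltxx.
case: ifPn => [t0 /expR_inj/oppr_inj/invr_inj//|_ E].
by have := expR_gt0 (- s^-1); rewrite E ltxx.
Qed.

(** The formula also covers t <= 0: [theta] vanishes there, whatever the value of the inverse. *)
Lemma is_derive_theta (t : R) : is_derive t 1 theta (t ^- 2 * theta t).
Proof.
apply: is_derive_eq (is_derive_flat _ _) _.
rewrite thetaE /flat; case: ifP => [t0|]; last by rewrite mulr0.
by rewrite /= derivC subr0 mulr1 hornerXn exprVn.
Qed.

Lemma Ck_theta n k (U : set 'rV[R]_n) (F : 'rV[R]_n -> R^o) : open U ->
  Ck k U F -> Ck k U (theta \o F).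
Proof.
move=> Uo; apply: (@Ck_comp1 _ _ _ _ (fun j => flat (flat_poly j)) 0%N) => // j t.
exact: is_derive_flat.
Qed.

End FlatFunction.

Section Primitive.
Variable R : realType.
Local Notation mu := (@lebesgue_measure R).

(* Normalised at 0; a primitive of v on ]-2, 2[ only. *)
Definition prim (v : R -> R) (t : R) : R^o :=
  (\int[mu]_(x in `[-2%R, t]) v x - \int[mu]_(x in `[-2%R, 0%R]) v x)%R.

Lemma prim0 v : prim v 0 = 0.
Proof. by rewrite /prim subrr. Qed.

Lemma is_derive_prim (v : R -> R) (t : R) : continuous v -> -2 < t < 2 ->
  is_derive t 1 (prim v) (v t).
Proof.
move=> vc /andP[t1 t2].
have vi : mu.-integrable `[-2, 2]%classic (EFin \o v).
  apply: continuous_compact_integrable; first exact: segment_compact.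
  exact: continuous_subspaceT.
have [d1 d2] := continuous_FTC1_closed t2 vi t1 (vc t).
rewrite -[v t]subr0; apply: is_deriveB.
by apply: DeriveDef; [exact: d1|rewrite -derive1E].
Qed.

End Primitive.

Section Hadamard.
Variables (R : realType) (n : nat).
Local Notation e_ i := (delta_mx 0 i : 'rV[R]_n).
Implicit Types (U : set 'rV[R]_n) (F : 'rV[R]_n -> R^o).

Definition clamp01 (t : R) : R := Num.max 0 (Num.min 1 t).

Lemma clamp01_id t : 0 <= t <= 1 -> clamp01 t = t.
Proof. by move=> /andP[t0 t1]; rewrite /clamp01 min_r// max_r. Qed.

Lemma clamp01_itv t : 0 <= clamp01 t <= 1.
Proof. by rewrite le_max lexx/= ge_max ler01 ge_min lexx. Qed.

Lemma clamp01_continuous : continuous clamp01.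
Proof.
move=> t; apply: continuous_max; first exact: cst_continuous.
by apply: continuous_min; [exact: cst_continuous|].
Qed.

(* The clamp makes integrands along the segment from a to y continuous on the whole line. *)
Definition ray (a y : 'rV[R]_n) (t : R) : 'rV[R]_n := clamp01 t *: (y - a) + a.

Lemma ray_continuous2 a (y : 'rV[R]_n) t :
  ray a z.1 z.2 @[z --> (y, t)] --> ray a y t.
Proof.
apply: cvgD; last exact: cvg_cst.
apply: cvgZ; last by apply: cvgB; [exact: cvg_fst|exact: cvg_cst].
by apply: cvg_comp; [exact: cvg_snd|exact: clamp01_continuous].
Qed.

Lemma ray_continuous a y : continuous (ray a y).
Proof.
move=> t; apply: cvgD; last exact: cvg_cst.
by apply: cvgZr_tmp; exact: clamp01_continuous.
Qed.

Definition star a U := forall y t, U y -> U (ray a y t).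

(** This is the integral over [0, 1] of t^m F(a + t(y - a)). Each differentiation in y brings out a
    factor t, so the weights t^m make the family stable under partial derivatives. *)
Definition ray_mean a m F y : R^o := prim (fun t => clamp01 t ^+ m * F (ray a y t)) 1.

Lemma ray_integrand_continuous a m F U y : star a U ->
  (forall x, U x -> {for x, continuous F}) -> U y ->
  continuous (fun t => clamp01 t ^+ m * F (ray a y t)).
Proof.
move=> aU cF Uy t; apply: cvgM.
  by apply: (@continuous_comp _ _ _ clamp01 (fun s => s ^+ m)); [exact: clamp01_continuous|exact: exprn_continuous].
apply: (@continuous_comp _ _ _ (ray a y) F); first exact: ray_continuous.
by apply: cF; exact: aU.
Qed.

Lemma is_derive_mulr_cst (c t : R) : is_derive t 1 (fun s : R => s * c : R^o) c.
Proof.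
rewrite (_ : (fun _ => _) = c *: (id : R -> R^o)); last first.
  by apply/funext => s; rewrite /GRing.scale/= mulrC.
by apply: is_derive_eq; rewrite /GRing.scale/= mulr1.
Qed.

Lemma is_derive_affine (v x : 'rV[R]_n) (t : R) : is_derive t 1 (fun s : R => s *: v + x) v.
Proof.
have := @is_derive_line R _ _ id x v t; rewrite derive_id; apply.
exact: derivable_id.
Qed.

Lemma is_derive_ray_prim a m F U y (t : R) : star a U ->
  (forall x, U x -> {for x, continuous F}) -> U y -> 0 <= t <= 1 ->
  is_derive t 1 (prim (fun s => clamp01 s ^+ m * F (ray a y s)) : R -> R^o)
    (t ^+ m * F (t *: (y - a) + a)).
Proof.
move=> aU cF Uy t01.
have E : ray a y t = t *: (y - a) + a by rewrite /ray clamp01_id.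
rewrite -E -[t in t ^+ m](clamp01_id t01).
apply: is_derive_prim; first exact: ray_integrand_continuous aU cF Uy.
by case/andP: t01 => t0 t1; apply/andP; split; lra.
Qed.

(** Tube lemma: compactness of [0, 1] turns pointwise neighbourhoods into a uniform one. *)
Lemma near_segment (I : Type) (F : set_system I) (P : I -> R -> Prop) : Filter F ->
  (forall t : R, 0 <= t <= 1 -> \forall s \near t & i \near F, P i s) ->
  \forall i \near F, forall t : R, 0 <= t <= 1 -> P i t.
Proof.
move=> FF HP.
have := (@compact_near_coveringP R `[0, 1]%classic).1 (@segment_compact R 0 1).
move=> /(_ I F P FF) H.
have : \near F, `[0, 1]%classic `<=` P F.
  by apply: H => x; rewrite /= in_itv/=; exact: HP.
by apply: filterS => i Pi t t01; apply: Pi; rewrite /= in_itv.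
Qed.

Lemma ray_mean_continuous a m F U y : open U -> star a U ->
  (forall x, U x -> {for x, continuous F}) -> U y ->
  {for y, continuous (ray_mean a m F)}.
Proof.
move=> Uo aU cF Uy; apply: (@cvgrPdist_le R R^o 'rV[R]_n (nbhs y) (nbhs_filter y) _ _).2 => e e0.
have e20 : 0 < e / 2 by rewrite divr_gt0.
have H : \forall z \near y, forall t : R, 0 <= t <= 1 -> `|F (ray a y t) - F (ray a z t)| <= e.
  apply: (@near_segment _ (nbhs y) (fun z t => `|F (ray a y t) - F (ray a z t)| <= e) (nbhs_filter y)) => t _.
  have c2 : F (ray a z.1 z.2) @[z --> (y, t)] --> F (ray a y t).
    apply: (@cvg_comp _ _ _ _ F _ (nbhs (ray a y t))); first exact: ray_continuous2.
    by apply: cF; exact: aU.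
  have c1 : F (ray a y s) @[s --> t] --> F (ray a y t).
    apply: (@continuous_comp _ _ _ (ray a y) F); first exact: ray_continuous.
    by apply: cF; exact: aU.
  move/cvgrPdist_le : c2 => /(_ _ e20) [/= [A B] [nA nB] AB].
  move/cvgrPdist_le : c1 => /(_ _ e20) nC.
  exists ([set s | B s /\ `|F (ray a y t) - F (ray a y s)| <= e / 2], A) => /=.
    by split => //; apply: filterI.
  move=> [s z] /= [[Bs h1] Az].
  have := AB (z, s) (conj Az Bs) => /= h2.
  rewrite (splitr e); apply: (le_trans (ler_distD (F (ray a y t)) _ _)).
  by apply: lerD; [rewrite distrC; exact: h1|exact: h2].
near=> z.
have Uz : U z by near: z; exact: open_nbhs_nbhs.
have Hz (t : R) : 0 <= t <= 1 -> `|F (ray a y t) - F (ray a z t)| <= e.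
  by move: t; near: z.
(* The two integrals are compared as primitives: the difference of the integrands, already at most
   [e], is the derivative of [G], so the mean value inequality replaces an estimate of integrals. *)
pose G t : R^o := prim (fun t => clamp01 t ^+ m * F (ray a y t)) t - prim (fun t => clamp01 t ^+ m * F (ray a z t)) t.
have := @mean_value_le R G (fun t => t ^+ m * F (t *: (y - a) + a) - t ^+ m * F (t *: (z - a) + a)) 0 1 e.
rewrite /G !prim0 !subr0 mulr1; apply => // t t01.
  by apply: is_deriveB; apply: is_derive_ray_prim aU cF _ t01.
have /andP[t0 t1] := t01.
rewrite -mulrBr normrM -[leRHS]mul1r; apply: ler_pM => //; last first.
  by have := Hz t t01; rewrite /ray clamp01_id.
by rewrite ger0_norm ?exprn_ge0// exprn_ile1.
Unshelve. all: by end_near. Qed.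

(** Differentiation under the integral sign, by two nested mean value inequalities: one in the
    parameter of the segment, one in the direction [e_ j]. *)
Lemma is_derive_ray_mean a m F U y j : open U -> star a U -> Ck 1 U F -> U y ->
  is_derive y (e_ j) (ray_mean a m F) (ray_mean a m.+1 (fun x => 'D_(e_ j) F x) y).
Proof.
move=> Uo aU CF Uy.
have [cF /(_ j)[dF [cdF _]]] := CF.
apply/derive_at_line.
have near0 (e : R) : 0 < e -> \forall h \near (0 : R), forall t : R, 0 <= t <= 1 ->
    U (h *: e_ j + ray a y t) /\ `|'D_(e_ j) F (h *: e_ j + ray a y t) - 'D_(e_ j) F (ray a y t)| <= e.
  move=> e0; apply: (@near_segment _ (nbhs (0 : R)) (fun h t => U (h *: e_ j + ray a y t) /\
    `|'D_(e_ j) F (h *: e_ j + ray a y t) - 'D_(e_ j) F (ray a y t)| <= e) (nbhs_filter (0 : R))) => t _.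
  have e20 : 0 < e / 2 by rewrite divr_gt0.
  have Ur := aU y t Uy.
  have cr : (z.2 *: e_ j + ray a y z.1) @[z --> (t, 0 : R)] --> ray a y t.
    have -> : ray a y t = 0 *: e_ j + ray a y t by rewrite scale0r add0r.
    apply: cvgD; first by apply: cvgZr_tmp; exact: cvg_snd.
    by apply: cvg_comp; [exact: cvg_fst|exact: ray_continuous].
  have nU : \forall x \near ray a y t, U x /\ `|'D_(e_ j) F (ray a y t) - 'D_(e_ j) F x| <= e / 2.
    apply: filterI; first exact: open_nbhs_nbhs.
    have /cvgrPdist_le : 'D_(e_ j) F x @[x --> ray a y t] --> 'D_(e_ j) F (ray a y t) by exact: cdF.
    exact.
  have /cr := nU; rewrite nbhs_simpl/= => -[[A B] [/= nA nB] AB].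
  exists (A, B) => //= -[s h] /= [As Bh].
  have := AB (s, h) (conj As Bh) => /= -[Ush h1].
  have /= := AB (s, 0) (conj As (nbhs_singleton nB)); rewrite scale0r add0r => -[_ h2].
  split => //; rewrite (splitr e); apply: (le_trans (ler_distD ('D_(e_ j) F (ray a y t)) _ _)).
  by apply: lerD; [rewrite distrC; exact: h1|exact: h2].
have L : (fun h : R => h^-1 *: (((fun h : R => ray_mean a m F (h *: e_ j + y)) \o shift 0) (h *: (1 : R^o))
   - ray_mean a m F (0 *: e_ j + y))) @ 0^' --> (ray_mean a m.+1 (fun x => 'D_(e_ j) F x) y : R^o).
  apply: (@cvgrPdist_le R R^o R (0^')%classic _ _ _).2 => e e0.
  have [d /= d0 Hd] := (nbhs_ballP _ _).1 (near0 e e0).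
  near=> h.
  have h0 : h != 0 by near: h; exact: nbhs_dnbhs_neq.
  have hd : `|h| < d by near: h; apply: dnbhs0_lt.
  have Uh : U (h *: e_ j + y).
    have := (Hd h _ 1 _).1; rewrite -ball_normE/= sub0r normrN => /(_ hd).
    by rewrite ler01 lexx /ray clamp01_id ?ler01 ?lexx// scale1r subrK => /(_ isT).
  rewrite /= addr0 [h *: 1]mulr1 scale0r add0r.
  rewrite -[X in X - _](scalerK h0) -scalerBr normrZ normfV ler_pdivrMl ?normr_gt0//.
  (* Its value at 1 is the error of the linear approximation, multiplied by h; it suffices to bound
     its derivative by |h| e. *)
  pose G t : R^o := h * prim (fun t => clamp01 t ^+ m.+1 * 'D_(e_ j) F (ray a y t)) t -
     (prim (fun t => clamp01 t ^+ m * F (ray a (h *: e_ j + y) t)) t - prim (fun t => clamp01 t ^+ m * F (ray a y t)) t).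
  have := @mean_value_le R G (fun t => h * (t ^+ m.+1 * 'D_(e_ j) F (t *: (y - a) + a))
     - (t ^+ m * F (t *: (h *: e_ j + y - a) + a) - t ^+ m * F (t *: (y - a) + a))) 0 1 (`|h| * e) ler01.
  rewrite /G !prim0 mulr0 !subr0 mulr1; apply => // t t01.
    apply: is_deriveB; last first.
      by apply: is_deriveB; apply: is_derive_ray_prim aU cF _ t01.
    by apply: (@is_deriveZ R R^o R^o _ h); apply: is_derive_ray_prim cdF _ _.
  have [t0 t1] := andP t01.
  have rE : ray a y t = t *: (y - a) + a by rewrite /ray clamp01_id.
  rewrite (_ : t *: (h *: e_ j + y - a) + a = (h * t) *: e_ j + ray a y t); last first.
    by rewrite rE -addrA scalerDr scalerA mulrC addrA.
  rewrite -rE (_ : _ - _ = t ^+ m * ((h * t) * 'D_(e_ j) F (ray a y t) - (F ((h * t) *: e_ j + ray a y t) - F (ray a y t)))); last first.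
    by rewrite exprS; ring.
  (* Moving y by h moves the point at parameter t by h t only; this is the origin of the extra
     factor t in [ray_mean a m.+1]. *)
  pose g (s : R) : R^o := s * 'D_(e_ j) F (ray a y t) - F (s *: e_ j + ray a y t).
  have hth : `|h * t| <= `|h| by rewrite normrM ler_piMr// ger0_norm.
  have : `|g (h * t) - g 0| <= e * `|h * t|.
    apply: (@mean_value_le0 R g (fun s => 'D_(e_ j) F (ray a y t) - 'D_(e_ j) F (s *: e_ j + ray a y t))) => s sht.
      apply: is_deriveB; first exact: is_derive_mulr_cst.
      apply: is_derive_line; apply: dF.
      apply: (Hd s _ t t01).1; rewrite -ball_normE/= sub0r normrN.
      by rewrite (le_lt_trans sht)// (le_lt_trans hth).
    rewrite distrC; apply: (Hd s _ t t01).2; rewrite -ball_normE/= sub0r normrN.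
    by rewrite (le_lt_trans sht)// (le_lt_trans hth).
  rewrite /g mul0r scale0r !add0r opprK => gb.
  rewrite normrM (@le_trans _ _ (1 * (e * `|h * t|)))//.
    apply: ler_pM => //; first by rewrite ger0_norm ?exprn_ge0// exprn_ile1.
    by rewrite opprB (addrC (F (ray a y t))) addrA.
  by rewrite mul1r mulrC ler_wpM2r// ltW.
split; [by apply/cvg_ex; eexists; exact: L|exact: cvg_lim L].
Unshelve. all: by end_near. Qed.

Lemma Ck_ray_mean k a m F U : open U -> star a U -> Ck k U F -> Ck k U (ray_mean a m F).
Proof.
move=> Uo aU; elim: k m F => [|k IH] m F CF.
  by split => // x Ux; apply: ray_mean_continuous Ux => //; case: CF.
split; first by move=> x Ux; apply: ray_mean_continuous Ux => //; case: CF.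
move=> i.
have D x : U x -> is_derive x (e_ i) (ray_mean a m F) (ray_mean a m.+1 (fun x => 'D_(e_ i) F x) x).
  by move=> Ux; apply: is_derive_ray_mean Ux => //; exact: Ck_mono CF.
split; first by move=> x /D[].
have [_ /(_ i)[_ CFi]] := CF.
by apply: (Ck_ext Uo) (IH m.+1 _ CFi) => x /D Dx; rewrite derive_val.
Qed.

(** F(y) - F(a) is the integral of the derivative of F along the segment from a to y. By the chain
    rule the factors (y - a)_i come out, and H_i is the mean of the i-th partial derivative along
    the segment. *)
Lemma hadamard a F U : open U -> star a U -> U a -> smooth_on U F ->
  exists H : 'I_n -> 'rV[R]_n -> R^o,
  [/\ forall i, smooth_on U (H i),
      forall i, H i a = 'D_(e_ i) F a &
      forall y, U y -> F y = F a + \sum_i (y - a) 0 i * H i y].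
Proof.
move=> Uo aU Ua SF.
have CF : Ck 1 U F := SF 1%N.
have cdF i x : U x -> {for x, continuous ('D_(e_ i) F)} by have [_ /(_ i)[_ [+ _]]] := CF; apply.
have mul1t (t c : R) : t ^+ 0 * c = c by rewrite expr0 mul1r.
exists (fun i => ray_mean a 0 ('D_(e_ i) F)); split.
- by move=> i k; apply: Ck_ray_mean => //; have [_ /(_ i)[]] := SF k.+1.
- move=> i; apply/eqP; rewrite -subr_eq0 -normr_le0.
  have := @mean_value_le R (fun t : R => prim (fun s => clamp01 s ^+ 0 * 'D_(e_ i) F (ray a a s)) t - t * 'D_(e_ i) F a : R^o) (fun=> 0) 0 1 0 ler01.
  rewrite prim0 !mul0r !mul1r !subr0; apply=> // t t01; last by rewrite normr0.
  rewrite -(subrr ('D_(e_ i) F a)); apply: is_deriveB; last exact: is_derive_mulr_cst.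
  have := is_derive_ray_prim 0 aU (cdF i) Ua t01.
  by rewrite mul1t subrr scaler0 add0r.
move=> y Uy.
(* The chain rule and the primitives give [G] derivative 0 on [0, 1], so [G 1 = G 0] is the required
   identity. *)
pose G (t : R) : R^o := F (t *: (y - a) + a) - \sum_i (y - a) 0 i * prim (fun s => clamp01 s ^+ 0 * 'D_(e_ i) F (ray a y s)) t.
have : `|G 1 - G 0| <= 0 * (1 - 0).
  apply: (@mean_value_le R G (fun=> 0)) => // t t01; last by rewrite normr0.
  rewrite -(subrr (\sum_i (y - a) 0 i * 'D_(e_ i) F (t *: (y - a) + a))).
  apply: is_deriveB.
    apply: (@Ck1_is_derive _ _ U F (fun s : R => s *: (y - a) + a)) => //.
      by have := aU y t Uy; rewrite /ray clamp01_id.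
    exact: is_derive_affine.
  rewrite [X in is_derive _ _ X _](_ : _ = \sum_i (fun s => (y - a) 0 i * prim (fun s => clamp01 s ^+ 0 * 'D_(e_ i) F (ray a y s)) s : R^o)); last first.
    by apply/funext => s; rewrite fct_sumE.
  apply: is_derive_sum => i; apply: (@is_deriveZ R R^o R^o _ ((y - a) 0 i)).
  by have := is_derive_ray_prim 0 aU (cdF i) Uy t01; rewrite mul1t.
rewrite mul0r normr_le0 subr_eq0 /G scale1r scale0r subrK add0r => /eqP E.
apply/eqP; rewrite -subr_eq; apply/eqP; rewrite E.
rewrite big1 ?subr0// => i _; by rewrite prim0 mulr0.
Qed.

End Hadamard.

(** * Picard iteration *)

Lemma near_norm_lt (R : realType) (e t : R) : `|t| < e -> \forall s \near t, `|s| < e.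
Proof.
rewrite ltr_norml => /andP[h1 h2]; near=> s; rewrite ltr_norml.
by apply/andP; split; near: s; [exact: lt_nbhsr|exact: lt_nbhsl].
Unshelve. all: by end_near. Qed.

Lemma max_lip (R : realType) (d a b : R) : `|Num.max d a - Num.max d b| <= `|a - b|.
Proof.
by case: (leP d a) => ?; case: (leP d b) => ?; rewrite ler_norml; case: (ger0P (a - b)) => ?;
  apply/andP; split; lra.
Qed.

Lemma min_lip (R : realType) (d a b : R) : `|Num.min d a - Num.min d b| <= `|a - b|.
Proof.
by case: (leP d a) => ?; case: (leP d b) => ?; rewrite ler_norml; case: (ger0P (a - b)) => ?;
  apply/andP; split; lra.
Qed.

Lemma clamp_lip (R : realType) (d a b : R) :
  `|Num.max (- d) (Num.min d a) - Num.max (- d) (Num.min d b)| <= `|a - b|.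
Proof. exact: le_trans (max_lip _ _ _) (min_lip _ _ _). Qed.

Section Picard.
Variable R : realType.

Lemma geometric_lt (C e : R) : 0 < e -> exists N : nat, C / 2 ^+ N < e.
Proof.
move=> e0; pose N := Num.bound `|C / e|; exists N.
have HN : C / e < N%:R := le_lt_trans (ler_norm _) (archi_boundP (normr_ge0 _)).
rewrite ltr_pdivrMr ?exprn_gt0// mulrC -ltr_pdivrMr//.
by apply: lt_trans HN _; rewrite -natrX ltr_nat; exact: ltn_expl.
Qed.

Lemma geometric_limit (W : completeNormedModType R) (u : nat -> W) (C : R) :
  (forall k, `|u k.+1 - u k| <= C / 2 ^+ k) ->
  exists l, forall k, `|l - u k| <= 2 * C / 2 ^+ k.
Proof.
move=> uC.
have C0 : 0 <= C by have := le_trans (normr_ge0 _) (uC 0%N); rewrite expr0 divr1.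
have D k m : `|u (k + m)%N - u k| <= 2 * C / 2 ^+ k - 2 * C / 2 ^+ (k + m).
  elim: m => [|m IH]; first by rewrite addn0 !subrr normr0.
  rewrite addnS; apply: (le_trans (ler_distD (u (k + m)%N) _ _)).
  apply: le_trans (lerD (uC _) IH) _.
  rewrite (_ : 2 * C / 2 ^+ (k + m).+1 = C / 2 ^+ (k + m)); first by lra.
  by rewrite exprS invfM; field; rewrite expf_neq0.
have B k m : (k <= m)%N -> `|u m - u k| <= 2 * C / 2 ^+ k.
  move=> /subnKC <-; apply: le_trans (D _ _) _.
  by rewrite gerBl divr_ge0 ?mulr_ge0 ?exprn_ge0.
have : cvg (u @ \oo).
  apply/cauchy_cvgP/cauchy_exP => e e0.
  have [N HN] := geometric_lt (2 * C) e0.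
  exists (u N); exists N => //= m Nm; rewrite -ball_normE/= distrC.
  exact: le_lt_trans (B _ _ Nm) HN.
move=> ul; exists (lim (u @ \oo)) => k.
apply/ler_addgt0Pr => e e0.
move/cvgrPdist_le : ul => /(_ e e0) [N _ HN].
apply: (le_trans (ler_distD (u (maxn N k)) _ _)).
rewrite addrC lerD//; first by apply: B; rewrite leq_maxr.
by apply: HN; rewrite /= leq_maxl.
Qed.

Variables (n : nat) (V : 'rV[R]_n -> 'rV[R]_n) (L K T : R).
Hypothesis V_lip : forall x y, `|V x - V y| <= L * `|x - y|.
Hypothesis V_bnd : forall x, `|V x| <= K.
Hypothesis T_gt0 : 0 < T.
Hypothesis T_le1 : T <= 1.
Hypothesis LT : L * T <= 2^-1.
Hypothesis L_ge0 : 0 <= L.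

Let cl (t : R) : R := Num.max (- T) (Num.min T t).

Let cl_itv t : - T <= cl t <= T.
Proof. by rewrite le_max lexx/= ge_max ge_min lexx andbT; have := T_gt0; lra. Qed.

Let cl_id t : `|t| <= T -> cl t = t.
Proof. by rewrite ler_norml => /andP[t0 t1]; rewrite /cl min_r// max_r. Qed.

Let cl_lip s t : `|cl s - cl t| <= `|s - t|.
Proof. exact: clamp_lip. Qed.

(** The integral operator of the equation. Clamping time to [-T, T] makes all estimates hold for
    every t, and T <= 1 keeps [prim] in the range where it is a primitive. *)
Definition picard_step (Y : R -> 'rV[R]_n -> 'rV[R]_n) (t : R) (x : 'rV[R]_n) : 'rV[R]_n :=
  x + \row_i prim (fun s => V (Y s x) 0 i) (cl t).

(** Bounds preserved by the iteration. The constant 2 is stable because one step gives 1 + 2 L T,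
    and L T <= 1/2. *)
Let good (Y : R -> 'rV[R]_n -> 'rV[R]_n) :=
  (forall s t x, `|Y s x - Y t x| <= K * `|s - t|) /\
  (forall t x y, `|Y t x - Y t y| <= 2 * `|x - y|).

Let K_ge0 : 0 <= K.
Proof. exact: le_trans (normr_ge0 _) (V_bnd 0). Qed.

Let lip_continuous (f : R -> 'rV[R]_n) (C : R) :
  (forall s t, `|f s - f t| <= C * `|s - t|) -> continuous f.
Proof.
move=> fC t.
have C0 : 0 <= C by have := le_trans (normr_ge0 _) (fC 1 0); rewrite subr0 normr1 mulr1.
apply/cvgrPdist_le => e e0; near=> s.
apply: le_trans (fC _ _) _.
have : `|t - s| < e / (C + 1).
  by near: s; apply: cvgr_dist_lt => //; rewrite divr_gt0// ltr_wpDl.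
rewrite ltr_pdivlMr ?ltr_wpDl// => /ltW; apply: le_trans.
by rewrite mulrDr mulr1 mulrC lerDl.
Unshelve. all: by end_near. Qed.

Let integrand_continuous Y x i : good Y -> continuous (fun s => V (Y s x) 0 i).
Proof.
move=> [gY _] t.
apply: (@continuous_comp _ _ _ (fun s => V (Y s x)) (fun v : 'rV[R]_n => v 0 i)); last exact: coord_continuous.
apply: (@lip_continuous _ (L * K)) => {}t s.
by rewrite -mulrA; apply: le_trans (V_lip _ _) _; apply: ler_wpM2l.
Qed.

Let in2 (t : R) : `|t| <= T -> -2 < t < 2.
Proof. by rewrite ler_norml => /andP[? ?]; apply/andP; split; have := T_le1; lra. Qed.

Let prim_dist (v w : R -> R) (C : R) t : continuous v -> continuous w -> 
  (forall s : R, `|v s - w s| <= C) -> `|prim v (cl t) - prim w (cl t)| <= C * T.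
Proof.
move=> cv cw vwC.
have clT : `|cl t| <= T by rewrite ler_norml; exact: cl_itv.
have C0 : 0 <= C := le_trans (normr_ge0 _) (vwC 0).
apply: (@le_trans _ _ (C * `|cl t|)); last exact: ler_wpM2l.
rewrite -[X in `|X|]subr0 -[X in _ - X](subrr (prim v 0)).
have := @mean_value_le0 R (fun t => prim v t - prim w t) (fun t => v t - w t) (cl t) C.
rewrite !prim0; apply => // s st.
by apply: is_deriveB; apply: is_derive_prim => //; apply: in2; exact: le_trans clT.
Qed.

Let step_good Y : good Y -> good (picard_step Y).
Proof.
move=> gY; have [gt gx] := gY; split=> [s t x|t x y].
  rewrite /picard_step opprD addrACA subrr add0r.
  apply: norm_le_coord => [|i]; first by rewrite mulr_ge0.
  rewrite !mxE; apply: (@le_trans _ _ (K * `|cl s - cl t|)); last by apply: ler_wpM2l.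
  wlog st : s t / cl t <= cl s => [H|].
    have [/H//|/ltW/H] := leP (cl t) (cl s).
    by rewrite distrC (distrC (cl t)).
  rewrite (ger0_norm (_ : 0 <= cl s - cl t)) ?subr_ge0//.
  apply: (@mean_value_le _ _ (fun s => V (Y s x) 0 i)) => // r /andP[r1 r2].
    apply: is_derive_prim; first exact: integrand_continuous.
    apply: in2; rewrite ler_norml.
    have /andP[+ _] := cl_itv t; have /andP[_ +] := cl_itv s => ? ?.
    by apply/andP; split; lra.
  exact: le_trans (coord_le_norm _ _) (V_bnd _).
rewrite /picard_step opprD addrACA.
apply: (le_trans (ler_normD _ _)).
rewrite mulrDl mul1r lerD2l; apply: norm_le_coord => // i; rewrite !mxE.
apply: (@le_trans _ _ (L * (2 * `|x - y|) * T)).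
  apply: prim_dist; [exact: integrand_continuous|exact: integrand_continuous|] => s.
  have := coord_le_norm (V (Y s x) - V (Y s y)) i; rewrite !mxE => /le_trans; apply.
  by apply: le_trans (V_lip _ _) _; apply: ler_wpM2l.
rewrite mulrAC -[leRHS]mul1r mulrA ler_wpM2r// mulrC; have := LT; lra.
Qed.

Let step_contract Y Z (C : R) : good Y -> good Z -> (forall t x, `|Y t x - Z t x| <= C) ->
  forall t x, `|picard_step Y t x - picard_step Z t x| <= C / 2.
Proof.
move=> gY gZ YZ t x.
have C0 : 0 <= C := le_trans (normr_ge0 _) (YZ 0 0).
rewrite /picard_step opprD addrACA subrr add0r.
apply: norm_le_coord => [|i]; first by rewrite divr_ge0.
rewrite !mxE; apply: (@le_trans _ _ (L * C * T)).
  apply: prim_dist; [exact: integrand_continuous|exact: integrand_continuous|] => s.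
  have := coord_le_norm (V (Y s x) - V (Z s x)) i; rewrite !mxE => /le_trans; apply.
  by apply: le_trans (V_lip _ _) _; apply: ler_wpM2l.
by rewrite mulrAC mulrC ler_wpM2l.
Qed.

(** One step halves the uniform distance between two good families, so the iterates converge
    geometrically and the limit is a fixed point. The Lipschitz bounds in time and in the initial
    point pass to the limit and give joint continuity later. *)
Lemma picard_flow : exists Y : R -> 'rV[R]_n -> 'rV[R]_n,
  [/\ forall x, Y 0 x = x,
      forall s t x, `|Y s x - Y t x| <= K * `|s - t|,
      forall t x y, `|Y t x - Y t y| <= 2 * `|x - y| &
      forall (t : R) x, `|t| < T -> is_derive t 1 (fun s : R => Y s x) (V (Y t x))].
Proof.
pose Yk k := iter k picard_step (fun _ x => x).
have gk k : good (Yk k).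
  elim: k => [|k IH]; last exact: step_good.
  split=> [s t x|t x y]; first by rewrite subrr normr0 mulr_ge0.
  by rewrite ler_peMl// ler1n.
have clT t : `|cl t| <= T by rewrite ler_norml; exact: cl_itv.
have d0 t x : `|Yk 1 t x - Yk 0 t x| <= K.
  rewrite /Yk/= /picard_step addrAC subrr add0r.
  apply: norm_le_coord => // i; rewrite mxE.
  have := @mean_value_le0 R (prim (fun s => V x 0 i)) (fun s => V x 0 i) (cl t) K.
  rewrite prim0 subr0 => H; apply: le_trans (H _ _) _.
  - move=> s st; apply: is_derive_prim; first by move=> ?; exact: cst_continuous.
    by apply: in2; exact: le_trans (clT t).
  - by move=> s _; exact: le_trans (coord_le_norm _ _) (V_bnd _).
  - by rewrite ler_piMr// (le_trans (clT t)).
have dk k t x : `|Yk k.+1 t x - Yk k t x| <= K / 2 ^+ k.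
  elim: k t x => [|k IH] t x; first by rewrite expr0 divr1.
  rewrite (_ : K / 2 ^+ k.+1 = K / 2 ^+ k / 2); last by rewrite exprSr invfM mulrA.
  exact: step_contract (gk k.+1) (gk k) IH t x.
have dki k t x i : `|Yk k.+1 t x 0 i - Yk k t x 0 i| <= K / 2 ^+ k.
  by apply: le_trans (dk k t x); have := coord_le_norm (Yk k.+1 t x - Yk k t x) i; rewrite !mxE.
have ex t x i := @geometric_limit R^o (fun k => Yk k t x 0 i) K (fun k => dki k t x i).
(* The limit is taken coordinate by coordinate in the complete space R, with the same geometric rate
   for all coordinates. *)
pose Y t x : 'rV[R]_n := \row_i projT1 (cid (ex t x i)).
have YE k t x : `|Y t x - Yk k t x| <= 2 * K / 2 ^+ k.
  apply: norm_le_coord => [|i]; first by rewrite divr_ge0 ?mulr_ge0// exprn_ge0.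
  by rewrite !mxE; case: cid => l /=; apply.
have lim0 (e : R) : 0 < e -> exists N, 2 * K / 2 ^+ N <= e.
  by move=> /(geometric_lt (2 * K))[N /ltW]; exists N.
have pass s t x y (C : R) : (forall k, `|Yk k s x - Yk k t y| <= C) -> `|Y s x - Y t y| <= C.
  move=> H; apply/ler_addgt0Pr => e e0.
  have [N HN] := lim0 (e / 2) ltac:(by rewrite divr_gt0).
  apply: (le_trans (ler_distD (Yk N s x) _ _)).
  apply: (@le_trans _ _ (e / 2 + (C + e / 2))); last by lra.
  apply: lerD; first exact: le_trans (YE _ _ _) HN.
  apply: (le_trans (ler_distD (Yk N t y) _ _)).
  apply: lerD; first exact: H.
  by rewrite distrC; exact: le_trans (YE _ _ _) HN.
have gY : good Y.
  by split=> *; apply: pass => k; have [h1 h2] := gk k; [exact: h1|exact: h2].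
have fixY t x : Y t x = picard_step Y t x.
  apply/eqP; rewrite -subr_eq0 -normr_le0; apply/ler_addgt0Pr => e e0; rewrite add0r.
  have [N HN] := lim0 (e / 2) ltac:(by rewrite divr_gt0).
  apply: (le_trans (ler_distD (Yk N.+1 t x) _ _)); rewrite [e]splitr.
  apply: lerD.
    apply: le_trans (YE _ _ _) (le_trans _ HN).
    rewrite ler_wpM2l ?mulr_ge0// lef_pV2 ?posrE ?exprn_gt0//.
    by rewrite exprS ler_peMl ?exprn_ge0// ler1n.
  apply: le_trans (_ : e / 2 / 2 <= _); last by rewrite ler_piMr ?divr_ge0 ?ltW// invf_lt1// ltr1n.
  by apply: step_contract => // ? ?; rewrite distrC; exact: le_trans (YE _ _ _) HN.
exists Y; split.
- move=> x; rewrite fixY /picard_step cl_id ?normr0 ?ltW//.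
  by apply/rowP => i; rewrite !mxE prim0 addr0.
- by move=> *; case: gY.
- by move=> *; case: gY => _; apply.
- move=> t x tT.
  apply: (@near_eq_is_derive _ _ _ (fun s : R => x + \row_i prim (fun r => V (Y r x) 0 i) s)).
    by apply: filterS (near_norm_lt tT) => s sT; rewrite fixY /picard_step cl_id// ltW.
  rewrite -[V _]add0r; apply: is_deriveD.
  have D (i : 'I_1) j : is_derive t 1 (fun s : R => (\row_i prim (fun r => V (Y r x) 0 i) s : 'rV[R]_n) i j : R^o) (V (Y t x) i j).
    rewrite (_ : (fun s => _) = prim (fun r => V (Y r x) 0 j)); last by apply/funext => s; rewrite mxE.
    rewrite (ord1 i); apply: is_derive_prim; first exact: integrand_continuous.
    by apply: in2; exact: ltW.
  have dM : derivable (fun s : R => \row_i prim (fun r => V (Y r x) 0 i) s : 'rV[R]_n) t 1.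
    by apply/derivable_mxP => i j; have [] := D i j.
  by split => //; rewrite derive_mx//; apply/matrixP => i j; rewrite mxE derive_val.
Qed.

End Picard.

(** * Charts and local frames *)

Section Charts.
Variables (R : realType) (n : nat) (T : topologicalType) (c : chart R n T).
Local Notation img := (chart_map c @` chart_dom c).

Lemma chart_map_cts p : chart_dom c p -> {for p, continuous (chart_map c)}.
Proof.
move=> cp; have := @chart_map_continuous R n T c.
by rewrite (continuous_open_subspace _ (chart_dom_open c)) => /(_ p); apply; exact/mem_set.
Qed.

Lemma chart_inv_cts x : img x -> {for x, continuous (chart_inv c)}.
Proof.
move=> cp; have := @chart_inv_continuous R n T c.
by rewrite (continuous_open_subspace _ (@chart_img_open R n T c)) => /(_ x); apply; exact/mem_set.
Qed.

Lemma chart_invK x : img x -> chart_map c (chart_inv c x) = x.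
Proof. by move=> [p cp <-]; rewrite chart_mapK. Qed.

Lemma chart_inv_dom x : img x -> chart_dom c (chart_inv c x).
Proof. by move=> [p cp <-]; rewrite chart_mapK. Qed.

Lemma chart_preimage_open (O : set 'rV[R]_n) : open O ->
  open [set p | chart_dom c p /\ O (chart_map c p)].
Proof.
move=> Oo; rewrite openE => p [cp Op]; apply: filterI.
  by apply: open_nbhs_nbhs; split => //; exact: chart_dom_open.
exact: (chart_map_cts cp (open_nbhs_nbhs (conj Oo Op))).
Qed.

Lemma chart_image_open (W : set T) : open W -> W `<=` chart_dom c -> open (chart_map c @` W).
Proof.
move=> Wo Wc; rewrite openE => _ [p Wp <-].
have ip : img (chart_map c p) by exists p => //; exact: Wc.
have h1 : \forall y \near chart_map c p, img y.
  by apply: open_nbhs_nbhs; split => //; exact: chart_img_open.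
have h2 : \forall y \near chart_map c p, W (chart_inv c y).
  by apply: (chart_inv_cts ip); rewrite chart_mapK; [exact: open_nbhs_nbhs|exact: Wc].
near=> y; exists (chart_inv c y); first by near: y.
by rewrite chart_invK//; near: y.
Unshelve. all: by end_near. Qed.

Lemma chart_inv_compact (K : set 'rV[R]_n) : compact K -> K `<=` img ->
  compact (chart_inv c @` K).
Proof.
move=> Kc Ki; apply: continuous_compact => //.
by apply: continuous_in_subspaceT => x /set_mem/Ki; exact: chart_inv_cts.
Qed.

End Charts.

(** * Cutoffs: from functions on a chart to smooth functions on M *)

Section Extension.
Variables (R : realType) (n : nat) (M : manifold R n).

Lemma smooth_funP (h : M -> R^o) : smooth h -> h \in @smooth_pred R n M.
Proof. by move=> sh; apply/asboolP. Qed.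

Lemma sfun_smooth (h : smooth_fun M) : smooth h.
Proof. by case: h => h /= /asboolP. Qed.

Definition zero_ext (c : chart R n M) (O : set 'rV[R]_n) (F : 'rV[R]_n -> R^o) (p : M) : R^o :=
  if `[< chart_dom c p /\ O (chart_map c p) >] then F (chart_map c p) else 0.

Lemma zero_ext_in c O F p : chart_dom c p -> O (chart_map c p) ->
  zero_ext c O F p = F (chart_map c p).
Proof. by move=> cp Op; rewrite /zero_ext asboolT. Qed.

Lemma zero_ext_out c O F p : ~ (chart_dom c p /\ O (chart_map c p)) -> zero_ext c O F p = 0.
Proof. by move=> cp; rewrite /zero_ext asboolF. Qed.

(** The preimage of O and the complement of the preimage of K are open and cover M. On the first,
    the function is F composed with a chart transition; on the second it is 0. The second set is
    open because compact sets of the Hausdorff space M are closed. *)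
Lemma zero_ext_smooth (c : chart R n M) (O K : set 'rV[R]_n) F : atlas c ->
  open O -> compact K -> K `<=` O -> O `<=` chart_map c @` chart_dom c ->
  smooth_on O F -> (forall x, O x -> ~ K x -> F x = 0) -> smooth (zero_ext c O F).
Proof.
move=> Ac Oo Kc KO Oc SF F0 d Ad k.
pose W1 := chart_dom d `&` [set p | chart_dom c p /\ O (chart_map c p)].
pose W2 := chart_dom d `&` ~` (chart_inv c @` K).
have W1o : open W1 by apply: openI; [exact: chart_dom_open|exact: chart_preimage_open].
have W2o : open W2.
  apply: openI; first exact: chart_dom_open.
  apply: closed_openC; apply: compact_closed; first exact: manifold_hausdorff.
  by apply: chart_inv_compact => // x /KO/Oc.
have -> : chart_map d @` chart_dom d = chart_map d @` W1 `|` chart_map d @` W2.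
  rewrite -image_setU; congr (_ @` _); apply/seteqP; split => [p dp|p [[]|[]]]//.
  have [|nK] := pselect ((chart_inv c @` K) p); last by right.
  move=> [x Kx xp]; left; split => //; have ix := Oc _ (KO _ Kx).
  by rewrite -xp; split; [exact: chart_inv_dom|rewrite /= chart_invK//; exact: KO].
have U1o := chart_image_open W1o (@subIsetl _ _ _).
have U2o := chart_image_open W2o (@subIsetl _ _ _).
apply: CkU.
  have C : Ck k (chart_map d @` W1) (F \o (chart_map c \o chart_inv d)).
    apply: (Ck_comp U1o Oo _ (SF k)); first by move=> _ [p [dp [_ Op]] <-] /=; rewrite chart_mapK.
    apply: Ck_sub (atlas_smooth Ad Ac k); apply: image_subset => p [dp [cp _]]; split => //.
  apply: (Ck_ext U1o) C => _ [p [dp [cp Op]] <-] /=.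
  by rewrite chart_mapK// zero_ext_in.
apply: (Ck_ext U2o) (Ck_cst k (0 : R^o) U2o) => _ [p [dp nK] <-] /=.
rewrite chart_mapK//.
have [[cp Op]|nO] := pselect (chart_dom c p /\ O (chart_map c p)); last by rewrite zero_ext_out.
rewrite zero_ext_in// F0// => Kp; apply: nK; exists (chart_map c p) => //.
by rewrite chart_mapK.
Qed.

End Extension.

Section Bump.
Variables (R : realType) (n : nat).
Local Notation e_ i := (delta_mx 0 i : 'rV[R]_n).

(** The norm of row vectors is the sup norm, which is not smooth; the squared Euclidean distance is
    used wherever smoothness or roundness matters. *)
Definition dist2 (x0 x : 'rV[R]_n) : R^o := \sum_i (x - x0) 0 i ^+ 2.

Definition bump (x0 : 'rV[R]_n) (s : R) (x : 'rV[R]_n) : R^o := theta (s - dist2 x0 x).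

Lemma dist2_ge0 x0 x : 0 <= dist2 x0 x.
Proof. by apply: sumr_ge0 => i _; exact: sqr_ge0. Qed.

Lemma dist2xx x0 : dist2 x0 x0 = 0.
Proof. by rewrite /dist2 big1// => i _; rewrite !mxE subrr expr0n. Qed.

Lemma norm_dist2 x0 x : `|x - x0| ^+ 2 <= dist2 x0 x.
Proof.
rewrite -[leRHS]sqr_sqrtr ?dist2_ge0// lerXn2r ?nnegrE ?sqrtr_ge0//.
apply: norm_le_coord => [|i]; first exact: sqrtr_ge0.
rewrite -sqrtr_sqr ler_wsqrtr// /dist2 (bigD1 i)//= lerDl.
by apply: sumr_ge0 => j _; exact: sqr_ge0.
Qed.

Lemma is_derive_coordB (x0 x : 'rV[R]_n) i j :
  is_derive x (e_ j) (fun x => (x - x0) 0 i : R^o) (i == j)%:R.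
Proof.
have D : is_derive x (e_ j) (fun y : 'rV[R]_n => y - x0) (e_ j).
  by rewrite -[X in is_derive _ _ _ X]subr0; apply: is_deriveB.
by have := is_derive_coord i D; rewrite mxE eqxx.
Qed.

Lemma smooth_coordB (U : set 'rV[R]_n) x0 i : open U -> smooth_on U (fun x => (x - x0) 0 i : R^o).
Proof.
move=> Uo k; apply: (Ck_ext Uo) (CkD Uo (Ck_coord0 k i Uo) (Ck_cst k (- x0 0 i : R^o) Uo)) => x _ /=.
by rewrite !mxE.
Qed.

Lemma smooth_dist2 (U : set 'rV[R]_n) x0 : open U -> smooth_on U (dist2 x0).
Proof.
move=> Uo k; apply: (@Ck_sum _ _ k U _ _ (fun i x => (x - x0) 0 i ^+ 2 : R^o)) => // i.
by apply: (Ck_ext Uo) (CkM Uo (smooth_coordB x0 i Uo k) (smooth_coordB x0 i Uo k)).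
Qed.

Lemma smooth_bump (U : set 'rV[R]_n) x0 s : open U -> smooth_on U (bump x0 s).
Proof.
move=> Uo k; apply: Ck_theta => //.
apply: (Ck_ext Uo) (CkD Uo (Ck_cst k (s : R^o) Uo) (CkM Uo (Ck_cst k (-1 : R^o) Uo) (smooth_dist2 x0 Uo k))) => x _ /=.
by rewrite mulN1r.
Qed.

Lemma open_dist2_lt x0 s : open [set x : 'rV[R]_n | dist2 x0 x < s].
Proof.
have c : continuous (dist2 x0).
  by move=> x; apply: Ck_continuous (smooth_dist2 x0 openT 0%N) _.
by have := (continuousP _).1 c _ (@open_lt _ s).
Qed.

Lemma compact_dist2_le x0 s : compact [set x : 'rV[R]_n | dist2 x0 x <= s].
Proof.
apply: bounded_closed_compact.
  exists (`|x0| + (`|s| + 1)); split; first by rewrite num_real.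
  move=> C CC x /= xs; apply: le_trans (ltW CC).
  rewrite -[x](subrK x0) addrC (le_trans (ler_normD _ _))// lerD2l.
  have := le_trans (norm_dist2 x0 x) (le_trans xs (ler_norm s)).
  have := normr_ge0 (x - x0); have := normr_ge0 s; move: `|_ - _| `|s| => a b b0 a0 ab.
  by rewrite leNgt; apply/negP => h; nra.
have c : continuous (dist2 x0).
  by move=> x; apply: Ck_continuous (smooth_dist2 x0 openT 0%N) _.
by have := (continuous_closedP _).1 c _ (@closed_le _ s).
Qed.

Lemma bump_gt0 x0 s x : (0 < bump x0 s x) = (dist2 x0 x < s).
Proof.
have [h|h] := ltP (dist2 x0 x) s; first by rewrite theta_gt0// subr_gt0.
by rewrite /bump theta_eq0 ?ltxx// subr_le0.
Qed.

Lemma bump_eq0 x0 s x : s <= dist2 x0 x -> bump x0 s x = 0.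
Proof. by move=> h; rewrite /bump theta_eq0// subr_le0. Qed.

Lemma bump_ge0 x0 s x : 0 <= bump x0 s x.
Proof. exact: theta_ge0. Qed.

Lemma star_ball (x0 a : 'rV[R]_n) (r : R) : ball x0 r a -> star a (ball x0 r).
Proof.
rewrite /star -ball_normE/= => ar y t yr.
have /andP[t0 t1] := clamp01_itv t.
rewrite /ray; move: (clamp01 t) t0 t1 => {}t t0 t1.
rewrite (_ : x0 - _ = t *: (x0 - y) + (1 - t) *: (x0 - a)); last first.
  by apply/rowP => i; rewrite !mxE; ring.
apply: le_lt_trans (ler_normD _ _) _; rewrite !normrZ (ger0_norm t0) (ger0_norm (_ : 0 <= 1 - t)) ?subr_ge0//.
have : `|x0 - y| < r by []; move: ar; move: `|_ - _| `|x0 - y| => A B Ar Br.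
have [->|tn] := eqVneq t 0; first by rewrite mul0r add0r subr0 mul1r.
have {}t0 : 0 < t by rewrite lt_neqAle eq_sym tn.
have : (1 - t) * A <= (1 - t) * r by rewrite ler_wpM2l ?subr_ge0// ltW.
have : t * B < t * r by rewrite ltr_pM2l.
by lra.
Qed.

End Bump.

Section LinearFacts.
Variables (A : pzRingType) (V W : lmodType A) (L : V -> W).
Hypothesis L_linear : linear L.

Lemma linear_add x y : L (x + y) = L x + L y.
Proof. by have := L_linear 1 x y; rewrite !scale1r. Qed.

Lemma linear_zero : L 0 = 0.
Proof. by apply: (addrI (L 0)); rewrite -linear_add !addr0. Qed.

Lemma linear_scale a x : L (a *: x) = a *: L x.
Proof. by have := L_linear a x 0; rewrite linear_zero !addr0. Qed.

Lemma linear_bigsum (I : finType) (F : I -> V) : L (\sum_i F i) = \sum_i L (F i).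
Proof. exact: (big_morph L linear_add linear_zero). Qed.

End LinearFacts.

(** * Derivations and vector fields in coordinates *)

Section LocalFrame.
Variables (R : realType) (n : nat) (M : manifold R n) (c : chart R n M).
Variables (x0 : 'rV[R]_n) (r s : R).
Hypotheses (Ac : atlas c) (r_gt0 : 0 < r) (s_gt0 : 0 < s) (s_lt : s < r ^+ 2).
Hypothesis ball_img : ball x0 r `<=` chart_map c @` chart_dom c.
Local Notation e_ i := (delta_mx 0 i : 'rV[R]_n).
Local Notation O := (ball x0 r).
Local Notation cm := (chart_map c).
Local Notation ci := (chart_inv c).
Local Notation C := (smooth_fun M).

Let Oo : open O. Proof. exact: ball_open. Qed.

(** The Euclidean ball of squared radius [s] lies in the sup-norm ball of radius [r], because the
    sup norm is at most the Euclidean one and s < r^2. *)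
Lemma dist2_ball x : dist2 x0 x <= s -> O x.
Proof.
move=> xs; rewrite -ball_normE/= -normrN opprB -(ltr_pXn2r (n := 2)) ?nnegrE ?normr_ge0 ?(ltW r_gt0)//.
by apply: le_lt_trans s_lt; apply: le_trans xs; exact: norm_dist2.
Qed.

Definition bump_ext (F : 'rV[R]_n -> R^o) : M -> R^o := zero_ext c O (bump x0 s \* F).

Lemma bump_ext_smooth F : smooth_on O F -> smooth (bump_ext F).
Proof.
move=> SF; apply: (@zero_ext_smooth _ _ _ _ _ [set x | dist2 x0 x <= s]) => //.
- exact: compact_dist2_le.
- by move=> x; exact: dist2_ball.
- by move=> k; apply: CkM => //; exact: smooth_bump.
- by move=> x _ /negP; rewrite -ltNge => /ltW xs /=; rewrite bump_eq0// mul0r.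
Qed.

Definition bump_fun F (SF : smooth_on O F) : C := SmoothFun (smooth_funP (bump_ext_smooth SF)).

Definition cball : set M := [set p | chart_dom c p /\ dist2 x0 (cm p) < s].

Lemma cball_ball p : cball p -> O (cm p).
Proof. by move=> [_ /ltW ps]; exact: dist2_ball. Qed.

Lemma cball_open : open cball.
Proof. by have := @chart_preimage_open _ _ _ c _ (@open_dist2_lt R n x0 s). Qed.

Lemma ci_cball x : dist2 x0 x < s -> cball (ci x).
Proof.
move=> xs; have ix := ball_img (dist2_ball (ltW xs)).
by split; [exact: chart_inv_dom|rewrite chart_invK].
Qed.

Lemma bump_ext_in F p : chart_dom c p -> O (cm p) -> bump_ext F p = bump x0 s (cm p) * F (cm p).
Proof. by move=> cp Op; rewrite /bump_ext zero_ext_in. Qed.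

Lemma bump_ext_out F p : ~ cball p -> bump_ext F p = 0.
Proof.
move=> np; have [[cp Op]|no] := pselect (chart_dom c p /\ O (cm p)); last by rewrite /bump_ext zero_ext_out.
rewrite bump_ext_in// bump_eq0 ?mul0r// leNgt; apply/negP => h; exact: np.
Qed.

Lemma smooth_cst_on (U : set 'rV[R]_n) (a : R^o) : open U -> smooth_on U (fun=> a).
Proof. by move=> Uo k; exact: Ck_cst. Qed.

Definition beta : C := bump_fun (smooth_cst_on (1 : R^o) Oo).
Definition xi i : C := bump_fun (smooth_coordB x0 i Oo).

Lemma betaE p : beta p = if `[< cball p >] then bump x0 s (cm p) else 0.
Proof.
have [cp|ncp] := pselect (cball p).
  by rewrite asboolT// [LHS]bump_ext_in ?mulr1//; [case: cp|exact: cball_ball].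
by rewrite asboolF// [LHS]bump_ext_out.
Qed.

Lemma beta_in p : cball p -> beta p = bump x0 s (cm p).
Proof. by move=> h; rewrite betaE asboolT. Qed.

Lemma beta_gt0 p : cball p -> 0 < beta p.
Proof. by move=> h; rewrite beta_in// bump_gt0; case: h. Qed.

Lemma beta_ge0 p : 0 <= beta p.
Proof. by rewrite betaE; case: ifP => _ //; exact: bump_ge0. Qed.

Lemma xiE i p : xi i p = (cm p - x0) 0 i * beta p.
Proof.
rewrite betaE; have [cp|ncp] := pselect (cball p).
  by rewrite asboolT// mulrC [LHS]bump_ext_in//; [case: cp|exact: cball_ball].
by rewrite asboolF// mulr0 [LHS]bump_ext_out.
Qed.

Lemma smooth_chart_inv (h : C) : smooth_on O (h \o ci).
Proof. by move=> k; apply: Ck_sub (sfun_smooth h Ac k). Qed.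

Lemma smooth_partial (F : 'rV[R]_n -> R^o) j : smooth_on O F -> smooth_on O ('D_(e_ j) F).
Proof. by move=> SF k; have [_ /(_ j)[]] := SF k.+1. Qed.

(** The coordinate derivation multiplied by the bump, so that it becomes a vector field on all of
    M. *)
Definition frame_fun j (h : C) : C^o := bump_fun (smooth_partial j (smooth_chart_inv h)).

Lemma frame_fun_in j (h : C) p : cball p ->
  (frame_fun j h : C) p = beta p * 'D_(e_ j) (h \o ci) (cm p).
Proof.
by move=> cp; rewrite [LHS]bump_ext_in ?beta_in//; [case: cp|exact: cball_ball].
Qed.

Lemma frame_fun_out j (h : C) p : ~ cball p -> (frame_fun j h : C) p = 0.
Proof. by move=> np; rewrite [LHS]bump_ext_out. Qed.

Lemma chart_derivable (h : C) x j : O x -> derivable (h \o ci) x (e_ j).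
Proof. by move=> Ox; have [_ /(_ j)[dh _]] := smooth_chart_inv h 1%N; exact: dh. Qed.

Lemma frame_subproof j : frame_fun j \in @vfield_pred R n M.
Proof.
apply/asboolP => p.
have [cp|np] := pselect (cball p); last first.
  split=> [a h k|h k]; rewrite !frame_fun_out// ?mul0r ?mulr0 ?addr0//.
  by rewrite /GRing.scale/= mulr0.
have Op := cball_ball cp; have [dp _] := cp.
have dh (h : C) : derivable (h \o ci) (cm p) (e_ j) by exact: chart_derivable.
have ck : ci (cm p) = p by rewrite chart_mapK.
split=> [a h k|h k]; rewrite !frame_fun_in//.
  rewrite (_ : ((a *: h + k : C) \o ci) = a *: (h \o ci : 'rV[R]_n -> R^o) + (k \o ci)); last by [].
  rewrite deriveD//; last exact: derivableZ.
  by rewrite deriveZ// /GRing.scale/= mulrDr mulrCA.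
rewrite (_ : ((h * k : C) \o ci) = (h \o ci : 'rV[R]_n -> R^o) * (k \o ci)); last by [].
rewrite deriveM// /GRing.scale/= ck; ring.
Qed.

Definition frame j : vfield M := VField (frame_subproof j).

Lemma frameE j (h : C) p : cball p ->
  (frame j h : C) p = beta p * 'D_(e_ j) (h \o ci) (cm p).
Proof. exact: frame_fun_in. Qed.

Lemma frame_out j (h : C) p : ~ cball p -> (frame j h : C) p = 0.
Proof. exact: frame_fun_out. Qed.

Section Representation.
Variables (p : M) (v : tangent p).

Lemma tangent_derivation : derivation_at p v.
Proof. by case: v => w /= /asboolP. Qed.

Lemma tangentD (h k : C) : v (h + k) = v h + v k.
Proof. by have [lv _] := tangent_derivation; have := lv 1 h k; rewrite !scale1r. Qed.

Lemma tangentM (h k : C) : v (h * k) = v h * k p + h p * v k.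
Proof. by have [_ dv] := tangent_derivation; exact: dv. Qed.

Lemma tangent0 : v 0 = 0.
Proof. by have := tangentD 0 0; rewrite addr0 => /eqP; rewrite -subr_eq subrr eq_sym => /eqP. Qed.

Lemma tangentZ a (h : C) : v (a *: h) = a * v h.
Proof. by have [lv _] := tangent_derivation; have := lv a h 0; rewrite !addr0 tangent0 addr0. Qed.

Lemma tangent_sum (I : finType) (F : I -> C) : v (\sum_i F i) = \sum_i v (F i).
Proof. exact: (big_morph v tangentD tangent0). Qed.

(** Hadamard's lemma at p writes h as h(p) plus a sum of products whose first factors, the
    coordinate differences, vanish at p. Applying the Leibniz rule to this identity leaves only v of
    the first factors times partial derivatives of h. *)
Lemma tangent_repr (h : C) : cball p ->
  beta p * v h = \sum_i (v (xi i) - (cm p - x0) 0 i * v beta) * 'D_(e_ i) (h \o ci) (cm p).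
Proof.
move=> cp; have Op := cball_ball cp; have [dp _] := cp.
have [H [SH Ha HE]] := hadamard Oo (star_ball Op) Op (smooth_chart_inv h).
pose eta i : C := bump_fun (SH i).
pose zeta i : C := xi i - (cm p - x0) 0 i *: beta.
(* One factor [beta] is needed for each of [zeta i] and [eta i], so that both are global smooth
   functions and v can be applied to them. *)
have E : beta * beta * h = h p *: (beta * beta) + \sum_i zeta i * eta i.
  apply/val_inj/funext => q /=.
  have sumE (F : 'I_n -> C) : (\sum_i F i : C) q = \sum_i F i q by exact: (big_morph (fun k : C => k q)).
  change (beta q * beta q * h q = h p * (beta q * beta q) + (\sum_i zeta i * eta i : C) q).
  rewrite sumE.
  have [cq|nq] := pselect (cball q); last first.
    rewrite big1 => [|i _]; first by rewrite betaE asboolF// !mul0r mulr0 addr0.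
    by change (zeta i q * eta i q = 0); rewrite [eta i q]bump_ext_out// mulr0.
  have Oq := cball_ball cq; have [dq _] := cq.
  have /= := HE _ Oq; rewrite !chart_mapK// => ->.
  rewrite mulrDr mulrC mulr_sumr; congr (_ + _); apply: eq_bigr => i _.
  change (beta q * beta q * ((cm q - cm p) 0 i * H i (cm q)) =
    (xi i q - (cm p - x0) 0 i * beta q) * eta i q).
  rewrite xiE [eta i q]bump_ext_in// -beta_in// !mxE; ring.
have := congr1 v E.
(* The terms h(p) v(beta^2) on the two sides cancel, so the derivative of the cutoff drops out. *)
rewrite tangentM tangentD tangentZ tangent_sum mulrC => /addrI e.
have bn0 : beta p != 0 by rewrite gt_eqF// beta_gt0.
apply: (mulfI bn0); rewrite mulrA.
change ((beta * beta : C) p * v h = beta p * \sum_i (v (xi i) - (cm p - x0) 0 i * v beta) * 'D_(e_ i) (h \o ci) (cm p)).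
rewrite e mulr_sumr; apply: eq_bigr => i _; rewrite tangentM.
have -> : zeta i p = 0.
  by change (xi i p - (cm p - x0) 0 i * beta p = 0); rewrite xiE subrr.
rewrite mul0r addr0 [eta i p]bump_ext_in// -beta_in// Ha.
have -> : v (zeta i) = v (xi i) - (cm p - x0) 0 i * v beta.
  by rewrite /zeta -scaleNr tangentD tangentZ mulNr.
by ring.
Qed.

End Representation.

Lemma vfield_repr (X : vfield M) (h : C) p : cball p ->
  beta p * (X h : C) p =
  \sum_i ((X (xi i) : C) p - (cm p - x0) 0 i * (X beta : C) p) * 'D_(e_ i) (h \o ci) (cm p).
Proof. exact: (tangent_repr (vfield_at X p)). Qed.

Definition coef (X : vfield M) i : C := beta * (X (xi i) : C) - xi i * (X beta : C).

(* The factor beta^3 clears the denominators, so that X becomes a global combination of the vector fields [frame i]. *)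
Lemma frame_decomposition (X : vfield M) :
  (beta * beta * beta) *: X = \sum_i coef X i *: frame i.
Proof.
apply/val_inj/funext => h; apply/val_inj/funext => q /=.
have sumE (F : 'I_n -> vfield M) : ((\sum_i F i : vfield M) h : C) q = \sum_i (F i h : C) q.
  exact: (big_morph (fun Y : vfield M => (Y h : C) q)).
change (beta q * beta q * beta q * (X h : C) q = ((\sum_i coef X i *: frame i : vfield M) h : C) q).
rewrite sumE.
have [cq|nq] := pselect (cball q); last first.
  rewrite big1 => [|i _]; first by rewrite betaE asboolF// !mul0r.
  by change (coef X i q * (frame i h : C) q = 0); rewrite frame_out// mulr0.
rewrite -mulrA vfield_repr// mulr_sumr; apply: eq_bigr => i _.
change (beta q * beta q * (((X (xi i) : C) q - (cm q - x0) 0 i * (X beta : C) q) * 'D_(e_ i) (h \o ci) (cm q))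
  = (beta q * (X (xi i) : C) q - xi i q * (X beta : C) q) * (frame i h : C) q).
rewrite frameE// xiE; ring.
Qed.

(* The components of X in the chart: only the products [xi i] of the coordinates with the bump are global functions. *)
Definition velocity (X : vfield M) i (x : 'rV[R]_n) : R^o :=
  ((X (xi i) : C) (ci x) - (x - x0) 0 i * (X beta : C) (ci x)) * (bump x0 s x)^-1.

Lemma velocityE (X : vfield M) (h : C) x : dist2 x0 x < s ->
  (X h : C) (ci x) = \sum_i velocity X i x * 'D_(e_ i) (h \o ci) x.
Proof.
move=> xs; have cx := ci_cball xs.
have ix : cm (ci x) = x by rewrite chart_invK//; exact: ball_img (dist2_ball (ltW xs)).
have := vfield_repr X h cx; rewrite ix beta_in// ix => E.
have bn : bump x0 s x != 0 by rewrite gt_eqF// bump_gt0.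
apply: (mulfI bn); rewrite E mulr_sumr; apply: eq_bigr => i _.
by rewrite /velocity; field.
Qed.

Lemma smooth_velocity (X : vfield M) i : smooth_on [set x | dist2 x0 x < s] (velocity X i).
Proof.
move=> k; have Uo := @open_dist2_lt R n x0 s.
have UO : [set x | dist2 x0 x < s] `<=` O by move=> x /= /ltW; exact: dist2_ball.
have h1 (h : C) : Ck k [set x | dist2 x0 x < s] (h \o ci).
  by apply: Ck_sub UO _; exact: smooth_chart_inv.
apply: CkM => //; last first.
  by apply: Ck_inv => //; [move=> x xs; rewrite gt_eqF// bump_gt0|exact: smooth_bump].
apply: (Ck_ext Uo) (CkD Uo (h1 (X (xi i))) (CkM Uo (Ck_cst k (-1 : R^o) Uo)
  (CkM Uo (smooth_coordB x0 i Uo k) (h1 (X beta))))) => x _ /=.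
by rewrite mulN1r.
Qed.

Section AtZero.
Variables (g : metric M) (nabla : vfield M -> vfield M -> vfield M) (u : vfield M) (f : C) (p : M).
Hypotheses (LC : levi_civita g nabla) (uC : concircular nabla u f) (up0 : vfield_at u p = 0).
Hypothesis cp : cball p.

Lemma vfield_at0 (h : C) : (u h : C) p = 0.
Proof. exact: (congr1 (fun v : tangent p => v h) up0). Qed.

(** The connection is linear over smooth functions in its first argument, and the coefficients of
    beta^3 u in the global fields [frame i] vanish at p together with u. Hence beta(p)^3 (nabla_u
    X)(p) = 0. *)
Lemma nabla_at0 (X : vfield M) (h : C) : (nabla u X h : C) p = 0.
Proof.
have [[lin _ _] _ _] := LC.
have := congr1 (fun Y => nabla Y X) (frame_decomposition u).
rewrite /= (linear_scale (lin X)) (linear_bigsum (lin X)) => E.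
have {}E := congr1 (fun Y : vfield M => (Y h : C) p) E.
have sumE (F : 'I_n -> vfield M) : ((\sum_i F i : vfield M) h : C) p = \sum_i (F i h : C) p.
  exact: (big_morph (fun Y : vfield M => (Y h : C) p)).
move: E; rewrite /= sumE big1 => [E|i _]; last first.
  rewrite (linear_scale (lin X)).
  change ((beta p * (u (xi i) : C) p - xi i p * (u beta : C) p) * (nabla (frame i) X h : C) p = 0).
  by rewrite !vfield_at0 !mulr0 subr0 mul0r.
have : beta p * beta p * beta p * (nabla u X h : C) p = 0 := E.
have bn0 : beta p != 0 by rewrite gt_eqF// beta_gt0.
by move/eqP; rewrite !mulf_eq0 (negbTE bn0)/= => /eqP.
Qed.

(** Torsion-freeness reads f X - nabla_u X = [X, u]. At p both nabla_u X and u(X h) vanish, and only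
    X(u h) remains on the right. *)
Lemma concircular_at0 (X : vfield M) (h : C) : (X (u h) : C) p = f p * (X h : C) p.
Proof.
have [_ tor _] := LC.
have := congr1 (fun Y : vfield M => (Y h : C) p) (tor X u).
rewrite /= uC => E.
have {}E : f p * (X h : C) p - (nabla u X h : C) p = (X (u h) : C) p - (u (X h) : C) p := E.
by move: E; rewrite nabla_at0 vfield_at0 !subr0.
Qed.

Hypothesis px0 : cm p = x0.

Lemma velocity_at0 i : velocity u i x0 = 0.
Proof.
have cip : ci x0 = p by rewrite -px0 chart_mapK//; case: cp.
by rewrite /velocity cip !vfield_at0 mulr0 subr0 mul0r.
Qed.

(** [velocity] is a quotient by the bump whose numerator vanishes at x0, so only the derivative of
    the numerator counts. In it, the correction (x - x0)_i u(beta) is a product of two functions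
    vanishing at x0 and contributes nothing. *)
Lemma derive_velocity_at0 i j : 'D_(e_ j) (velocity u i) x0 = f p * (i == j)%:R.
Proof.
have dp : chart_dom c p by case: cp.
have cip : ci x0 = p by rewrite -px0 chart_mapK.
have Op : O x0 by exact: ballxx.
have bn : bump x0 s x0 != 0 by rewrite gt_eqF// bump_gt0 dist2xx.
have xs0 : dist2 x0 x0 < s by rewrite dist2xx.
have Db : derivable (bump x0 s) x0 (e_ j).
  by have [_ /(_ j)[db _]] := smooth_bump x0 s Oo 1%N; exact: db.
have Dxi : 'D_(e_ j) (xi i \o ci) x0 = (i == j)%:R * bump x0 s x0.
  rewrite (@near_eq_derive _ _ _ _ ((fun x => (x - x0) 0 i : R^o) * (bump x0 s : _ -> R^o))).
    have /@derive_val -> := is_deriveM (is_derive_coordB x0 x0 i j) (DeriveDef Db erefl).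
    by rewrite /GRing.scale/= !mxE subrr mul0r add0r mulrC.
  have : \forall x \near x0, dist2 x0 x < s by apply: (open_nbhs_nbhs (conj (@open_dist2_lt R n x0 s) xs0)).
  apply: filterS => x xs /=.
  have cx := ci_cball xs.
  change (xi i (ci x) = (x - x0) 0 i * bump x0 s x).
  rewrite xiE beta_in// chart_invK//; exact: ball_img (dist2_ball (ltW xs)).
(* This is [concircular_at0] for the field [frame j], with the common factor [beta p] cancelled. *)
have Duxi : 'D_(e_ j) ((u (xi i) : C) \o ci) x0 = f p * 'D_(e_ j) (xi i \o ci) x0.
  have := concircular_at0 (frame j) (xi i); rewrite !frameE// px0 mulrCA.
  by apply: mulfI; rewrite gt_eqF// beta_gt0.
have DN : is_derive x0 (e_ j) (fun x => (u (xi i) : C) (ci x) - (x - x0) 0 i * (u beta : C) (ci x) : R^o)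
   (f p * ((i == j)%:R * bump x0 s x0)).
  rewrite -[X in is_derive _ _ _ X]subr0; apply: is_deriveB.
    by split; [exact: (chart_derivable (h := u (xi i)))|rewrite Duxi Dxi].
  have D2 : is_derive x0 (e_ j) ((u beta : C) \o ci : _ -> R^o) ('D_(e_ j) ((u beta : C) \o ci) x0).
    by split => //; exact: chart_derivable.
  have := is_deriveM (is_derive_coordB x0 x0 i j) D2.
  move=> H; apply: (is_derive_eq H).
  by rewrite /GRing.scale/= cip vfield_at0 !mxE subrr !mul0r addr0.
rewrite /velocity.
have DV : is_derive x0 (e_ j) (fun x => (bump x0 s x)^-1 : R^o) ('D_(e_ j) (fun x => (bump x0 s x)^-1 : R^o) x0).
  by split => //; exact: derivableV.
have /@derive_val := is_deriveM DN DV.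
move=> E; rewrite [LHS]E /GRing.scale/= cip !vfield_at0 mulr0 subr0 mul0r add0r mulrC -mulrA mulfK//.
Qed.

End AtZero.

End LocalFrame.

Lemma exists_chart_ball (R : realType) (n : nat) (M : manifold R n) (p : M) :
  exists (c : chart R n M) (r s : R), [/\ atlas c, chart_dom c p, 0 < r, 0 < s & s < r ^+ 2] /\
    ball (chart_map c p) r `<=` chart_map c @` chart_dom c.
Proof.
have [c Ac cp] := atlas_cover p.
have := open_nbhs_nbhs (conj (chart_img_open (c := c)) (ex_intro2 _ _ p cp erefl) : open_nbhs (chart_map c p) _).
move=> /nbhs_ballP[r /= r0 Hr]; exists c, r, (r ^+ 2 / 2); split => //.
have : 0 < r ^+ 2 by rewrite exprn_gt0.
by split => //; lra.
Qed.

(** * The flow of a vector field on a compact manifold *)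

Section CubeLipschitz.
Variables (R : realType) (n : nat).
Local Notation e_ i := (delta_mx 0 i : 'rV[R]_n).

Definition cube (x0 : 'rV[R]_n) (d : R) : set 'rV[R]_n := [set x | `|x - x0| <= d].

Lemma cube_compact x0 d : compact (cube x0 d).
Proof.
apply: bounded_closed_compact.
  exists (`|x0| + d); split; first by rewrite num_real.
  move=> C CC x /= xd; apply: le_trans (ltW CC).
  by rewrite -[x](subrK x0) addrC (le_trans (ler_normD _ _))// lerD2l.
have c : continuous (fun x : 'rV[R]_n => `|x - x0| : R^o).
  move=> x; apply: (@cvgrPdist_le R R^o _ (nbhs x) (nbhs_filter x) _ _).2 => e e0.
  apply: filterS (nbhsx_ballx x e e0) => y; rewrite -ball_normE/= => /ltW; apply: le_trans.
  by apply: le_trans (ler_dist_dist _ _) _; rewrite opprB addrA subrK.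
by have := (continuous_closedP _).1 c _ (@closed_le _ d).
Qed.

Lemma compact_norm_bound (T : topologicalType) (A : set T) (F : T -> R^o) : compact A ->
  (forall x, A x -> {for x, continuous F}) ->
  exists2 B : R, 0 <= B & forall x, A x -> `|F x| <= B.
Proof.
move=> Ac Fc.
have : compact (F @` A).
  by apply: continuous_compact => //; apply: continuous_in_subspaceT => x /set_mem; exact: Fc.
move=> /compact_bounded[B [_ HB]]; exists (`|B| + 1); first by rewrite addr_ge0.
by move=> x Ax; apply: HB; [rewrite (le_lt_trans (ler_norm B))// ltrDl|exists x].
Qed.

Lemma cube_segment x0 d x y (t : R) : cube x0 d x -> cube x0 d y -> 0 <= t <= 1 ->
  cube x0 d (t *: (y - x) + x).
Proof.
rewrite /cube/= => xd yd /andP[t0 t1].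
rewrite (_ : _ - x0 = t *: (y - x0) + (1 - t) *: (x - x0)); last first.
  by apply/rowP => i; rewrite !mxE; ring.
apply: (le_trans (ler_normD _ _)).
rewrite !normrZ (ger0_norm t0) (ger0_norm (_ : 0 <= 1 - t)) ?subr_ge0//.
have := ler_wpM2l t0 yd; have : 0 <= 1 - t by rewrite subr_ge0.
by move=> /ler_wpM2l/(_ _ _ xd); lra.
Qed.

Lemma C1_cube_lipschitz (U : set 'rV[R]_n) (F : 'rV[R]_n -> R^o) x0 d :
  open U -> Ck 1 U F -> cube x0 d `<=` U ->
  exists2 L : R, 0 <= L & forall x y, cube x0 d x -> cube x0 d y -> `|F x - F y| <= L * `|x - y|.
Proof.
move=> Uo CF cU; have [_ dF] := CF.
have HB j : exists2 B : R, 0 <= B & forall x, cube x0 d x -> `|'D_(e_ j) F x| <= B.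
  apply: compact_norm_bound; first exact: cube_compact.
  by move=> x /cU Ux; have [_ [+ _]] := dF j; apply.
pose B j := projT1 (cid2 (HB j)).
have B0 j : 0 <= B j by rewrite /B; case: cid2.
have BE j x : cube x0 d x -> `|'D_(e_ j) F x| <= B j by rewrite /B; case: cid2 => b ? /=; apply.
exists (\sum_j B j); first exact: sumr_ge0.
move=> x y xd yd.
have := @mean_value_le R (fun t : R => F (t *: (x - y) + y))
  (fun t => \sum_j (x - y) 0 j * 'D_(e_ j) F (t *: (x - y) + y)) 0 1 ((\sum_j B j) * `|x - y|) ler01.
rewrite scale1r subrK scale0r add0r subr0 mulr1; apply => t t01.
  apply: (@Ck1_is_derive _ _ U F (fun s : R => s *: (x - y) + y)) => //.
    by apply: cU; exact: cube_segment.
  exact: is_derive_affine.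
apply: (le_trans (ler_norm_sum _ _ _)); rewrite mulr_suml; apply: ler_sum => j _.
rewrite normrM mulrC; apply: ler_pM => //; last exact: coord_le_norm.
by apply: BE; exact: cube_segment.
Qed.

(** The coordinatewise retraction onto the cube is 1-Lipschitz for the sup norm. Composing with it
    extends a local field to a bounded, globally Lipschitz one, as Picard iteration requires. *)
Definition clamp_cube (x0 : 'rV[R]_n) (d : R) (x : 'rV[R]_n) : 'rV[R]_n :=
  \row_i (x0 0 i + Num.max (- d) (Num.min d ((x - x0) 0 i))).

Lemma clamp_cubeP x0 d x : 0 <= d -> cube x0 d (clamp_cube x0 d x).
Proof.
move=> d0; rewrite /cube/=; apply: norm_le_coord => // i.
rewrite !mxE addrAC subrr add0r ler_norml le_max lexx/= ge_max ge_min lexx andbT.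
lra.
Qed.

Lemma clamp_cube_id x0 d x : cube x0 d x -> clamp_cube x0 d x = x.
Proof.
move=> xd; apply/rowP => i; rewrite mxE.
have := le_trans (coord_le_norm (x - x0) i) xd; rewrite !mxE ler_norml => /andP[h1 h2].
by rewrite min_r// max_r// [LHS]addrC subrK.
Qed.

Lemma clamp_cube_lip x0 d x y :
  `|clamp_cube x0 d x - clamp_cube x0 d y| <= `|x - y|.
Proof.
apply: norm_le_coord => // i; rewrite !mxE opprD addrACA subrr add0r.
apply: le_trans (clamp_lip _ _ _) _.
have := coord_le_norm (x - y) i; rewrite !mxE; congr (`|_| <= _); ring.
Qed.

End CubeLipschitz.

Lemma cvg_pair_at (X Y Z : topologicalType) (f : X -> Y) (g : X -> Z) (x : X) (y : Y) (z : Z) :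
  f @ x --> y -> g @ x --> z -> (f t, g t) @[t --> x] --> (y, z).
Proof.
move=> fy gz A [[B1 B2] /= [n1 n2] AB].
have h1 : \forall t \near x, B1 (f t) := fy _ n1.
have h2 : \forall t \near x, B2 (g t) := gz _ n2.
by apply: filterS (filterI h1 h2) => t [? ?]; exact: (AB (f t, g t)).
Qed.

Lemma cvg_slice (T1 T2 : topologicalType) (t : T1) (q : T2) : (s, q) @[s --> t] --> (t, q).
Proof. by apply: cvg_pair_at; [exact: cvg_id|exact: cvg_cst]. Qed.

(** * Local existence and uniqueness of integral curves *)

Section IntegralCurves.
Variables (R : realType) (n : nat) (M : manifold R n) (u : vfield M).
Local Notation C := (smooth_fun M).
Local Notation e_ i := (delta_mx 0 i : 'rV[R]_n).

(** The differential equation is tested on all smooth functions, as suits derivations; continuity is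
    included so that a curve can be placed in a chart for nearby times. *)
Definition integral_curve (e : R) (c : R -> M) : Prop := forall t : R, `|t| < e ->
  {for t, continuous c} /\
  forall h : C, is_derive t 1 (fun s => h (c s) : R^o) ((u h : C) (c t)).

Lemma integral_curve_le e e' c : e' <= e -> integral_curve e c -> integral_curve e' c.
Proof. by move=> ee ic t te; apply: ic; exact: lt_le_trans ee. Qed.

Definition local_flow (e : R) (N : set M) (phi : R -> M -> M) : Prop :=
  forall x, N x -> [/\ phi 0 x = x, integral_curve e (phi^~ x) &
    forall t : R, `|t| < e -> phi z.1 z.2 @[z --> (t, x)] --> phi t x].

Lemma velocity_cube (c : chart R n M) (x0 : 'rV[R]_n) (r s : R)
    (Ac : atlas c) (r_gt0 : 0 < r) (s_gt0 : 0 < s) (s_lt : s < r ^+ 2)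
    (bi : ball x0 r `<=` chart_map c @` chart_dom c) :
  let v x : 'rV[R]_n := \row_i velocity Ac r_gt0 s_lt bi u i x in
  exists d L K : R, [/\ 0 < d, 0 <= L, 0 <= K, cube x0 d `<=` [set x | dist2 x0 x < s] &
    (forall x y, cube x0 d x -> cube x0 d y -> `|v x - v y| <= L * `|x - y|) /\
    (forall x, cube x0 d x -> `|v x| <= K)].
Proof.
move=> v; set U := [set x | _].
have Uo : open U by exact: open_dist2_lt.
have Ux0 : U x0 by rewrite /U/= dist2xx.
have [d0 /= d00 Hd0] := (nbhs_ballP _ _).1 (open_nbhs_nbhs (conj Uo Ux0)).
pose d := d0 / 2.
have d_gt0 : 0 < d by rewrite divr_gt0.
have cU : cube x0 d `<=` U.
  move=> x xd; apply: Hd0; rewrite -ball_normE/= distrC; apply: le_lt_trans xd _.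
  by rewrite /d; lra.
have HL i : exists2 L : R, 0 <= L & forall x y, cube x0 d x -> cube x0 d y ->
    `|velocity Ac r_gt0 s_lt bi u i x - velocity Ac r_gt0 s_lt bi u i y| <= L * `|x - y|.
  by apply: (C1_cube_lipschitz Uo) cU; exact: smooth_velocity.
pose L i := projT1 (cid2 (HL i)).
have L0 i : 0 <= L i by rewrite /L; case: cid2.
have LE i x y : cube x0 d x -> cube x0 d y ->
    `|velocity Ac r_gt0 s_lt bi u i x - velocity Ac r_gt0 s_lt bi u i y| <= L i * `|x - y|.
  by rewrite /L; case: cid2 => b ? /=; apply.
have Lsum i : L i <= \sum_j L j by rewrite (bigD1 i)//= lerDl sumr_ge0.
have lip x y : cube x0 d x -> cube x0 d y -> `|v x - v y| <= (\sum_j L j) * `|x - y|.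
  move=> xd yd; apply: norm_le_coord => [|i]; first by rewrite mulr_ge0// sumr_ge0.
  by rewrite !mxE; apply: le_trans (LE i x y xd yd) _; rewrite ler_wpM2r.
have x0d : cube x0 d x0 by rewrite /cube/= subrr normr0 ltW.
exists d, (\sum_j L j), (`|v x0| + (\sum_j L j) * d); split => //.
- exact: sumr_ge0.
- by rewrite addr_ge0// mulr_ge0 ?sumr_ge0// ltW.
split => // x xd; rewrite -[v x](subrK (v x0)) addrC.
apply: (le_trans (ler_normD _ _)); rewrite lerD2l; apply: le_trans (lip _ _ xd x0d) _.
by rewrite ler_wpM2l// sumr_ge0.
Qed.

Lemma local_flow_exists p : exists e N phi, [/\ 0 < e, open N, N p & local_flow e N phi].
Proof.
have [c [r [s [[Ac cp r0 s0 sr] bi]]]] := exists_chart_ball p.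
set x0 := chart_map c p in bi.
have [d [L [K [d0 L0 K0 cU [vL vK]]]]] := velocity_cube Ac r0 s0 sr bi.
pose v x : 'rV[R]_n := \row_i velocity Ac r0 sr bi u i x.
pose V x := v (clamp_cube x0 d x).
have VL x y : `|V x - V y| <= L * `|x - y|.
  apply: le_trans (vL _ _ (clamp_cubeP _ _ (ltW d0)) (clamp_cubeP _ _ (ltW d0))) _.
  by rewrite ler_wpM2l// clamp_cube_lip.
have VK x : `|V x| <= K by apply: vK; exact: clamp_cubeP (ltW d0).
pose T := Num.min 1 (2 * (L + 1))^-1.
have T0 : 0 < T by rewrite lt_min ltr01 invr_gt0 mulr_gt0// ltr_wpDl.
have T1 : T <= 1 by rewrite ge_min lexx.
have LT : L * T <= 2^-1.
  apply: (@le_trans _ _ (L * (2 * (L + 1))^-1)); first by rewrite ler_wpM2l// ge_min lexx orbT.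
  by rewrite ler_pdivrMr ?mulr_gt0 ?ltr_wpDl// mulKf ?pnatr_eq0// lerDl.
have [Y [Y0 Yt Yx Yd]] := picard_flow VL VK T0 T1 LT L0.
(* At speed at most K, a solution moves less than d/2 in time e. Started in the half-size cube, it
   stays where the clamped field is the true one; [K + 1] covers K = 0. *)
pose e := Num.min T (d / (2 * (K + 1))).
have e0 : 0 < e by rewrite lt_min T0 divr_gt0// mulr_gt0// ltr_wpDl.
have eT : e <= T by rewrite ge_min lexx.
have eK t : `|t| < e -> K * `|t| <= d / 2.
  move=> te; apply: (@le_trans _ _ (K * (d / (2 * (K + 1))))).
    by rewrite ler_wpM2l// ltW// (lt_le_trans te)// ge_min lexx orbT.
  rewrite mulrA ler_pdivrMr ?mulr_gt0 ?ltr_wpDl// mulrA divfK ?pnatr_eq0// mulrC ler_wpM2l ?ltW//.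
  by rewrite ltrDl.
pose N := [set q | chart_dom c q /\ `|x0 - chart_map c q| < d / 2].
have d20 : 0 < d / 2 by rewrite divr_gt0.
have No : open N.
  have := @chart_preimage_open _ _ _ c _ (ball_open x0 (d / 2)).
  by rewrite -ball_normE.
have Np : N p by split => //; rewrite /x0 subrr normr0.
have Ycube q t : N q -> `|t| < e -> cube x0 d (Y t (chart_map c q)).
  move=> [cq qd] te; rewrite /cube/=; apply: (le_trans (ler_distD (chart_map c q) _ _)).
  rewrite [d]splitr; apply: lerD; last by rewrite distrC ltW.
  have := Yt t 0 (chart_map c q); rewrite Y0 subr0 => /le_trans; apply; exact: eK.
have Yimg q t : N q -> `|t| < e -> (chart_map c @` chart_dom c) (Y t (chart_map c q)).
  by move=> Nq te; exact: (bi _ (dist2_ball r0 sr (ltW (cU _ (Ycube q t Nq te))))).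
exists e, N, (fun t q => chart_inv c (Y t (chart_map c q))); split => // q Nq.
have [cq _] := Nq.
have Ycont (t : R) : Y z.1 (chart_map c z.2) @[z --> (t, q)] --> Y t (chart_map c q).
  apply/cvgrPdist_le => eps eps0.
  have cq1 : chart_map c z.2 @[z --> (t, q)] --> chart_map c q.
    apply: (@cvg_comp _ _ _ snd (chart_map c) _ (nbhs q)); first exact: cvg_snd.
    exact: chart_map_cts.
  have c2 : z.1 @[z --> (t, q)] --> t by exact: cvg_fst.
  have e1 : 0 < eps / (2 * (K + 1)) by rewrite divr_gt0// mulr_gt0// ltr_wpDl.
  have e2 : 0 < eps / 4 by rewrite divr_gt0.
  move/cvgrPdist_le : cq1 => /(_ _ e2) h2; move/cvgrPdist_le : c2 => /(_ _ e1) h1.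
  near=> z.
  have z1 : `|t - z.1| <= eps / (2 * (K + 1)) by near: z.
  have z2 : `|chart_map c q - chart_map c z.2| <= eps / 4 by near: z.
  apply: (le_trans (ler_distD (Y z.1 (chart_map c q)) _ _)); rewrite [eps]splitr; apply: lerD.
    apply: le_trans (Yt _ _ _) _; apply: le_trans (ler_wpM2l K0 z1) _.
    rewrite mulrA ler_pdivrMr ?mulr_gt0 ?ltr_wpDl// mulrA divfK ?pnatr_eq0// mulrC ler_wpM2l ?ltW//.
    by rewrite ltrDl.
  apply: le_trans (Yx _ _ _) _; rewrite (_ : eps / 2 = 2 * (eps / 4)); last by field.
  by rewrite ler_pM2l.
have cnt (t : R) : `|t| < e -> chart_inv c (Y z.1 (chart_map c z.2)) @[z --> (t, q)] --> chart_inv c (Y t (chart_map c q)).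
  move=> te; apply: (@cvg_comp _ _ _ _ (chart_inv c) _ (nbhs (Y t (chart_map c q)))); first exact: Ycont.
  by apply: chart_inv_cts; exact: Yimg.
split => //; first by rewrite Y0 chart_mapK.
move=> t te; split.
  apply: (@cvg_comp _ _ _ (fun s => (s, q)) (fun z => chart_inv c (Y z.1 (chart_map c z.2))) _ (nbhs (t, q))); last exact: cnt.
  exact: cvg_slice.
move=> h.
have hs := smooth_chart_inv Ac bi h.
have xs := cU _ (Ycube _ _ Nq te).
have := Ck1_is_derive (ball_open x0 r) (dist2_ball r0 sr (ltW xs)) (hs 1%N) (Yd t (chart_map c q) (lt_le_trans te eT)).
move=> H; apply: (is_derive_eq H).
rewrite (velocityE Ac r0 sr bi u h xs); apply: eq_bigr => i _.
by rewrite /V clamp_cube_id ?mxE//; exact: Ycube.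
Unshelve. all: by end_near. Qed.

Lemma is_derive_shiftr (W : normedModType R) (F : R -> W) (t0 s : R) dF :
  is_derive (s + t0) 1 F dF -> is_derive s 1 (fun r => F (r + t0)) dF.
Proof.
move=> [Fd <-].
have E : (fun h : R => h^-1 *: (((fun r => F (r + t0)) \o shift s) (h *: (1 : R^o)) - F (s + t0))) =
    (fun h => h^-1 *: ((F \o shift (s + t0)) (h *: (1 : R^o)) - F (s + t0))).
  by apply/funext => h /=; rewrite addrA.
by split; rewrite /derivable /derive E.
Qed.

(** Coordinates are not global functions, but near time t they equal x0_i + xi_i / beta along the
    curve. The quotient rule then yields exactly the formula for [velocity]. *)
Lemma is_derive_chart_curve (c : chart R n M) (x0 : 'rV[R]_n) (r s : R)
    (Ac : atlas c) (r_gt0 : 0 < r) (s_gt0 : 0 < s) (s_lt : s < r ^+ 2)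
    (bi : ball x0 r `<=` chart_map c @` chart_dom c) (e : R) (q : R -> M) (t : R) :
  integral_curve e q -> `|t| < e -> cball c x0 s (q t) ->
  is_derive t 1 (fun a : R => chart_map c (q a))
    (\row_i velocity Ac r_gt0 s_lt bi u i (chart_map c (q t))).
Proof.
move=> iq te qt.
have [qc qd] := iq t te.
have near_cball : \forall a \near t, cball c x0 s (q a).
  by apply: qc; apply: open_nbhs_nbhs; split => //; exact: cball_open.
have bn0 a : cball c x0 s a -> beta Ac r_gt0 s_lt bi a != 0.
  by move=> ca; rewrite gt_eqF// beta_gt0.
have D i : is_derive t 1 (fun a : R => chart_map c (q a) 0 i : R^o)
    (velocity Ac r_gt0 s_lt bi u i (chart_map c (q t))).
  pose A (a : R) : R^o := xi Ac r_gt0 s_lt bi i (q a).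
  pose B (a : R) : R^o := beta Ac r_gt0 s_lt bi (q a).
  have dA : is_derive t 1 A ((u (xi Ac r_gt0 s_lt bi i) : C) (q t)) by exact: qd.
  have dB : is_derive t 1 B ((u (beta Ac r_gt0 s_lt bi) : C) (q t)) by exact: qd.
  have Bt : B t != 0 by exact: bn0.
  have dV := is_deriveV Bt dB.
  apply: (@near_eq_is_derive _ _ _ (fun a : R => A a * (B a)^-1 + x0 0 i : R^o)).
    apply: filterS near_cball => a ca; rewrite /A /B xiE mulfK ?bn0//.
    by rewrite !mxE subrK.
  have := is_deriveD (is_deriveM dA dV) (is_derive_cst (x0 0 i : R^o) t 1).
  move=> H; apply: (is_derive_eq H).
  have cqt : chart_inv c (chart_map c (q t)) = q t by rewrite chart_mapK//; case: qt.
  have At : A t = (chart_map c (q t) - x0) 0 i * B t := xiE _ _ _ _ _ _.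
  rewrite [LHS]addr0 At /velocity cqt -(beta_in Ac r_gt0 s_lt bi qt) -/(B t) /GRing.scale/=; field.
  exact: Bt.
have dM : derivable (fun a : R => chart_map c (q a)) t 1.
  by apply/derivable_mxP => k i; rewrite (ord1 k); have [] := D i.
split => //; rewrite derive_mx//; apply/matrixP => k i; rewrite !mxE (ord1 k).
exact: (@derive_val _ _ _ _ _ _ _ (D i)).
Qed.

Lemma integral_curve_unique_near (e : R) (c1 c2 : R -> M) (t0 : R) :
  integral_curve e c1 -> integral_curve e c2 -> `|t0| < e -> c1 t0 = c2 t0 ->
  \forall t \near t0, c1 t = c2 t.
Proof.
move=> i1 i2 t0e c12.
have [c [r [s [[Ac cp r0 s0 sr] bi]]]] := exists_chart_ball (c1 t0).
set x0 := chart_map c (c1 t0) in bi.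
have [d [L [K [d0 L0 _ cU [vL _]]]]] := velocity_cube Ac r0 s0 sr bi.
have near_cube q : integral_curve e q -> q t0 = c1 t0 ->
    \forall t \near t0, chart_dom c (q t) /\ `|x0 - chart_map c (q t)| < d.
  move=> iq q0; have [qc _] := iq _ t0e.
  apply: (qc [set y | chart_dom c y /\ `|x0 - chart_map c y| < d]); rewrite q0.
  have := @chart_preimage_open _ _ _ c _ (ball_open x0 d); rewrite -ball_normE => No.
  by apply: open_nbhs_nbhs; split => //; split => //=; rewrite subrr normr0.
have : \forall t \near t0, `|t| < e /\ ((chart_dom c (c1 t) /\ `|x0 - chart_map c (c1 t)| < d) /\
    (chart_dom c (c2 t) /\ `|x0 - chart_map c (c2 t)| < d)).
  apply: filterI; first exact: near_norm_lt.
  by apply: filterI; [exact: near_cube i1 erefl|exact: near_cube i2 (esym c12)].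
move=> /nbhs_ballP[tau0 /= tau00 H].
pose tau := Num.min tau0 (2 * (L + 1))^-1.
have tau_gt0 : 0 < tau by rewrite lt_min tau00 invr_gt0 mulr_gt0// ltr_wpDl.
have Ltau : L * tau <= 2^-1.
  apply: (@le_trans _ _ (L * (2 * (L + 1))^-1)); first by rewrite ler_wpM2l// ge_min lexx orbT.
  by rewrite ler_pdivrMr ?mulr_gt0 ?ltr_wpDl// mulKf ?pnatr_eq0// lerDl.
have inb (t : R) : `|t - t0| < tau -> [/\ `|t| < e, chart_dom c (c1 t) /\ cube x0 d (chart_map c (c1 t)) &
     chart_dom c (c2 t) /\ cube x0 d (chart_map c (c2 t))].
  move=> tt; have := H t; rewrite -ball_normE/= distrC => /(_ _)[|? [[? h1] [? h2]]].
    by rewrite (lt_le_trans tt)// ge_min lexx.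
  by split => //; split => //; rewrite /cube/= distrC ltW.
(* Both curves start inside the cube, which gives the bound 2d; each use of the mean value
   inequality multiplies it by L tau <= 1/2. *)
have key k (t : R) : `|t - t0| < tau -> `|chart_map c (c1 t) - chart_map c (c2 t)| <= 2 * d / 2 ^+ k.
  elim: k t => [|k IH] t tt.
    have [_ [_ h1] [_ h2]] := inb t tt; rewrite expr0 divr1.
    apply: (le_trans (ler_distD x0 _ _)); rewrite mulr_natl mulr2n; apply: lerD => //.
    by rewrite distrC.
  have B0 : 0 <= 2 * d / 2 ^+ k by rewrite divr_ge0 ?mulr_ge0 ?exprn_ge0// ltW.
  apply: norm_le_coord => [|i]; first by rewrite divr_ge0 ?mulr_ge0 ?exprn_ge0// ltW.
  rewrite !mxE.
  pose F (a : R) : R^o := chart_map c (c1 a) 0 i - chart_map c (c2 a) 0 i.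
  have := @mean_value_le0 R (fun a => F (a + t0))
    (fun a => velocity Ac r0 sr bi u i (chart_map c (c1 (a + t0))) - velocity Ac r0 sr bi u i (chart_map c (c2 (a + t0))))
    (t - t0) (L * (2 * d / 2 ^+ k)).
  have F0 : F t0 = 0 by rewrite /F c12 subrr.
  rewrite subrK add0r F0 subr0 => /(_ _ _)/le_trans; apply.
  - move=> a at0; apply: is_derive_shiftr.
    have [ae [d1 h1] [d2 h2]] := inb (a + t0) ltac:(by rewrite addrK; exact: le_lt_trans tt).
    have D q : integral_curve e q -> chart_dom c (q (a + t0)) -> cube x0 d (chart_map c (q (a + t0))) ->
      is_derive (a + t0) 1 (fun a : R => chart_map c (q a) 0 i : R^o) (velocity Ac r0 sr bi u i (chart_map c (q (a + t0)))).
      move=> iq dq cq; have := is_derive_coord i (is_derive_chart_curve Ac r0 s0 sr bi iq ae (conj dq (cU _ cq))).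
      by rewrite mxE.
    by apply: is_deriveB; apply: D.
  - move=> a at0; have ta : `|a + t0 - t0| < tau by rewrite addrK; exact: le_lt_trans tt.
    have [ae [d1 h1] [d2 h2]] := inb _ ta.
    apply: le_trans (ler_wpM2l L0 (IH _ ta)); apply: le_trans (vL _ _ h1 h2).
    by have := coord_le_norm (\row_j velocity Ac r0 sr bi u j (chart_map c (c1 (a + t0))) - \row_j velocity Ac r0 sr bi u j (chart_map c (c2 (a + t0)))) i; rewrite !mxE.
  - rewrite (_ : 2 * d / 2 ^+ k.+1 = 2 * d / 2 ^+ k * 2^-1); last first.
      by rewrite exprSr invfM mulrA.
    rewrite mulrAC mulrC ler_wpM2l//.
    by apply: le_trans Ltau; rewrite ler_wpM2l// ltW.
apply/nbhs_ballP; exists tau => //= t; rewrite -ball_normE/= distrC => tt.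
have [_ [d1 _] [d2 _]] := inb t tt.
rewrite -(chart_mapK d1) -(chart_mapK d2); congr chart_inv.
apply/eqP; rewrite -subr_eq0 -normr_le0; apply/ler_addgt0Pr => eps eps0; rewrite add0r.
have [k /ltW kE] := geometric_lt (2 * d) eps0.
exact: le_trans (key k t tt) kE.
Qed.

(** The coincidence set in the time interval is open by local uniqueness and closed because M is
    Hausdorff; it contains 0 and the interval is connected. *)
Lemma integral_curve_unique (e : R) (c1 c2 : R -> M) :
  integral_curve e c1 -> integral_curve e c2 -> c1 0 = c2 0 ->
  forall t : R, `|t| < e -> c1 t = c2 t.
Proof.
move=> i1 i2 c12 t te.
pose A := [set t : R | `|t| < e].
have Ac : connected A.
  apply/connected_intervalP => x y /= xe ye z /andP[xz zy].
  by move: xe ye; rewrite /A/= !ltr_norml => /andP[? ?] /andP[? ?]; apply/andP; split; lra.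
pose B := [set t : R | `|t| < e /\ c1 t = c2 t].
have Ao : open A.
  by rewrite openE => x; exact: near_norm_lt.
have Bo : open B.
  rewrite openE => x [xe xc]; apply: filterI; first by apply: open_nbhs_nbhs.
  exact: (integral_curve_unique_near i1 i2 xe xc).
suff : B = A by move=> BA; have : A t by []; rewrite -BA => -[].
apply: Ac.
- by exists 0; split => //; rewrite normr0 (le_lt_trans _ te).
- by exists B => //; apply/seteqP; split=> [x [? ?]|x []].
- exists (closure B); first exact: closed_closure.
  apply/seteqP; split=> [x Bx|x [xe xB]].
    by split; [case: Bx|exact: subset_closure].
  split => //; apply: (@manifold_hausdorff _ _ M) => U1 U2 n1 n2.
  have [k1 _] := i1 x xe; have [k2 _] := i2 x xe.
  have h1 : \forall y \near x, U1 (c1 y) := k1 _ n1.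
  have h2 : \forall y \near x, U2 (c2 y) := k2 _ n2.
  have [y [[_ yc] [y1 y2]]] := xB _ (filterI h1 h2).
  by exists (c1 y); split => //; rewrite yc.
Qed.

End IntegralCurves.

(** * Completeness of the flow on a compact manifold *)

Section GlobalFlow.
Variables (R : realType) (n : nat) (M : manifold R n) (u : vfield M).
Hypothesis M_compact : compact [set: M].
Local Notation C := (smooth_fun M).

(** Compactness gives one lifetime valid at all points. A local flow is then chosen at each point,
    and only the curve through that point is kept. *)
Lemma uniform_local_flow : exists e phi, 0 < e /\ @local_flow R n M u e setT phi.
Proof.
pose good (e : R) (x : M) := exists N phi, [/\ open N, N x & @local_flow R n M u e N phi].
have : \forall e \near (0 : R)^'+, [set: M] `<=` good e.
  apply: ((compact_near_coveringP _).1 M_compact R (0 : R)^'+ good _) => p _.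
  have [e [N [phi [e0 No Np lf]]]] := local_flow_exists u p.
  exists (N, [set e' | e' <= e]); first by split => /=; [exact: open_nbhs_nbhs|exact: nbhs_right_le].
  move=> [q e'] /= [Nq e'e]; exists N, phi; split => // x /lf[h1 h2 h3].
  split => //; first exact: integral_curve_le h2.
  by move=> t te; apply: h3; exact: lt_le_trans e'e.
move=> H; have : \forall e \near (0 : R)^'+, 0 < e /\ [set: M] `<=` good e.
  by apply: filterI => //; exact: nbhs_right_gt.
move=> /filter_ex[e [e0 ge]].
have ex x : exists D : set M * (R -> M -> M), [/\ open D.1, D.1 x & @local_flow R n M u e D.1 D.2].
  by have [N [phi H1]] := ge x I; exists (N, phi).
pose D x := projT1 (cid (ex x)).
have DP x : [/\ open (D x).1, (D x).1 x & @local_flow R n M u e (D x).1 (D x).2] by rewrite /D; case: cid.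
exists e, (fun t x => (D x).2 t x); split => // x _.
have [Dxo Dxx lx] := DP x; have [l1 l2 l3] := lx x Dxx.
split => // t te.
(* By uniqueness of integral curves, the independent choices at neighbouring points agree with the
   flow chosen at x, so its joint continuity carries over. *)
have E : \forall z \near (t, x), (D x).2 z.1 z.2 = (D z.2).2 z.1 z.2.
  exists ([set s : R | `|s| < e], (D x).1) => /=.
    by split; [exact: near_norm_lt|exact: open_nbhs_nbhs].
  move=> [s y] /= [se Dxy].
  have [_ Dyy ly] := DP y.
  have [k1 k2 _] := lx y Dxy; have [m1 m2 _] := ly y Dyy.
  by apply: (integral_curve_unique k2 m2) => //; rewrite k1 m1.
by apply: cvg_trans (l3 t te); apply: near_eq_cvg; apply: filterS E => z ->.
Qed.

Lemma integral_curve_shift (e a : R) (c : R -> M) (t : R) : integral_curve u e c ->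
  `|t| + a <= e -> integral_curve u a (fun s => c (s + t)).
Proof.
move=> ic tae s sa.
have st : `|s + t| < e by apply: le_lt_trans (ler_normD _ _) _; lra.
have [cc cd] := ic _ st; split; last by move=> h; apply: is_derive_shiftr.
apply: (@continuous_comp _ _ _ (fun s => s + t) c) => //.
by apply: cvgD; [exact: cvg_id|exact: cvg_cst].
Qed.

Section Extend.
Variables (e : R) (phi : R -> M -> M).
Hypotheses (e0 : 0 < e) (lf : @local_flow R n M u e setT phi).
(** Half of the lifetime, so that a sum of two admissible times is still below [e]. *)
Let a := e / 2.
Let a0 : 0 < a. Proof. by rewrite divr_gt0. Qed.
Let phi0 x : phi 0 x = x. Proof. by have [] := lf (x := x) I. Qed.
Let phi_ic x : integral_curve u e (phi^~ x). Proof. by have [] := lf (x := x) I. Qed.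

Let phiD s t x : `|s| < a -> `|t| < a -> phi (s + t) x = phi s (phi t x).
Proof.
move=> sa ta.
have i1 : integral_curve u a (fun s => phi (s + t) x).
  by apply: integral_curve_shift (phi_ic x) _; rewrite /a in ta *; lra.
have i2 : integral_curve u a (phi^~ (phi t x)).
  by apply: integral_curve_le (phi_ic _); rewrite /a; have := e0; lra.
by apply: (integral_curve_unique i1 i2) => //; rewrite add0r phi0.
Qed.

Let phiM k s x : `|k%:R * s| < a -> iter k (phi s) x = phi (k%:R * s) x.
Proof.
elim: k => [|k IH] ks; first by rewrite mul0r phi0.
have ks' : `|k%:R * s| < a /\ `|s| < a.
  move: ks; rewrite !normrM !normr_nat -natr1 mulrDl mul1r => ks.
  have : 0 <= k%:R * `|s| by rewrite mulr_ge0.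
  by have := normr_ge0 s; move=> ? ?; split; lra.
by rewrite iterS IH; [|exact: ks'.1]; rewrite -phiD; [rewrite -[in RHS]natr1 mulrDl mul1r addrC|exact: ks'.2|exact: ks'.1].
Qed.

Let good m (t : R) := (0 < m)%N /\ `|t| < m%:R * a.

Let goodV m (t : R) : good m t -> `|t / m%:R| < a.
Proof.
move=> [m0 tm]; rewrite normrM normfV (ger0_norm (ler0n _ _)) ltr_pdivrMr ?ltr0n//.
by rewrite mulrC.
Qed.

(* The flow at time t is the m-fold iterate of the local flow at time t / m. *)
Let root m t x := iter m (phi (t / m%:R)) x.

Let root_mul m k t x : good m t -> (0 < k)%N -> root (m * k) t x = root m t x.
Proof.
move=> gm k0; rewrite /root iterM; apply: eq_iter => y.
have m0 : (0 < m)%N by case: gm.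
have E : k%:R * (t / (m * k)%:R) = t / m%:R :> R.
  by rewrite natrM; field; rewrite !pnatr_eq0 -!lt0n m0.
by rewrite phiM E//; exact: goodV.
Qed.

(** Both subdivisions are compared with the common refinement into [m * k] steps. *)
Let root_eq m k t x : good m t -> good k t -> root m t x = root k t x.
Proof.
move=> gm gk; rewrite -(root_mul x gm gk.1) mulnC; exact: root_mul x gk gm.1.
Qed.

Let bnd (t : R) := (Num.bound (`|t| / a)).+1.

Let good_bnd t : good (bnd t) t.
Proof.
split => //; rewrite -ltr_pdivrMr//.
apply: lt_le_trans (archi_boundP _) _; first by rewrite divr_ge0// ltW.
by rewrite ler_nat.
Qed.

Let good_le m k t : good m t -> (m <= k)%N -> good k t.
Proof.
move=> [m0 tm] mk; split; first exact: leq_trans mk.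
by apply: lt_le_trans tm _; rewrite ler_wpM2r ?ler_nat// ltW.
Qed.

Let Phi t x := root (bnd t) t x.

Let PhiE m t x : good m t -> Phi t x = root m t x.
Proof. by move=> gm; apply: root_eq => //; exact: good_bnd. Qed.

Let Phi_small t x : `|t| < a -> Phi t x = phi t x.
Proof. by move=> ta; rewrite (@PhiE 1)/root ?divr1//; split; rewrite ?mul1r. Qed.

Let PhiD s t x : Phi (s + t) x = Phi s (Phi t x).
Proof.
pose m := maxn (bnd (s + t)) (maxn (bnd s) (bnd t)).
have g1 : good m (s + t) by apply: good_le (good_bnd _) _; rewrite leq_maxl.
have g2 : good m s by apply: good_le (good_bnd _) _; rewrite /m maxnCA leq_maxl.
have g3 : good m t by apply: good_le (good_bnd _) _; rewrite /m !leq_max leqnn !orbT.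
rewrite (PhiE _ g1) (PhiE _ g2) (PhiE _ g3) /root.
have hs := goodV g2; have ht := goodV g3.
rewrite mulrDl; set s' := s / _ in hs *; set t' := t / _ in ht *.
(* With a common number of steps, the group law reduces to interleaving the two kinds of step, which
   commute since addition of small times does. *)
have comm k y : phi t' (iter k (phi s') y) = iter k (phi s') (phi t' y).
  by elim: k => //= k <-; rewrite -!phiD// addrC.
by elim: (m) x => //= k IH y; rewrite IH phiD// comm.
Qed.

Let iter_cvg k (t : R) x : `|t| < e -> iter k (phi z.1) z.2 @[z --> (t, x)] --> iter k (phi t) x.
Proof.
move=> te; elim: k => [|k IH]; first exact: cvg_snd.
apply: (@cvg_comp _ _ _ (fun z : R * M => (z.1, iter k (phi z.1) z.2)) (fun z => phi z.1 z.2) _ (nbhs (t, iter k (phi t) x))).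
  by apply: (@cvg_pair_at (R * M)%type) => //; exact: cvg_fst.
by have [_ _] := lf (x := iter k (phi t) x) I; apply.
Qed.

Let Phi_cvg (t : R) x : Phi z.1 z.2 @[z --> (t, x)] --> Phi t x.
Proof.
have gt := good_bnd t; set m := bnd t in gt.
have near_good : \forall s \near t, good m s.
  by apply: filterS (near_norm_lt gt.2) => s ms; split => //; exact: gt.1.
have L : root m z.1 z.2 @[z --> (t, x)] --> root m t x.
  apply: (@cvg_comp _ _ _ (fun z : R * M => (z.1 / m%:R, z.2)) (fun z => iter m (phi z.1) z.2) _ (nbhs (t / m%:R, x))).
    by apply: (@cvg_pair_at (R * M)%type); [apply: cvgMr_tmp; exact: cvg_fst|exact: cvg_snd].
  by apply: iter_cvg; apply: lt_trans (goodV gt) _; rewrite /a; have := e0; lra.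
apply: cvg_trans L; apply: near_eq_cvg.
exists ([set s | good m s], setT) => /=; first by split => //; exact: filterT.
by move=> [s y] /= [gs _]; rewrite -(PhiE _ gs).
Qed.

Lemma extend_flow : exists F : R -> M -> M,
  [/\ forall x, F 0 x = x, forall s t x, F (s + t) x = F s (F t x),
      forall (t : R) x, F z.1 z.2 @[z --> (t, x)] --> F t x &
      forall (h : C) x (t : R), is_derive t 1 (fun s => h (F s x) : R^o) ((u h : C) (F t x))].
Proof.
exists Phi; split; [by move=> x; rewrite Phi_small ?phi0// normr0|exact: PhiD|exact: Phi_cvg|].
move=> h x t.
have D : is_derive (t + - t) 1 (fun s => h (phi s (Phi t x)) : R^o) ((u h : C) (Phi t x)).
  have [_] := phi_ic (Phi t x) (t := 0) ltac:(by rewrite normr0).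
  by rewrite subrr phi0; apply.
(* By the group law, the derivative at any time is the derivative at time 0 of the local flow
   through [Phi t x]. *)
apply: (@near_eq_is_derive _ _ _ (fun s => h (phi (s + - t) (Phi t x)) : R^o)); last first.
  exact: (is_derive_shiftr D).
apply: filterS (nbhsx_ballx t a a0) => s; rewrite -ball_normE/= => sa.
by rewrite -Phi_small ?(distrC s)// -PhiD subrK.
Qed.

End Extend.

Lemma global_flow : exists F : R -> M -> M,
  [/\ forall x, F 0 x = x, forall s t x, F (s + t) x = F s (F t x),
      forall (t : R) x, F z.1 z.2 @[z --> (t, x)] --> F t x &
      forall (h : C) x (t : R), is_derive t 1 (fun s => h (F s x) : R^o) ((u h : C) (F t x))].
Proof. by have [e [phi [e0 lf]]] := uniform_local_flow; exact: extend_flow lf. Qed.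

End GlobalFlow.

(** * Flows with one source and one sink *)

Section RealLine.
Variable R : realType.

Lemma mean_value_exists (y dy : R -> R^o) (s t : R) : s <= t ->
  (forall r : R, is_derive r 1 y (dy r)) ->
  exists2 c, s <= c <= t & y t - y s = dy c * (t - s).
Proof.
move=> st D; have [|c] := @MVT_segment R y dy s t st (fun x _ => D x).
  by apply: continuous_subspaceT => x; exact: is_derive_continuous (D x).
by rewrite in_itv/= => cst; exists c.
Qed.

Lemma derive_ge0_ndecr (y dy : R -> R^o) (s t : R) : s <= t ->
  (forall r : R, is_derive r 1 y (dy r)) -> (forall r, 0 <= dy r) -> y s <= y t.
Proof.
move=> st D dy0; have [c _ E] := mean_value_exists st D.
by rewrite -subr_ge0 E mulr_ge0 ?subr_ge0.
Qed.

Lemma derive_at_min (y dy : R -> R^o) (s : R) :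
  (forall r : R, is_derive r 1 y (dy r)) -> (forall r, y s <= y r) -> dy s = 0.
Proof.
move=> D m; have : is_derive s 1 y 0.
  apply: (@derive1_at_min R y (s - 1) (s + 1)).
  - by lra.
  - by move=> t _; have [] := D t.
  - by rewrite in_itv/=; apply/andP; split; lra.
  - by move=> t _; exact: m.
by move=> [_ <-]; have [_ ->] := D s.
Qed.

(** Positivity at the single time s suffices: if y(t) <= y(s), then the nondecreasing y has an
    interior maximum at s on ]s - 1, t[, and its derivative there would be 0. *)
Lemma derive_gt0_incr (y dy : R -> R^o) (s t : R) : s < t ->
  (forall r : R, is_derive r 1 y (dy r)) -> (forall r, 0 <= dy r) -> 0 < dy s -> y s < y t.
Proof.
move=> st D dy0 ds; rewrite ltNge; apply/negP => ts.
have : is_derive s 1 y 0.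
  apply: (@derive1_at_max R y (s - 1) t).
  - by lra.
  - by move=> r _; have [] := D r.
  - by rewrite in_itv/=; apply/andP; split; lra.
  - move=> r; rewrite in_itv/= => /andP[_ rt]; apply: le_trans ts.
    exact: derive_ge0_ndecr (ltW rt) D dy0.
by move=> [_ E]; have [_ E'] := D s; move: ds; rewrite -E' E ltxx.
Qed.

End RealLine.

Lemma cvg_row (R : realType) (m : nat) (T : topologicalType) (f : T -> 'rV[R]_m) (x : T) (l : 'rV[R]_m) :
  (forall i, f t 0 i @[t --> x] --> l 0 i) -> f @ x --> l.
Proof.
move=> H; apply/cvgrPdist_le => e e0.
have : \forall t \near x, forall i, `|l 0 i - f t 0 i| <= e.
  apply: (@filter_forall _ 'I_m _ (nbhs x) (nbhs_filter x)) => i.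
  by move/cvgrPdist_le : (H i) => /(_ e e0).
apply: filterS => t Ht; apply: norm_le_coord => [|i]; first exact: ltW.
by rewrite !mxE.
Qed.

Lemma compact_bijection_homeomorphic (S T : topologicalType) (F : S -> T) :
  compact [set: S] -> hausdorff_space T -> continuous F -> injective F ->
  (forall y, exists x, F x = y) -> homeomorphic S T.
Proof.
move=> Sc Th Fc Fi Fs.
pose G y := projT1 (cid (Fs y)).
have FG : cancel G F by move=> y; rewrite /G; case: cid.
have GF : cancel F G by move=> x; apply: Fi; rewrite FG.
exists F, G; split => //; apply/continuous_closedP => A Ac.
rewrite (_ : G @^-1` A = F @` A).
  apply: compact_closed => //; apply: continuous_compact; first exact: continuous_subspaceT.
  by apply: subclosed_compact Sc _.
apply/seteqP; split=> [y Gy|_ [x Ax <-]]; first by exists (G y).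
by rewrite /= GF.
Qed.

Lemma set_type_hausdorff (T : topologicalType) (A : set T) :
  hausdorff_space T -> hausdorff_space (set_type A).
Proof.
move=> Th x y xy; apply: val_inj; apply: Th => U1 U2 n1 n2.
have c : continuous (set_val : set_type A -> T) by exact: initial_continuous.
by have [z [z1 z2]] := xy _ _ (c x _ n1) (c y _ n2); exists (set_val z).
Qed.

(* p is the sink and q the source of psi; L is a Lyapunov function, [b = b0] is a cross-section around p and dir its identification with the unit sphere. *)
Section Dynamics.
Variables (R : realType) (n : nat) (M : topologicalType) (p q : M) (psi : R -> M -> M).
Variables (L k b db : M -> R^o) (b0 : R) (dir : M -> 'rV[R]_n).
Hypotheses (Mc : compact [set: M]) (pq : p <> q).
Hypotheses (psi0 : forall x, psi 0 x = x) (psiD : forall s t x, psi (s + t) x = psi s (psi t x)).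
Hypothesis psi_cvg : forall (t : R) x, psi z.1 z.2 @[z --> (t, x)] --> psi t x.
Hypotheses (L_cts : continuous L) (k_cts : continuous k) (b_cts : continuous b).
Hypothesis dL : forall x (t : R), is_derive t 1 (fun s => L (psi s x)) (k (psi t x)).
Hypotheses (k_ge0 : forall x, 0 <= k x) (k_eq0 : forall x, k x = 0 -> x = p \/ x = q).
Hypothesis dbP : forall x (t : R), is_derive t 1 (fun s => b (psi s x)) (db (psi t x)).
Hypotheses (db_ge0 : forall x, 0 <= db x) (db_gt0 : forall x, 0 < b x -> x <> p -> 0 < db x).
Hypotheses (b0_gt0 : 0 < b0) (bp : b0 < b p) (bq : b q = 0).
Hypothesis b_nontrivial : exists2 x, x <> p & 0 < b x.
Hypothesis dir_unit : forall x, b x = b0 -> \sum_i dir x 0 i ^+ 2 = 1.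
Hypothesis dir_inj : forall x y, b x = b0 -> b y = b0 -> dir x = dir y -> x = y.
Hypothesis dir_surj : forall y : 'rV[R]_n, \sum_i y 0 i ^+ 2 = 1 -> exists2 x, b x = b0 & dir x = y.
Hypothesis dir_cts : forall x, b x = b0 -> {for x, continuous dir}.

Let L_ndecr x s t : s <= t -> L (psi s x) <= L (psi t x).
Proof. by move=> st; apply: (derive_ge0_ndecr st (dL x)). Qed.

Let b_ndecr x s t : s <= t -> b (psi s x) <= b (psi t x).
Proof. by move=> st; apply: (derive_ge0_ndecr st (dbP x)). Qed.

(** On a compact set avoiding p and q, the speed [k] has a positive minimum, while L is bounded; an
    orbit cannot stay there for long. *)
Let escape (K : set M) : closed K -> ~ K p -> ~ K q ->
  exists2 T : R, 0 <= T & forall x, exists2 t, 0 <= t <= T & ~ K (psi t x).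
Proof.
move=> Kc Kp Kq.
have [K0|/set0P/negP] := pselect (K !=set0); last first.
  rewrite negbK => /eqP ->; exists 0 => // x; exists 0; rewrite ?lexx//.
have Kco : compact K by apply: subclosed_compact Mc _.
have [m Km mmin] := compact_EVT_min K0 Kco (continuous_subspaceT k_cts).
rewrite inE in Km.
have km : 0 < k m.
  rewrite lt_neqAle k_ge0 andbT eq_sym; apply/eqP => /k_eq0[] E; [apply: Kp|apply: Kq];
  by rewrite -E.
have [B B0 HB] := compact_norm_bound Mc (fun x _ => L_cts (x := x)).
(* Staying in K up to this time would raise L by at least 2B + 1, although |L| <= B. *)
pose T := (2 * B + 1) / k m.
have T0 : 0 <= T by rewrite divr_ge0 ?(ltW km)// addr_ge0// mulr_ge0.
exists T => // x; apply: contrapT => nx.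
have Kall t : 0 <= t <= T -> K (psi t x).
  by move=> tT; apply: contrapT => nK; apply: nx; exists t.
have [c cT E] := mean_value_exists T0 (dL x).
have : k m <= k (psi c x) by apply: mmin; rewrite inE; exact: Kall.
have := HB (psi T x) I; have := HB (psi 0 x) I.
rewrite !ler_norml => /andP[h1 h2] /andP[h3 h4] kc.
have : k m * T <= L (psi T x) - L (psi 0 x) by rewrite E subr0 ler_wpM2r.
rewrite /T mulrC divfK ?gt_eqF//; lra.
Qed.

Let crit_max x : (forall y, L y <= L x) -> x = p \/ x = q.
Proof.
move=> m; apply: k_eq0.
have D (r : R) : is_derive r 1 (fun t => - L (psi t x) : R^o) (- k (psi r x)).
  by apply: is_deriveN.
have : - k (psi 0 x) = 0.
  apply: (@derive_at_min R (fun t => - L (psi t x)) (fun t => - k (psi t x)) 0 D) => r.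
  by rewrite psi0 lerN2.
by move/eqP; rewrite psi0 oppr_eq0 => /eqP.
Qed.

Let crit_min x : (forall y, L x <= L y) -> x = p \/ x = q.
Proof.
move=> m; apply: k_eq0.
have := @derive_at_min R (fun t => L (psi t x)) (fun t => k (psi t x)) 0.
by rewrite psi0; apply => // r; rewrite psi0.
Qed.

Let qp : b q < b p. Proof. by rewrite bq (lt_trans b0_gt0). Qed.

Let M0 : [set: M] !=set0. Proof. by exists p. Qed.

(** Extrema of L are stationary, hence located in {p, q}. What has to be excluded is the reversed
    situation, with the maximum at q and the minimum at p. *)
Let L_extrema : (forall y, L y <= L p) /\ (forall y, L q <= L y).
Proof.
have [M1 _ M1max] := compact_EVT_max M0 Mc (continuous_subspaceT L_cts).
have [M2 _ M2min] := compact_EVT_min M0 Mc (continuous_subspaceT L_cts).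
have hmax y : L y <= L M1 by apply: M1max; rewrite inE.
have hmin y : L M2 <= L y by apply: M2min; rewrite inE.
have [x1 x1p bx1] := b_nontrivial.
have x1q : x1 <> q by move=> E; move: bx1; rewrite E bq ltxx.
have notcrit : ~ (x1 = p \/ x1 = q) by case.
have nconst : L M2 < L M1.
  rewrite lt_neqAle hmin andbT; apply/eqP => E.
  by apply: notcrit; apply: crit_max => y; apply: le_trans (hmax y) _; rewrite -E.
have nqmax : ~ (forall y, L y <= L q).
  move=> qmax.
  have pmin y : L p <= L y.
    have [E|E] := crit_min hmin; first by rewrite -E.
    by move: nconst; rewrite E ltNge qmax.
  have Lx1 : L p < L x1.
    rewrite lt_neqAle pmin andbT; apply/eqP => E; apply: notcrit.
    by apply: crit_min => y; rewrite -E.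
  (* A forward invariant set, since b and L do not decrease along orbits. It misses p because L p <
     L x1, and q because b q = 0 < b x1, so the orbit of x1 would contradict [escape]. *)
  pose K := [set x | b x1 <= b x] `&` [set x | L x1 <= L x].
  have Kc : closed K.
    apply: closedI.
      by have := (continuous_closedP _).1 b_cts _ (@closed_ge R (b x1)).
    by have := (continuous_closedP _).1 L_cts _ (@closed_ge R (L x1)).
  have [|||T T0 /(_ x1)[t /andP[t0 _]]] := @escape K => //.
  - by move=> [_ /=]; rewrite leNgt Lx1.
  - by move=> [/= + _]; rewrite bq leNgt bx1.
  apply; split => /=; first by rewrite -[in leLHS](psi0 x1) b_ndecr.
  by rewrite -[in leLHS](psi0 x1) L_ndecr.
have pmax : M1 = p by have [//|E] := crit_max hmax; exfalso; apply: nqmax => y; rewrite -E.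
have qmin : M2 = q.
  by have [E|//] := crit_min hmin; move: nconst; rewrite pmax E ltxx.
by split => y; rewrite -?pmax -?qmin.
Qed.

Let L_lt_p x : x <> p -> L x < L p.
Proof.
have [pmax qmin] := L_extrema => xp.
rewrite lt_neqAle pmax andbT; apply/eqP => E.
have xmax y : L y <= L x by rewrite E.
have [//|xq] := crit_max xmax.
have [y yp by0] := b_nontrivial.
have [//|yq] : y = p \/ y = q by apply: crit_max => z; apply: le_trans (xmax z) _; rewrite xq.
by move: by0; rewrite yq bq ltxx.
Qed.

Let L_gt_q x : x <> q -> L q < L x.
Proof.
have [pmax qmin] := L_extrema => xq.
rewrite lt_neqAle qmin andbT; apply/eqP => E.
have xmin y : L x <= L y by rewrite -E.
have [xp|//] := crit_min xmin.
by have := @L_lt_p q (fun h => pq (esym h)); rewrite E xp ltxx.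
Qed.

Let psiK t x : psi t (psi (- t) x) = x. Proof. by rewrite -psiD subrr psi0. Qed.
Let psiNK t x : psi (- t) (psi t x) = x. Proof. by rewrite -psiD addNr psi0. Qed.

(** Forward in time L cannot drop below its value at p, which is attained nowhere else; negative
    times follow by inverting the flow. *)
Let fix_p t : psi t p = p.
Proof.
have pos s : 0 <= s -> psi s p = p.
  move=> s0; apply: contrapT => /L_lt_p; rewrite ltNge -[in X in X <= _](psi0 p).
  by rewrite L_ndecr.
have [t0|t0] := leP 0 t; first exact: pos.
by rewrite -[in LHS](pos (- t)) ?psiK// oppr_ge0 ltW.
Qed.

Let fix_q t : psi t q = q.
Proof.
have neg s : s <= 0 -> psi s q = q.
  move=> s0; apply: contrapT => /L_gt_q; rewrite ltNge -[in X in _ <= X](psi0 q).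
  by rewrite L_ndecr.
have [t0|t0] := leP t 0; first exact: neg.
by rewrite -[in LHS](neg (- t)) ?psiK// oppr_le0 ltW.
Qed.

Let psi_inj t : injective (psi t).
Proof. by move=> x y E; rewrite -(psiNK t x) E psiNK. Qed.

Let psi_neq_p t x : x <> p -> psi t x <> p.
Proof. by move=> xp E; apply: xp; apply: (@psi_inj t); rewrite fix_p. Qed.

Let b_incr x s t : x <> p -> 0 < b (psi s x) -> s < t -> b (psi s x) < b (psi t x).
Proof.
move=> xp bs st; apply: (derive_gt0_incr st (dbP x)) => //.
by apply: db_gt0 => //; exact: psi_neq_p.
Qed.

(** Forward, the orbit leaves the set where b <= b0 and L >= L x, and backward the set where b >= b0
    and L <= L x; each of these contains neither p nor q. The intermediate value theorem then
    applies to b. *)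
Let crossing x : x <> p -> x <> q -> exists t, b (psi t x) = b0.
Proof.
move=> xp xq.
have [t1 h1] : exists t, b0 < b (psi t x).
  pose K := [set y | b y <= b0] `&` [set y | L x <= L y].
  have Kc : closed K.
    apply: closedI.
      by have := (continuous_closedP _).1 b_cts _ (@closed_le R b0).
    by have := (continuous_closedP _).1 L_cts _ (@closed_ge R (L x)).
  have [|||T T0 /(_ x)[t /andP[t0 _] nK]] := @escape K => //.
  - by move=> [/= + _]; rewrite leNgt bp.
  - by move=> [_ /=]; rewrite leNgt L_gt_q.
  exists t; rewrite ltNge; apply/negP => h; apply: nK; split => //=.
  by rewrite -[in leLHS](psi0 x) L_ndecr.
have [t2 h2] : exists t, b (psi t x) < b0.
  pose K := [set y | b0 <= b y] `&` [set y | L y <= L x].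
  have Kc : closed K.
    apply: closedI.
      by have := (continuous_closedP _).1 b_cts _ (@closed_ge R b0).
    by have := (continuous_closedP _).1 L_cts _ (@closed_le R (L x)).
  (* [escape] speaks of positive times; starting at time -T keeps the orbit in the past of x, where
     L is at most L x. *)
  have [|||T T0 /(_ (psi (- T) x))[t /andP[t0 tT] nK]] := @escape K => //.
  - by move=> [_ /=]; rewrite leNgt L_lt_p.
  - by move=> [/= + _]; rewrite bq leNgt b0_gt0.
  exists (t + - T); rewrite psiD ltNge; apply/negP => h; apply: nK; split => //=.
  by rewrite -psiD -[in leRHS](psi0 x) L_ndecr// subr_le0.
have t21 : t2 <= t1.
  by rewrite leNgt; apply/negP => /ltW/(@b_ndecr x); rewrite leNgt (lt_trans h2).
have [||c _ E] := @IVT R (fun t => b (psi t x)) t2 t1 b0 t21; last by exists c.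
  by apply: continuous_subspaceT => t; exact: is_derive_continuous (dbP x t).
by rewrite ge_min (ltW h2)/= le_max (ltW h1) orbT.
Qed.

Let T x : R := if pselect (x <> p /\ x <> q) is left h then projT1 (cid (crossing h.1 h.2)) else 0.

Let TP x : x <> p -> x <> q -> b (psi (T x) x) = b0.
Proof.
move=> xp xq; rewrite /T; case: pselect => [h|]; last by case.
by case: cid.
Qed.

(** Comparing the crossing time with a is the same as an inequality on b at time a, an open
    condition on x; continuity of T and the behaviour near the poles follow from this equivalence
    and its mirror image. *)
Let T_lt x a : x <> p -> x <> q -> (T x < a) = (b0 < b (psi a x)).
Proof.
move=> xp xq; apply/idP/idP => [h|h].
  by rewrite -{1}(TP xp xq); apply: b_incr => //; rewrite TP.
rewrite ltNge; apply/negP => /(@b_ndecr x); rewrite TP// leNgt h//.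
Qed.

Let T_gt x a : x <> p -> x <> q -> (a < T x) = (b (psi a x) < b0).
Proof.
move=> xp xq; apply/idP/idP => [h|h].
  rewrite -(TP xp xq); have [ba|ba] := leP (b (psi a x)) 0; last exact: b_incr.
  by rewrite TP// (le_lt_trans ba).
rewrite ltNge; apply/negP => /(@b_ndecr x); rewrite TP// leNgt h//.
Qed.

Let T_unique x t : x <> p -> x <> q -> b (psi t x) = b0 -> T x = t.
Proof.
move=> xp xq E; apply/eqP; rewrite eq_le !leNgt T_gt// T_lt// E !ltxx//.
Qed.

Let psi_cts a : continuous (psi a).
Proof.
move=> x; apply: (@cvg_comp _ _ _ (fun y => (a, y)) (fun z => psi z.1 z.2) _ (nbhs (a, x))); last exact: psi_cvg.
by apply: cvg_pair_at; [exact: cvg_cst|exact: cvg_id].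
Qed.

Let bpsi_gt x a c : c < b (psi a x) -> \forall y \near x, c < b (psi a y).
Proof.
move=> h; have cc : {for x, continuous (b \o psi a)} by apply: continuous_comp; [exact: psi_cts|exact: b_cts].
by apply: (cc [set r | c < r]); exact: lt_nbhsr.
Qed.

Let bpsi_lt x a c : b (psi a x) < c -> \forall y \near x, b (psi a y) < c.
Proof.
move=> h; have cc : {for x, continuous (b \o psi a)} by apply: continuous_comp; [exact: psi_cts|exact: b_cts].
by apply: (cc [set r | r < c]); exact: lt_nbhsl.
Qed.

(** * The map to the sphere in terms of crossing time and direction *)

Let den (t : R) := Num.sqrt (1 + t ^+ 2).

Let den_gt0 t : 0 < den t.
Proof. by rewrite sqrtr_gt0 ltr_pwDl// sqr_ge0. Qed.

Let den_sqr t : den t ^+ 2 = 1 + t ^+ 2.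
Proof. by rewrite sqr_sqrtr// addr_ge0// sqr_ge0. Qed.

(** Together with [radius], the central projection of the point (t, 1) to the unit circle; it tends
    to (1, 0) and (-1, 0) as t goes to plus and minus infinity. *)
Let height (t : R) := t / den t.
Let radius (t : R) := (den t)^-1.

Let radius_gt0 t : 0 < radius t. Proof. by rewrite invr_gt0. Qed.

Let height_radius t : height t ^+ 2 + radius t ^+ 2 = 1.
Proof.
rewrite /height /radius expr_div_n exprVn -[X in _ + X]mul1r -mulrDl den_sqr addrC divff//.
by rewrite -den_sqr sqrf_eq0 gt_eqF.
Qed.

Let height_inj s t : height s = height t -> s = t.
Proof.
move=> E; have : radius s ^+ 2 = radius t ^+ 2.
  by have := height_radius s; rewrite E -(height_radius t) => /addrI.
move=> /eqP; rewrite eqrXn2 ?ltW// => /eqP rE.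
have nz : radius t != 0 by rewrite gt_eqF.
by move: E; rewrite /height -/(radius s) -/(radius t) rE => /(mulIf nz).
Qed.

Let radius_le e t : 0 < e -> e^-1 < `|t| -> radius t <= e.
Proof.
move=> e0 et; rewrite -[e]invrK /radius lef_pV2 ?posrE ?invr_gt0//.
apply: le_trans (ltW et) _; rewrite -sqrtr_sqr ler_wsqrtr// lerDr//.
Qed.

Let radius_le1 t : radius t <= 1.
Proof.
rewrite /radius invf_le1// -[leLHS]sqrtr1 ler_wsqrtr// lerDl sqr_ge0//.
Qed.

(** Here c is the sign of t, and h = c [height t] is positive with h^2 = 1 - r^2, r being the
    radius. Hence 1 - h = r^2 / (1 + h) <= r <= e. *)
Let height_dist e t c : 0 < e -> c ^+ 2 = 1 -> 0 < c * t -> e^-1 < `|t| -> `|c - height t| <= e.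
Proof.
move=> e0 c1 ct et; have re := radius_le e0 et.
have ch : 0 < c * height t by rewrite /height mulrA divr_gt0.
have hr := height_radius t; have r0 := radius_gt0 t; have r1 := radius_le1 t.
have -> : c - height t = c * (1 - c * height t) by rewrite mulrBr mulr1 mulrA -expr2 c1 mul1r.
have cn : `|c| = 1.
  by apply/eqP; rewrite -(@eqrXn2 _ 2)// ?normr_ge0// expr1n -normrX c1 normr1.
rewrite normrM cn mul1r.
have hc : (c * height t) ^+ 2 = 1 - radius t ^+ 2 by rewrite exprMn c1 mul1r -hr addrK.
move: hc ch; set h := c * height t => hc ch.
have h1 : h <= 1 by nra.
rewrite ger0_norm ?subr_ge0//; apply: le_trans re; nra.
Qed.

Let spt (c r : R) (y : 'rV[R]_n) : 'rV[R]_n.+1 :=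
  \row_(i < n.+1) oapp (fun j => r * y 0 j) c (unlift ord0 i).

Let spt0 c r y : spt c r y 0 ord0 = c.
Proof. by rewrite mxE unlift_none. Qed.

Let sptS c r y j : spt c r y 0 (lift ord0 j) = r * y 0 j.
Proof. by rewrite mxE liftK. Qed.

Let spt_sphere c r (y : 'rV[R]_n) : c ^+ 2 + r ^+ 2 * (\sum_i y 0 i ^+ 2) = 1 -> sphere R n (spt c r y).
Proof.
move=> E; rewrite /sphere/= big_ord_recl spt0 -[RHS]E mulr_sumr; congr (_ + _).
by apply: eq_bigr => j _; rewrite sptS exprMn.
Qed.

(* A point is encoded by its crossing time and direction; the source and the sink go to the poles. *)
Let G x : 'rV[R]_n.+1 :=
  if pselect (x = p) is left _ then spt (-1) 0 0 else
  if pselect (x = q) is left _ then spt 1 0 0 else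
  spt (height (T x)) (radius (T x)) (dir (psi (T x) x)).

Let Gp : G p = spt (-1) 0 0.
Proof. by rewrite /G; case: pselect. Qed.

Let Gq : G q = spt 1 0 0.
Proof.
rewrite /G; case: pselect => [E|_]; first by case: pq.
by case: pselect.
Qed.

Let GE x : x <> p -> x <> q -> G x = spt (height (T x)) (radius (T x)) (dir (psi (T x) x)).
Proof. by move=> xp xq; rewrite /G; case: pselect => // _; case: pselect. Qed.

Let trichotomy x : [\/ x = p, x = q | x <> p /\ x <> q].
Proof.
have [->|xp] := pselect (x = p); first exact: Or31.
have [->|xq] := pselect (x = q); first exact: Or32.
exact: Or33.
Qed.

Let G_sphere x : sphere R n (G x).
Proof.
have [->|->|[xp xq]] := trichotomy x.
- by rewrite Gp; apply: spt_sphere; rewrite expr0n mul0r addr0 sqrrN expr1n.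
- by rewrite Gq; apply: spt_sphere; rewrite expr0n mul0r addr0 expr1n.
- by rewrite GE//; apply: spt_sphere; rewrite dir_unit ?TP// mulr1 height_radius.
Qed.

Let height_lt1 t : height t ^+ 2 < 1.
Proof. by rewrite -(height_radius t) ltrDl exprn_gt0. Qed.

Let G_inj : injective G.
Proof.
have hneq x c : x <> p -> x <> q -> c ^+ 2 = 1 -> G x <> spt c 0 0.
  move=> xp xq c1; rewrite GE// => /(congr1 (fun v : 'rV_n.+1 => v 0 ord0)); rewrite !spt0 => E.
  by have := height_lt1 (T x); rewrite E c1 ltxx.
have n1 : (-1) ^+ 2 = 1 :> R by rewrite sqrrN expr1n.
have pn : spt (-1) 0 0 <> spt 1 0 0.
  move=> /(congr1 (fun v : 'rV_n.+1 => v 0 ord0)); rewrite !spt0 => /eqP; rewrite eq_sym -addr_eq0.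
  by rewrite (_ : 1 + 1 = 2%:R :> R) ?pnatr_eq0.
move=> x y; have [->|->|[xp xq]] := trichotomy x; have [->|->|[yp yq]] := trichotomy y => //;
  rewrite ?Gp ?Gq.
- by move=> /pn.
- by move=> /esym/hneq; case.
- by move=> /esym/pn.
- by move=> /esym/hneq; case=> //; rewrite expr1n.
- by move=> /hneq; case.
- by move=> /hneq; case=> //; rewrite expr1n.
rewrite !GE// => E.
have TE : T x = T y.
  apply: height_inj; have := congr1 (fun v : 'rV_n.+1 => v 0 ord0) E; by rewrite !spt0.
apply: (@psi_inj (T x)); rewrite [in RHS]TE; apply: dir_inj; rewrite ?TP//.
apply/rowP => j; have := congr1 (fun v : 'rV_n.+1 => v 0 (lift ord0 j)) E.
by rewrite !sptS TE; apply: mulfI; rewrite gt_eqF.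
Qed.

Let G_surj z : sphere R n z -> exists x, G x = z.
Proof.
rewrite /sphere/= big_ord_recl => zE.
pose y : 'rV[R]_n := \row_j z 0 (lift ord0 j).
have yE : \sum_j y 0 j ^+ 2 = 1 - z 0 ord0 ^+ 2.
  by rewrite -zE addrAC subrr add0r; apply: eq_bigr => j _; rewrite mxE.
have zspt (c r : R) (w : 'rV[R]_n) : z 0 ord0 = c -> (forall j : 'I_n, z 0 (lift ord0 j) = r * w 0 j) -> spt c r w = z.
  move=> z0 zS; apply/rowP => i; have [j ->|->] := unliftP ord0 i; last by rewrite spt0.
  by rewrite sptS zS.
have y0 : 0 <= \sum_j y 0 j ^+ 2 by apply: sumr_ge0 => j _; exact: sqr_ge0.
have [yy|yy] := eqVneq (\sum_j y 0 j ^+ 2) 0.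
  have yj (j : 'I_n) : z 0 (lift ord0 j) = 0.
    have h : y 0 j ^+ 2 <= 0.
      by rewrite -yy (bigD1 j)//= lerDl; apply: sumr_ge0 => i _; exact: sqr_ge0.
    have : y 0 j ^+ 2 == 0 by rewrite eq_le h sqr_ge0.
    by rewrite sqrf_eq0 mxE => /eqP.
  have : z 0 ord0 ^+ 2 == 1 ^+ 2 by rewrite expr1n eq_sym -subr_eq0 -yE yy.
  rewrite eqf_sqr => /orP[/eqP z1|/eqP z1].
    by exists q; rewrite Gq; apply: zspt => // j; rewrite yj mul0r.
  by exists p; rewrite Gp; apply: zspt => // j; rewrite yj mul0r.
pose nu := Num.sqrt (\sum_j y 0 j ^+ 2).
have nu2 : nu ^+ 2 = \sum_j y 0 j ^+ 2 by rewrite sqr_sqrtr.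
have nu0 : 0 < nu by rewrite sqrtr_gt0 lt_neqAle eq_sym yy.
have [m bm dm] : exists2 m, b m = b0 & dir m = nu^-1 *: y.
  apply: dir_surj; under eq_bigr => j _ do rewrite mxE exprMn.
  by rewrite -mulr_sumr -nu2 exprVn mulVf// sqrf_eq0 gt_eqF.
(* Since z_0^2 + nu^2 = 1, this t has sqrt(1 + t^2) = 1/nu, so its height is z_0 and its radius is
   nu. The preimage is the cross-section point m moved back by time t. *)
pose t := z 0 ord0 / nu.
have mp : m <> p by move=> E; move: bp; rewrite -E bm ltxx.
have mq : m <> q by move=> E; move: b0_gt0; rewrite -bm E bq ltxx.
pose x := psi (- t) m.
have xp : x <> p by exact: psi_neq_p.
have xq : x <> q by move=> E; apply: mq; rewrite -(psiK t m) -/x E fix_q.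
have xm : psi t x = m by rewrite /x psiK.
have Tx : T x = t by apply: T_unique => //; rewrite xm.
have dt : den t = nu^-1.
  rewrite /den /t expr_div_n -[Num.sqrt _]/(Num.sqrt (1 + _)).
  have -> : 1 + z 0 ord0 ^+ 2 / nu ^+ 2 = nu^-1 ^+ 2.
    have nn : nu ^+ 2 != 0 by rewrite sqrf_eq0 gt_eqF.
    rewrite exprVn -{1}(divff nn) -mulrDl nu2 yE subrK mul1r//.
  by rewrite sqrtr_sqr ger0_norm// invr_ge0 ltW.
exists x; rewrite GE// Tx xm; apply: zspt.
  by rewrite /height dt invrK /t divfK// gt_eqF.
by move=> j; rewrite /radius dt invrK dm !mxE mulVKf// gt_eqF.
Qed.

Let T_cts x : x <> p -> x <> q -> T @ x --> T x.
Proof.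
move=> xp xq; apply/cvgrPdist_le => e e0.
have h1 : \forall y \near x, b0 < b (psi (T x + e) y) by apply: bpsi_gt; rewrite -T_lt// ltrDl.
have h2 : \forall y \near x, b (psi (T x - e) y) < b0 by apply: bpsi_lt; rewrite -T_gt// gtrBl.
apply: filterS (filterI h1 h2) => y [y1 y2].
have yp : y <> p by move=> E; move: y2; rewrite E fix_p ltNge (ltW bp).
have yq : y <> q by move=> E; move: y1; rewrite E fix_q bq ltNge (ltW b0_gt0).
by rewrite -T_lt// -T_gt// in y1 y2; rewrite ler_norml; apply/andP; split; lra.
Qed.

Let near_regular x : x <> p -> x <> q -> \forall y \near x, y <> p /\ y <> q.
Proof.
move=> xp xq.
have h1 : \forall y \near x, b0 < b (psi (T x + 1) y) by apply: bpsi_gt; rewrite -T_lt// ltrDl.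
have h2 : \forall y \near x, b (psi (T x - 1) y) < b0 by apply: bpsi_lt; rewrite -T_gt// gtrBl.
apply: filterS (filterI h1 h2) => y [y1 y2]; split => E.
  by move: y2; rewrite E fix_p ltNge (ltW bp).
by move: y1; rewrite E fix_q bq ltNge (ltW b0_gt0).
Qed.

Let spt_cvg (x : M) (c r : M -> R^o) (y : M -> 'rV[R]_n) c0 r0 y0 : c @ x --> c0 -> r @ x --> r0 ->
  y @ x --> y0 -> spt (c t) (r t) (y t) @[t --> x] --> spt c0 r0 y0.
Proof.
move=> cc rc yc; apply: cvg_row => i; have [j ->|->] := unliftP ord0 i.
  rewrite sptS; under eq_cvg do rewrite sptS.
  apply: cvgM => //; apply: (@cvg_comp _ _ _ y (fun v : 'rV[R]_n => v 0 j) _ (nbhs y0)) => //.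
  exact: coord_continuous.
by rewrite spt0; under eq_cvg do rewrite spt0.
Qed.

Let den_cts : continuous den.
Proof.
move=> t; apply: (@cvg_comp _ _ _ (fun t : R => 1 + t ^+ 2) Num.sqrt _ (nbhs (1 + t ^+ 2))); last exact: sqrt_continuous.
by apply: cvgD; [exact: cvg_cst|exact: exprn_continuous].
Qed.

Let G_cts_regular x : x <> p -> x <> q -> {for x, continuous G}.
Proof.
move=> xp xq; rewrite /prop_for /continuous_at (GE xp xq).
have L1 : spt (height (T y)) (radius (T y)) (dir (psi (T y) y)) @[y --> x] -->
    spt (height (T x)) (radius (T x)) (dir (psi (T x) x)).
  have Tc := T_cts xp xq.
  have dc : den (T y) @[y --> x] --> den (T x).
    by apply: (@cvg_comp _ _ _ T den _ (nbhs (T x))) => //; exact: den_cts.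
  have rc : radius (T y) @[y --> x] --> radius (T x) by apply: cvgV => //; rewrite gt_eqF.
  apply: spt_cvg => //; first exact: cvgM.
  apply: (@cvg_comp _ _ _ (fun y => psi (T y) y) dir _ (nbhs (psi (T x) x))); last first.
    by apply: dir_cts; exact: TP.
  apply: (@cvg_comp _ _ _ (fun y => (T y, y)) (fun z => psi z.1 z.2) _ (nbhs (T x, x))).
    by apply: cvg_pair_at => //; exact: cvg_id.
  exact: psi_cvg.
apply: cvg_trans L1; apply: near_eq_cvg.
by apply: filterS (near_regular xp xq) => y [yp yq]; rewrite GE.
Qed.

Let dir_bound x i : b x = b0 -> `|dir x 0 i| <= 1.
Proof.
move=> bx; rewrite -(ler_pXn2r (n := 2)) ?nnegrE// expr1n -normrX ger0_norm ?sqr_ge0//.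
by rewrite -(dir_unit bx) (bigD1 i)//= lerDl; apply: sumr_ge0 => j _; exact: sqr_ge0.
Qed.

(* Near a pole the crossing time leaves every bounded set, on the side given by the sign c. *)
Let G_cts_pole x c : c ^+ 2 = 1 -> G x = spt c 0 0 ->
  (forall a, \forall y \near x, y = x \/ [/\ y <> p, y <> q & a < c * T y]) ->
  {for x, continuous G}.
Proof.
move=> c1 Gx H; apply/cvgrPdist_le => e e0.
apply: filterS (H e^-1) => y [->|[yp yq cT]]; first by rewrite subrr normr0 ltW.
have ei : 0 < e^-1 by rewrite invr_gt0.
have cn : `|c| = 1.
  by apply/eqP; rewrite -(@eqrXn2 _ 2)// ?normr_ge0// expr1n -normrX c1 normr1.
have eT : e^-1 < `|T y|.
  by apply: lt_le_trans cT _; rewrite -[leRHS]mul1r -cn -normrM ler_norm.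
rewrite Gx GE//; apply: norm_le_coord => [|i]; first exact: ltW.
rewrite [X in `|X|]mxE [in X in `|_ + X|]mxE; have [j ->|->] := unliftP ord0 i.
  rewrite !sptS mul0r add0r normrN normrM (ger0_norm (ltW (radius_gt0 _))).
  apply: (@le_trans _ _ (radius (T y) * 1)).
    by apply: ler_pM => //; [exact: ltW|apply: dir_bound; exact: TP].
  by rewrite mulr1; exact: radius_le.
by rewrite !spt0; apply: height_dist => //; exact: lt_trans cT.
Qed.

Let G_cts : continuous G.
Proof.
move=> x; have [->|->|[xp xq]] := trichotomy x; last exact: G_cts_regular.
- apply: (@G_cts_pole p (-1)) => //; first by rewrite sqrrN expr1n.
  (* Points near p are still above the level at time -a, because the flow at time -a is continuous
     and fixes p; so they cross before -a. The argument at q is the same at time a. *)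
  move=> a; have h : \forall y \near p, b0 < b (psi (- a) y) by apply: bpsi_gt; rewrite fix_p.
  apply: filterS h => y ya; have [->|E|[yp yq]] := trichotomy y; [by left| |right; split => //].
    by move: ya; rewrite E fix_q bq ltNge (ltW b0_gt0).
  by rewrite mulN1r ltrNr T_lt.
- apply: (@G_cts_pole q 1) => //; first by rewrite expr1n.
  move=> a; have h : \forall y \near q, b (psi a y) < b0 by apply: bpsi_lt; rewrite fix_q bq.
  apply: filterS h => y ya; have [E|->|[yp yq]] := trichotomy y; [|by left|right; split => //].
    by move: ya; rewrite E fix_p ltNge (ltW bp).
  by rewrite mul1r T_gt.
Qed.

Theorem source_sink_sphere : homeomorphic M (set_type (sphere R n)).
Proof.
pose F x : set_type (sphere R n) := exist _ (G x) (mem_set (G_sphere x)).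
apply: (@compact_bijection_homeomorphic _ _ F) => //.
- exact: set_type_hausdorff (@norm_hausdorff _ _).
- apply/continuous_comp_initial; exact: G_cts.
- by move=> x y /(congr1 set_val); exact: G_inj.
- move=> [z zS]; have [x xz] := G_surj (set_mem zS).
  by exists x; apply: val_inj.
Qed.

End Dynamics.

(** * Concircular vector fields *)

Section BumpDerivative.
Variables (R : realType) (n : nat).
Local Notation e_ i := (delta_mx 0 i : 'rV[R]_n).

Lemma is_derive_dist2 (x0 x : 'rV[R]_n) i : is_derive x (e_ i) (dist2 x0) (2 * (x - x0) 0 i).
Proof.
have D j : is_derive x (e_ i) ((fun x => (x - x0) 0 j : R^o) * (fun x => (x - x0) 0 j : R^o)) (2 * (x - x0) 0 j * (j == i)%:R).
  have := is_deriveM (is_derive_coordB x0 x j i) (is_derive_coordB x0 x j i).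
  move=> H; apply: (is_derive_eq H).
  by rewrite /GRing.scale/=; ring.
rewrite (_ : dist2 x0 = \sum_j ((fun x => (x - x0) 0 j : R^o) * (fun x => (x - x0) 0 j : R^o))); last first.
  by apply/funext => y; rewrite fct_sumE /dist2; apply: eq_bigr => j _; rewrite expr2.
apply: (is_derive_eq (is_derive_sum D)).
rewrite (bigD1 i)//= eqxx mulr1 big1 ?addr0// => j ji.
by rewrite (negbTE ji) mulr0.
Qed.

Lemma is_derive_bump (x0 x : 'rV[R]_n) s i :
  is_derive x (e_ i) (bump x0 s) (- ((s - dist2 x0 x) ^- 2 * bump x0 s x * (2 * (x - x0) 0 i))).
Proof.
apply/derive_at_line.
have D1 : is_derive (0 : R) 1 (fun h => s - dist2 x0 (h *: e_ i + x) : R^o) (- (2 * (x - x0) 0 i)).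
  rewrite -[X in is_derive _ _ _ X]sub0r; apply: is_deriveB.
  by apply/derive_at_line; exact: is_derive_dist2.
have := @is_derive1_comp R (@theta R) (fun h => s - dist2 x0 (h *: e_ i + x)) 0 _ _ (is_derive_theta _) D1.
rewrite scale0r add0r => H; apply: (is_derive_eq H).
by rewrite mulrN.
Qed.

Lemma dist2_line (x0 : 'rV[R]_n) i t : dist2 x0 (t *: e_ i + x0) = t ^+ 2.
Proof.
rewrite /dist2 (bigD1 i)//= big1 ?addr0 => [|j ji]; rewrite !mxE eqxx addrK /= ?eqxx ?mulr1//.
by rewrite (negbTE ji) mulr0 expr0n.
Qed.

(* Gronwall on a short interval: each application of the mean value inequality halves the bound on y. *)
Lemma linear_bound_zero (y dy : R -> R^o) (tau K : R) : 0 <= K -> K * tau <= 2^-1 -> y 0 = 0 ->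
  (forall t : R, `|t| <= tau -> is_derive t 1 y (dy t)) ->
  (forall t : R, `|t| <= tau -> `|dy t| <= K * `|y t|) ->
  forall t : R, `|t| <= tau -> y t = 0.
Proof.
move=> K0 Kt y0 dyP dyK t tt.
have [B B0 HB] : exists2 B : R, 0 <= B & forall t, `[- tau, tau]%classic t -> `|y t| <= B.
  apply: compact_norm_bound; first exact: segment_compact.
  move=> a /=; rewrite in_itv/= -ler_norml => /dyP; exact: is_derive_continuous.
have key k (a : R) : `|a| <= tau -> `|y a| <= B / 2 ^+ k.
  elim: k a => [|k IH] a at_; first by rewrite expr0 divr1; apply: HB; rewrite /= in_itv/= -ler_norml.
  rewrite -[y a]subr0 -[in X in _ - X]y0.
  have := @mean_value_le0 R y dy a (K * (B / 2 ^+ k)) => H.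
  apply: le_trans (H _ _) _.
  - by move=> c ca; apply: dyP; exact: le_trans at_.
  - move=> c ca; have ct := le_trans ca at_; apply: le_trans (dyK _ ct) _.
    by apply: ler_wpM2l => //; exact: IH.
  - rewrite (_ : B / 2 ^+ k.+1 = B / 2 ^+ k * 2^-1); last by rewrite exprSr invfM mulrA.
    rewrite mulrAC mulrC ler_wpM2l ?divr_ge0 ?exprn_ge0//.
    by apply: le_trans Kt; rewrite ler_wpM2l.
apply/eqP; rewrite -normr_le0; apply/ler_addgt0Pr => eps eps0; rewrite add0r.
have [k /ltW kE] := geometric_lt B eps0.
exact: le_trans (key k t tt) kE.
Qed.

End BumpDerivative.

Lemma mulr_lt0_cancel (R : realDomainType) (a b c : R) : a * b < 0 -> b * c < 0 -> 0 < a * c.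
Proof.
move=> ab bc; rewrite ltNge; apply/negP => ac.
have : 0 < (a * b) * (b * c) by rewrite nmulr_rgt0.
have := mulr_le0_ge0 ac (sqr_ge0 b); rewrite (_ : a * b * (b * c) = a * c * b ^+ 2); last by ring.
by move=> /le_lt_trans h /h; rewrite ltxx.
Qed.

Lemma continuous_scale_sub (R : realType) n (T : topologicalType) (k : R) (x0 : 'rV[R]_n)
    (h : T -> 'rV[R]_n) x :
  {for x, continuous h} -> {for x, continuous (fun y => k *: (h y - x0))}.
Proof.
move=> hc; apply: (@cvgZ R 'rV[R]_n T (nbhs x) _ (fun=> k) (fun y => h y - x0)); first exact: cvg_cst.
by apply: cvgB => //; exact: cvg_cst.
Qed.

Section ManifoldTopology.
Variables (R : realType) (n : nat) (M : manifold R n).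

Lemma sfun_continuous (h : smooth_fun M) : continuous h.
Proof.
move=> p; have [c Ac cp] := atlas_cover p.
have ip : (chart_map c @` chart_dom c) (chart_map c p) by exists p.
have hc : {for chart_map c p, continuous (h \o chart_inv c)}.
  exact: Ck_continuous (sfun_smooth h Ac 0%N) ip.
have L : (h \o chart_inv c) (chart_map c y) @[y --> p] --> h p.
  rewrite -[h p]/(h p) -[in X in _ --> X](chart_mapK cp).
  exact: (@cvg_comp _ _ _ (chart_map c) (h \o chart_inv c) _ (nbhs (chart_map c p)) _ (chart_map_cts cp) hc).
apply: cvg_trans L; apply: near_eq_cvg.
have : \forall y \near p, chart_dom c y by apply: open_nbhs_nbhs; split => //; exact: chart_dom_open.
by apply: filterS => y cy; rewrite /= chart_mapK.
Qed.

Lemma connected_sign (h : smooth_fun M) : connected [set: M] -> (forall p, h p != 0) ->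
  exists2 e : R, e ^+ 2 = 1 & forall p, 0 < e * h p.
Proof.
move=> Mc h0.
have [[p hp]|np] := pselect (exists p, 0 < h p).
  exists 1; first by rewrite expr1n.
  have HT : [set p | 0 < h p] = [set: M].
    apply: Mc; first by exists p.
    - exists [set p | 0 < h p]; last by rewrite setTI.
      by have := (continuousP _).1 (@sfun_continuous h) _ (@open_gt R 0).
    - exists [set p | 0 <= h p]; last first.
        by rewrite setTI; apply/seteqP; split => x /=; [exact: ltW|rewrite lt_neqAle eq_sym h0].
      by have := (continuous_closedP _).1 (@sfun_continuous h) _ (@closed_ge R 0).
  by move=> x; rewrite mul1r; have : [set: M] x by []; rewrite -HT.
exists (-1); first by rewrite sqrrN expr1n.
move=> x; rewrite mulN1r oppr_gt0 lt_neqAle h0 leNgt; apply/negP => hx.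
by apply: np; exists x.
Qed.

End ManifoldTopology.

(** In dimension 0 a chart domain is a single point, which is open and closed. This disposes of n =
    0, so that a coordinate direction exists afterwards. *)
Lemma connected_manifold0 (R : realType) (n : nat) (M : manifold R n) (p q : M) :
  n = 0%N -> connected [set: M] -> p = q.
Proof.
move=> n0 Mc; subst n; have [c Ac cp] := atlas_cover p.
have E : chart_dom c = [set p].
  apply/seteqP; split => [x cx|_ -> //]; rewrite /= -(chart_mapK cx) -(chart_mapK cp).
  by congr chart_inv; apply/rowP => -[].
have : [set p] = [set: M].
  apply: Mc; first by exists p.
  - by exists [set p]; rewrite ?setTI// -E; exact: chart_dom_open.
  - exists [set p]; rewrite ?setTI//; apply: compact_closed; first exact: manifold_hausdorff.
    exact: compact_set1.
by move=> pT; have : [set: M] q by []; rewrite -pT => ->.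
Qed.

(** * Energy estimate and nonvanishing of the potential at a zero of u *)

Section Concircular.
Variables (R : realType) (n : nat) (M : manifold R n) (g : metric M)
    (nabla : vfield M -> vfield M -> vfield M) (u : vfield M) (f rho : smooth_fun M).
Hypotheses (LC : levi_civita g nabla) (uC : concircular nabla u f)
  (rhoC : is_connecting_function g u f rho).
Local Notation C := (smooth_fun M).
Local Notation gx X Y x := (inner g (vfield_at X x) (vfield_at Y x)).
Local Notation e_ i := (delta_mx 0 i : 'rV[R]_n).

Lemma inner_addl x (v w z : tangent x) : inner g (v + w) z = inner g v z + inner g w z.
Proof. exact: (linear_add (inner_linear g z)). Qed.

Lemma inner_scalel x a (v z : tangent x) : inner g (a *: v) z = a * inner g v z.
Proof. exact: (linear_scale (inner_linear g z)). Qed.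

Lemma inner_ge0 x (v : tangent x) : 0 <= inner g v v.
Proof.
have [->|v0] := eqVneq v 0; last exact/ltW/inner_gt0.
by rewrite (linear_zero (inner_linear g 0)).
Qed.

Lemma inner_eq0 x (v : tangent x) : inner g v v = 0 -> v = 0.
Proof. by move=> v0; apply/eqP; apply: contraPT v0 => /(inner_gt0 g) h /eqP; rewrite gt_eqF. Qed.

(** Expand g(d w + v, d w + v) >= 0 for d = c and d = -c. *)
Lemma inner_cross x c (v w : tangent x) :
  `|2 * c * inner g v w| <= c ^+ 2 * inner g w w + inner g v v.
Proof.
have key d : 0 <= d ^+ 2 * inner g w w + 2 * d * inner g v w + inner g v v.
  have := inner_ge0 (d *: w + v).
  rewrite !inner_addl !inner_scalel ![inner g _ (d *: w + v)]inner_sym !inner_addl !inner_scalel.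
  rewrite (inner_sym g w v) => h; apply: le_trans h _.
  by rewrite le_eqVlt; apply/orP; left; apply/eqP; ring.
have k1 := key c; have k2 := key (- c).
by rewrite ler_norml; apply/andP; split; rewrite ?sqrrN in k2 *; lra.
Qed.

Lemma vfield_atZ a (X : vfield M) x : vfield_at (a *: X) x = a x *: vfield_at X x.
Proof. exact/val_inj. Qed.

Lemma vfield_potential (X : vfield M) x : (X f : C) x = rho x * gx u X x.
Proof.
have := congr1 (fun h : C => h x) (rhoC X); rewrite /= => <-.
by rewrite vfield_atZ inner_scalel.
Qed.

Definition sqnorm : C := inner_vfield g u u.

Lemma vfield_sqnorm (X : vfield M) x : (X sqnorm : C) x = 2 * f x * gx u X x.
Proof.
have [_ _ met] := LC.
have := congr1 (fun h : C => h x) (met X u u); rewrite /= uC => ->.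
change (gx (f *: X) u x + gx u (f *: X) x = 2 * f x * gx u X x).
by rewrite vfield_atZ [inner g (vfield_at u x) _]inner_sym inner_scalel inner_sym; ring.
Qed.

Definition energy : C := sqnorm + f * f.

Lemma energyE x : energy x = sqnorm x + f x ^+ 2.
Proof. by []. Qed.

Lemma sqnorm_ge0 x : 0 <= sqnorm x.
Proof. exact: inner_ge0. Qed.

Lemma energy_ge0 x : 0 <= energy x.
Proof. by rewrite energyE addr_ge0 ?sqr_ge0 ?sqnorm_ge0. Qed.

Lemma sqnorm_eq0 x : sqnorm x = 0 -> zeros u x.
Proof. by move=> /inner_eq0. Qed.

Lemma zeros_sqnorm x : zeros u x -> sqnorm x = 0.
Proof.
move=> ux; change (gx u u x = 0).
by rewrite [vfield_at u x]ux (linear_zero (inner_linear g 0)).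
Qed.

(** The derivative is 2 f (1 + rho) g(u, X). The cross term is bounded by f^2 g(X, X) + g(u, u),
    hence by (1 + g(X, X)) times the energy, which is the linear bound needed for Gronwall. *)
Lemma vfield_energy_bound (X : vfield M) x :
  `|(X energy : C) x| <= (1 + `|rho x|) * (1 + gx X X x) * energy x.
Proof.
have -> : (X energy : C) x = (2 * f x * gx u X x) * (1 + rho x).
  have := tangentD (vfield_at X x) sqnorm (f * f).
  rewrite (tangentM (vfield_at X x)) => E.
  rewrite -[LHS]/(vfield_at X x energy) [LHS]E.
  rewrite -[vfield_at X x sqnorm]/((X sqnorm : C) x) -[vfield_at X x f]/((X f : C) x).
  by rewrite vfield_sqnorm vfield_potential; ring.
rewrite normrM mulrC -[leRHS]mulrA; apply: ler_pM => //.
  by apply: le_trans (ler_normD _ _) _; rewrite normr1.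
apply: le_trans (inner_cross _ _ _) _.
have X0 := inner_ge0 (vfield_at X x); have u0 := sqnorm_ge0 x.
rewrite energyE mulrDl mul1r mulrDr -[inner g (vfield_at u x) _]/(sqnorm x).
have := sqr_ge0 (f x); have : 0 <= gx X X x * sqnorm x by rewrite mulr_ge0.
move: (gx X X x * sqnorm x) (gx X X x) (sqnorm x) u0 => a b c' c0 a0 h.
by rewrite [f x ^+ 2 * b]mulrC; lra.
Qed.

Hypotheses (M_compact : compact [set: M]) (n_gt0 : (0 < n)%N).

(* If f p = 0, the energy vanishes along a coordinate segment through p by Gronwall, so u has a third zero. *)
Lemma potential_neq0 (p q : M) : zeros u = [set p; q] -> f p != 0.
Proof.
move=> upq; apply/eqP => fp0.
have up0 : zeros u p by rewrite upq; left.
have [c [r [s [[Ac cp r0 s0 sr] bi]]]] := exists_chart_ball p.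
set x0 := chart_map c p in bi.
pose i := Ordinal n_gt0.
pose X := frame Ac r0 sr bi i.
pose bt := beta Ac r0 sr bi.
pose ci := chart_inv c.
have [B B0 HB] : exists2 B : R, 0 <= B & forall x, [set: M] x -> `|(1 + `|rho x|) * (1 + gx X X x) : R^o| <= B.
  apply: compact_norm_bound => // x _.
  apply: cvgM; apply: cvgD; try exact: cvg_cst; first by apply: cvg_norm; exact: sfun_continuous.
  exact: (@sfun_continuous _ _ _ (inner_vfield g X X)).
pose m := bump x0 s x0.
have m0 : 0 < m by rewrite /m bump_gt0 dist2xx.
have near_x0 : \forall x \near x0, dist2 x0 x < s /\ m / 2 < bump x0 s x.
  apply: filterI; first by apply: (open_nbhs_nbhs (conj (@open_dist2_lt R n x0 s) _)); rewrite /= dist2xx.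
  have bc : {for x0, continuous (bump x0 s)} by apply: Ck_continuous (smooth_bump x0 s openT 0%N) _.
  by apply: (bc [set a | m / 2 < a]); apply: lt_nbhsr; rewrite ltr_pdivrMr// ltr_pMr// ltr1n.
have [d /= d0 Hd] := (nbhs_ballP _ _).1 near_x0.
(* B bounds the growth rate along the frame field, which is the bump times the coordinate
   derivative; dividing by the lower bound m/2 of the bump gives the rate for the coordinate
   derivative. *)
pose K := B / (m / 2).
have K0 : 0 <= K by rewrite divr_ge0// divr_ge0// ltW.
pose tau := Num.min (d / 2) (2 * (K + 1))^-1.
have tau0 : 0 < tau by rewrite lt_min divr_gt0// invr_gt0 mulr_gt0// ltr_wpDl.
have Ktau : K * tau <= 2^-1.
  apply: (@le_trans _ _ (K * (2 * (K + 1))^-1)); first by rewrite ler_wpM2l// ge_min lexx orbT.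
  by rewrite ler_pdivrMr ?mulr_gt0 ?ltr_wpDl// mulKf ?pnatr_eq0// lerDl.
have inb (t : R) : `|t| <= tau -> dist2 x0 (t *: e_ i + x0) < s /\ m / 2 < bump x0 s (t *: e_ i + x0).
  move=> tt; apply: Hd; rewrite -ball_normE/= opprD addrCA subrr addr0 normrN.
  apply: (@le_lt_trans _ _ (d / 2)); last by lra.
  apply: norm_le_coord => [|j]; first by lra.
  rewrite !mxE eqxx/=; apply: (@le_trans _ _ `|t|); last by apply: le_trans tt _; rewrite ge_min lexx.
  by case: (j == i); rewrite ?mulr1// mulr0 normr0.
have KB : B <= K * (m / 2) by rewrite /K divfK// gt_eqF// divr_gt0.
clearbody tau K m.
pose y (t : R) : R^o := energy (ci (t *: e_ i + x0)).
pose dy (t : R) : R^o := 'D_(e_ i) (energy \o ci) (t *: e_ i + x0).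
have y0 : y 0 = 0 by rewrite /y scale0r add0r /ci chart_mapK// energyE fp0 expr0n addr0 zeros_sqnorm.
have yD (t : R) : `|t| <= tau -> is_derive t 1 y (dy t).
  move=> tt; have [ts _] := inb t tt.
  have := @is_derive_line R _ _ (energy \o ci) x0 (e_ i) t; apply.
  by apply: (chart_derivable Ac bi); exact: dist2_ball (ltW ts).
have dyK (t : R) : `|t| <= tau -> `|dy t| <= K * `|y t|.
  move=> tt; have [ts tm] := inb t tt.
  set x := t *: e_ i + x0 in ts tm *.
  have cx := ci_cball r0 sr bi ts.
  have ix : chart_map c (ci x) = x by rewrite /ci chart_invK//; exact: bi (dist2_ball r0 sr (ltW ts)).
  have FE := frameE Ac r0 sr bi i energy cx; rewrite -/ci ix in FE.
  have bE : bt (ci x) = bump x0 s x by rewrite /bt beta_in// -/ci ix.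
  have b0 : 0 < bt (ci x) by rewrite bE; apply: lt_trans tm; rewrite divr_gt0.
  rewrite /dy -/x; have -> : 'D_(e_ i) (energy \o ci) x = (X energy : C) (ci x) / bt (ci x).
    by rewrite -[(X energy : C) (ci x)]/((frame Ac r0 sr bi i energy : C) (ci x)) FE mulrC mulKf// gt_eqF.
  rewrite normrM normfV (gtr0_norm b0) ler_pdivrMr//.
  apply: le_trans (vfield_energy_bound _ _) _.
  rewrite (ger0_norm (energy_ge0 _ : 0 <= y t)) [leRHS]mulrAC /y -/x.
  apply: ler_wpM2r; first exact: energy_ge0.
  apply: le_trans (ler_norm _) _; apply: le_trans (HB _ I) _.
  by apply: le_trans KB _; rewrite ler_wpM2l// bE ltW.
have yz (t : R) : `|t| <= tau -> y t = 0 by exact: (linear_bound_zero K0 Ktau y0 yD dyK).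
have zt (t : R) : `|t| <= tau -> zeros u (ci (t *: e_ i + x0)).
  move=> /yz; rewrite /y energyE => E; apply: sqnorm_eq0.
  have := sqnorm_ge0 (ci (t *: e_ i + x0)); have := sqr_ge0 (f (ci (t *: e_ i + x0))); lra.
have inj (t t' : R) : `|t| <= tau -> `|t'| <= tau -> ci (t *: e_ i + x0) = ci (t' *: e_ i + x0) -> t = t'.
  have ix (a : R) : `|a| <= tau -> chart_map c (ci (a *: e_ i + x0)) = a *: e_ i + x0.
    by move=> /inb[/ltW/(dist2_ball r0 sr)/bi as_ _]; rewrite /ci chart_invK.
  move=> /ix tE /ix tE' /(congr1 (chart_map c)); rewrite tE tE' => /addIr/rowP/(_ i).
  by rewrite !mxE !eqxx !mulr1.
have e0 : `|0 : R| <= tau by rewrite normr0 ltW.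
have e1 : `|tau| <= tau by rewrite gtr0_norm.
have e2 : `|tau / 2| <= tau by rewrite gtr0_norm ?divr_gt0// ler_pdivrMr// ler_pMr// ler1n.
have p0 : ci (0 *: e_ i + x0) = p by rewrite scale0r add0r /ci chart_mapK.
(* The parameters tau and tau/2 give zeros of u different from p, so both must be q, against
   injectivity of the segment. *)
have q1 : ci (tau *: e_ i + x0) = q.
  have := zt _ e1; rewrite upq => -[E|//]; have := inj _ _ e1 e0; rewrite p0 => /(_ E) h.
  by move: tau0; rewrite h ltxx.
have q2 : ci ((tau / 2) *: e_ i + x0) = q.
  have := zt _ e2; rewrite upq => -[E|//]; have := inj _ _ e2 e0; rewrite p0 => /(_ E) h.
  by move: tau0; rewrite -(divfK (_ : 2 != 0 :> R) tau) ?h ?mul0r ?ltxx// pnatr_eq0.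
have := inj _ _ e1 e2; rewrite q1 q2 => /(_ erefl) h; move: tau0; lra.
Qed.

End Concircular.

(** * The local picture at p, and the application of the dynamical theorem *)

Section Sphere.
Variables (R : realType) (n : nat) (M : manifold R n) (g : metric M)
    (nabla : vfield M -> vfield M -> vfield M) (u : vfield M) (f : smooth_fun M).
Hypotheses (LC : levi_civita g nabla) (uC : concircular nabla u f).
Local Notation C := (smooth_fun M).
Local Notation e_ i := (delta_mx 0 i : 'rV[R]_n).

(* The linear part of u at a zero p is f p times the identity, so that a small coordinate sphere is transverse to u. *)
Lemma velocity_radial (p : M) (c : chart R n M) (r s : R) (Ac : atlas c) (cp : chart_dom c p)
    (r0 : 0 < r) (s0 : 0 < s) (sr : s < r ^+ 2)
    (bi : ball (chart_map c p) r `<=` chart_map c @` chart_dom c) :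
  zeros u p -> f p != 0 ->
  exists2 d : R, 0 < d & forall h : 'rV[R]_n, `|h| < d ->
    `|\sum_i velocity Ac r0 sr bi u i (h + chart_map c p) * h 0 i - f p * (\sum_i h 0 i ^+ 2)|
      <= `|f p| / 2 * (\sum_i h 0 i ^+ 2).
Proof.
move=> up fp; set x0 := chart_map c p in bi *.
have xs0 : dist2 x0 x0 < s by rewrite dist2xx.
have cbp : cball c x0 s p by split.
have fp0 : 0 < `|f p| by rewrite normr_gt0.
(* The n coordinate errors, each at most e |h|^2, then add up to at most half of the main term. *)
pose e := `|f p| / (2 * n.+1%:R).
have e0 : 0 < e by rewrite divr_gt0// mulr_gt0.
have : \forall h \near (0 : 'rV[R]_n), forall i, `|velocity Ac r0 sr bi u i (h + x0) - f p * h 0 i| <= e * `|h|.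
  apply: (@filter_forall _ 'I_n _ (nbhs (0 : 'rV[R]_n)) (nbhs_filter _)) => i.
  have := C1_estimate (@open_dist2_lt R n x0 s) xs0 (smooth_velocity Ac r0 sr bi u i 1%N) e0.
  apply: filterS => h.
  rewrite (velocity_at0 Ac r0 sr bi up cbp (erefl x0)) subr0.
  under eq_bigr => j _ do rewrite (derive_velocity_at0 Ac r0 s0 sr bi LC uC up cbp (erefl x0)).
  rewrite (bigD1 i)//= eqxx mulr1 big1 ?addr0 => [|j ji]; last by rewrite eq_sym (negbTE ji) !mulr0.
  by rewrite [h 0 i * _]mulrC.
move=> /nbhs_ballP[d /= d0 Hd]; exists d => // h hd.
have Hh i : `|velocity Ac r0 sr bi u i (h + x0) - f p * h 0 i| <= e * `|h|.
  by apply: Hd; rewrite -ball_normE/= sub0r normrN.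
rewrite mulr_sumr -sumrB; apply: (le_trans (ler_norm_sum _ _ _)).
have hN : `|h| ^+ 2 <= \sum_i h 0 i ^+ 2.
  by have := norm_dist2 0 h; rewrite /dist2 subr0.
have N0 : 0 <= \sum_i h 0 i ^+ 2 by apply: sumr_ge0 => i _; exact: sqr_ge0.
apply: (@le_trans _ _ (\sum_(i < n) e * `|h| ^+ 2)).
  apply: ler_sum => i _; rewrite expr2 !mulrA -mulrBl normrM.
  by apply: ler_pM => //; exact: coord_le_norm.
rewrite sumr_const card_ord -[leLHS]mulr_natl; apply: (@le_trans _ _ (n%:R * (e * (\sum_i h 0 i ^+ 2)))).
  by rewrite ler_wpM2l// ler_wpM2l// ltW.
rewrite mulrA ler_wpM2r// /e mulrC mulrAC ler_pdivrMr ?mulr_gt0// mulrA divfK ?pnatr_eq0//.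
by rewrite ler_wpM2l// ler_nat.
Qed.

(** The gradient of the bump is a negative multiple of x - x0, so u(beta) has the sign opposite to
    the radial component of u. Two radii occur because the components of u are fixed with [s1]
    before the bump is shrunk to [s]. *)
Lemma velocity_beta (c : chart R n M) (x0 : 'rV[R]_n) (r s s1 : R) (Ac : atlas c)
    (r0 : 0 < r) (sr : s < r ^+ 2) (s1r : s1 < r ^+ 2)
    (bi : ball x0 r `<=` chart_map c @` chart_dom c) x : s <= s1 -> dist2 x0 x < s ->
  (u (beta Ac r0 sr bi) : C) (chart_inv c x) =
    - (2 * (s - dist2 x0 x) ^- 2 * bump x0 s x) *
      \sum_i velocity Ac r0 s1r bi u i x * (x - x0) 0 i.
Proof.
move=> ss1 xs; rewrite (velocityE Ac r0 s1r bi u (beta Ac r0 sr bi) (lt_le_trans xs ss1)) mulr_sumr.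
apply: eq_bigr => i _.
have -> : 'D_(e_ i) (beta Ac r0 sr bi \o chart_inv c) x = 'D_(e_ i) (bump x0 s) x.
  apply: near_eq_derive.
  have : \forall y \near x, dist2 x0 y < s by apply: (open_nbhs_nbhs (conj (@open_dist2_lt R n x0 s) xs)).
  apply: filterS => y ys.
  change (beta Ac r0 sr bi (chart_inv c y) = bump x0 s y).
  rewrite beta_in; last exact: (ci_cball r0 sr bi).
  by rewrite chart_invK//; exact: bi (dist2_ball r0 sr (ltW ys)).
by rewrite (@derive_val _ _ _ _ _ _ _ (is_derive_bump x0 x s i)); ring.
Qed.

Lemma bump_radial_derivative (p : M) : zeros u p -> f p != 0 -> forall q, q <> p ->
  exists (c : chart R n M) (r s : R) (Ac : atlas c) (r0 : 0 < r) (s0 : 0 < s) (sr : s < r ^+ 2)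
   (bi : ball (chart_map c p) r `<=` chart_map c @` chart_dom c),
  [/\ chart_dom c p, ~ cball c (chart_map c p) s q &
   forall x, cball c (chart_map c p) s x -> x <> p ->
     f p * (u (beta Ac r0 sr bi) : C) x < 0].
Proof.
move=> up fp q qp.
have [c [r [s1 [[Ac cp r0 s10 s1r] bi]]]] := exists_chart_ball p.
have [d d0 Hd] := velocity_radial Ac cp r0 s10 s1r bi up fp.
set x0 := chart_map c p in bi Hd *.
have dist2_gt0 y : chart_dom c y -> y <> p -> 0 < dist2 x0 (chart_map c y).
  move=> cy yp; rewrite lt_neqAle dist2_ge0 andbT eq_sym; apply/eqP => E; apply: yp.
  rewrite -(chart_mapK cy) -(chart_mapK cp); congr chart_inv; apply/eqP; rewrite -/x0 -subr_eq0 -normr_eq0.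
  by rewrite -sqrf_eq0 eq_le sqr_ge0 andbT -E norm_dist2.
have [D D0 HD] : exists2 D : R, 0 < D & chart_dom c q -> D <= dist2 x0 (chart_map c q).
  have [cq|ncq] := pselect (chart_dom c q); last by exists 1.
  by exists (dist2 x0 (chart_map c q)) => //; exact: dist2_gt0.
(* Small enough for the radial estimate to hold on the whole support and for q to lie outside. *)
pose s := Num.min s1 (Num.min (d ^+ 2) D).
have ss1 : s <= s1 by rewrite ge_min lexx.
have sd : s <= d ^+ 2 by rewrite !ge_min lexx orbT.
have sD : s <= D by rewrite !ge_min lexx !orbT.
have s0 : 0 < s by rewrite !lt_min s10 D0 exprn_gt0.
have sr := le_lt_trans ss1 s1r.
exists c, r, s, Ac, r0, s0, sr, bi; split => //.
  by move=> [cq qs]; have := lt_le_trans qs (le_trans sD (HD cq)); rewrite ltxx.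
move=> x [cx xs] xp; rewrite -/x0 in xs; have N0 := dist2_gt0 _ cx xp.
have xd : `|chart_map c x - x0| < d.
  rewrite -(@ltr_pXn2r _ 2) ?nnegrE ?normr_ge0 ?ltW//.
  by apply: lt_le_trans sd; apply: le_lt_trans xs; exact: norm_dist2.
have := Hd _ xd; rewrite -/x0 subrK -/(dist2 x0 (chart_map c x)).
rewrite -(chart_mapK cx) (velocity_beta Ac r0 sr s1r bi ss1 xs) (chart_mapK cx).
rewrite mulNr mulrN oppr_lt0 mulrCA pmulr_rgt0; last first.
  by rewrite mulr_gt0 ?bump_gt0// mulr_gt0// invr_gt0 exprn_gt0// subr_gt0.
move: (dist2 x0 _) N0 (\sum_i _) => N N0 S h.
have fp2 : 0 < `|f p| by rewrite normr_gt0.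
have : `|f p * (S - f p * N)| <= `|f p| ^+ 2 / 2 * N.
  by rewrite normrM expr2 -!mulrA ler_wpM2l// mulrA.
rewrite real_normK ?num_real// ler_norml => /andP[h1 _].
have : 0 < f p ^+ 2 * N by rewrite mulr_gt0// lt_neqAle sqr_ge0 eq_sym sqrf_eq0 fp.
by rewrite mulrBr in h1; nra.
Qed.

End Sphere.

Theorem theorem5p1 (R : realType) (n : nat) (M : manifold R n) (g : metric M)
    (nabla : vfield M -> vfield M -> vfield M) (u : vfield M)
    (f rho : smooth_fun M)
    (M_compact : compact [set: M])
    (M_connected : connected [set: M])
    (nabla_LC : levi_civita g nabla)
    (u_concircular : concircular nabla u f)
    (u_nontrivial : f != 0)
    (rho_connecting : is_connecting_function g u f rho)
    (rho_neq0 : forall p : M, rho p != 0)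
    (u_two_zeros : exists p q : M, p <> q /\ zeros u = [set p; q]) :
  homeomorphic M (set_type (sphere R n)).
Proof.
have [p [q [pq upq]]] := u_two_zeros.
have n0 : (0 < n)%N.
  by rewrite lt0n; apply/eqP => n0; apply: pq; exact: connected_manifold0 n0 M_connected.
have up : zeros u p by rewrite upq; left.
have fp := potential_neq0 nabla_LC u_concircular rho_connecting M_compact n0 upq.
have [e e2 erho] := connected_sign M_connected rho_neq0.
(* The direction of time that makes p a sink: the linear part of sg u at p is sg f(p) < 0. *)
have [sg sg2 sgf] : exists2 sg : R, sg ^+ 2 = 1 & sg * f p < 0.
  have [fp0|fp0] := ltP (f p) 0; first by exists 1; rewrite ?expr1n ?mul1r.
  by exists (-1); rewrite ?sqrrN ?expr1n// mulN1r oppr_lt0 lt_neqAle eq_sym fp.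
have [c [r [s [Ac [r0 [s0 [sr [bi [cp qs bneg]]]]]]]]] :=
  bump_radial_derivative nabla_LC u_concircular up fp (fun E => pq (esym E)).
have [F [F0 FD Fcvg FP]] := global_flow u M_compact.
pose b := beta Ac r0 sr bi.
pose psi t := F (sg * t).
(* Along the flow of sg u the two factors sg cancel, and the derivative of L is e rho g(u, u) >= 0,
   zero only at the zeros of u. *)
pose L : smooth_fun M := (sg * e) *: f.
set x0 := chart_map c p in bi qs bneg b *.
have psiP (h : smooth_fun M) x (t : R) :
    is_derive t 1 (fun a => h (psi a x) : R^o) (sg * (u h : smooth_fun M) (psi t x)).
  have D : is_derive t 1 (fun a : R => sg * a : R^o) sg.
    have := is_deriveZ sg (is_derive_id t (1 : R)).
    by move=> H; apply: (is_derive_eq H); rewrite /GRing.scale/= mulr1.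
  have := @is_derive1_comp R (fun a => h (F a x)) (fun a => sg * a) t _ _ (FP h x (sg * t)) D.
  by move=> H; apply: (is_derive_eq H); rewrite mulrC.
have kE x : sg * (u L : smooth_fun M) x = e * rho x * sqnorm g u x.
  rewrite -[(u L : smooth_fun M) x]/(vfield_at u x L) tangentZ.
  rewrite -[vfield_at u x f]/((u f : smooth_fun M) x) (vfield_potential rho_connecting).
  rewrite -[inner g _ _]/(sqnorm g u x) mulrA mulrA -expr2 sg2 mul1r mulrA //.
have pball : cball c x0 s p by split => //; rewrite dist2xx.
have db_gt0 x : cball c x0 s x -> x <> p -> 0 < sg * (u b : smooth_fun M) x.
  move=> cx xp; have h := bneg x cx xp.
  exact: mulr_lt0_cancel sgf h.
have s2 : 0 < s / 2 by rewrite divr_gt0.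
have b0_gt0 : 0 < theta (s / 2) by rewrite theta_gt0.
have level x : b x = theta (s / 2) -> cball c x0 s x /\ dist2 x0 (chart_map c x) = s / 2.
  rewrite /b betaE; case: asboolP => [cx|_ E]; last by move: b0_gt0; rewrite -E ltxx.
  by move=> E; split => //; have := theta_inj b0_gt0 (esym E); lra.
have b_gt0 x : 0 < b x -> cball c x0 s x.
  by rewrite /b betaE; case: asboolP => // _; rewrite ltxx.
(* The level theta(s/2) of the bump is the Euclidean coordinate sphere of squared radius s/2, which
   [dir] rescales to the unit sphere. *)
apply: (@source_sink_sphere R n M p q psi L (fun x => sg * (u L : smooth_fun M) x) b
  (fun x => sg * (u b : smooth_fun M) x) (theta (s / 2))
  (fun x => (Num.sqrt (s / 2))^-1 *: (chart_map c x - x0))).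
- exact: M_compact.
- exact: pq.

- by move=> x; rewrite /psi mulr0.
- by move=> a t x; rewrite /psi mulrDr.
- move=> t x.
  apply: (@cvg_comp _ _ _ (fun z : R * M => (sg * z.1, z.2)) (fun z => F z.1 z.2) _ (nbhs (sg * t, x))); last exact: Fcvg.
  apply: (@cvg_pair_at (R * M)%type) => //; last exact: cvg_snd.
  by apply: cvgMl_tmp; exact: cvg_fst.
- exact: sfun_continuous.
- have -> : (fun x => sg * (u L : smooth_fun M) x) = (sg *: (u L : smooth_fun M) : smooth_fun M) by [].
  exact: sfun_continuous.
- exact: sfun_continuous.
- by move=> x; rewrite kE; apply: mulr_ge0; [exact: ltW|exact: sqnorm_ge0].
- move=> x; rewrite kE => /eqP; rewrite mulf_eq0 gt_eqF//= => /eqP/sqnorm_eq0.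
  by rewrite upq.
- move=> x; have [cx|ncx] := pselect (cball c x0 s x).
    have [->|xp] := pselect (x = p); last by apply/ltW; exact: db_gt0.
    by rewrite (vfield_at0 up) mulr0.
  (* Outside the coordinate ball b takes its minimum 0, so its derivative along the orbit vanishes
     there. *)
  have bx : b x = 0 by rewrite /b betaE asboolF.
  have px : psi 0 x = x by rewrite /psi mulr0.
  have := @derive_at_min R (fun t => b (psi t x)) (fun t => sg * (u b : smooth_fun M) (psi t x)) 0 (psiP b x).
  rewrite px bx => -> // y; exact: beta_ge0.
- by move=> x bx; apply: db_gt0; exact: b_gt0.
- exact: b0_gt0.
- rewrite /b (beta_in Ac r0 sr bi pball) /bump dist2xx subr0; apply: theta_lt => //; lra.
- by rewrite /b betaE asboolF.
- pose t := Num.sqrt (s / 2).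
  have t2 : t ^+ 2 = s / 2 by rewrite sqr_sqrtr// ltW.
  have ts : dist2 x0 (t *: delta_mx 0 (Ordinal n0) + x0) < s by rewrite dist2_line t2; lra.
  have cx := ci_cball r0 sr bi ts.
  exists (chart_inv c (t *: delta_mx 0 (Ordinal n0) + x0)); last exact: beta_gt0.
  move=> /(congr1 (fun x => dist2 x0 (chart_map c x))); rewrite chart_invK; last exact: bi (dist2_ball r0 sr (ltW ts)).
  by rewrite dist2_line dist2xx t2 => E; move: s2; rewrite E ltxx.
- move=> x /level[_ E].
  under eq_bigr => i _ do rewrite mxE exprMn exprVn sqr_sqrtr ?ltW//.
  by rewrite -mulr_sumr -/(dist2 x0 (chart_map c x)) E mulVf// gt_eqF.
- move=> x y /level[[cx _] _] /level[[cy _] _] /scalerI h.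
  rewrite -(chart_mapK cx) -(chart_mapK cy); congr chart_inv; apply: (addIr (- x0)); apply: h.
  by rewrite invr_eq0 gt_eqF// sqrtr_gt0.
- move=> y y1; pose x := Num.sqrt (s / 2) *: y + x0.
  have xs : dist2 x0 x = s / 2.
    rewrite /dist2 /x addrK; under eq_bigr => i _ do rewrite mxE exprMn sqr_sqrtr ?ltW//.
    by rewrite -mulr_sumr y1 mulr1.
  have xs' : dist2 x0 x < s by rewrite xs; lra.
  have ix : chart_map c (chart_inv c x) = x by rewrite chart_invK//; exact: bi (dist2_ball r0 sr (ltW xs')).
  exists (chart_inv c x).
    rewrite /b (beta_in Ac r0 sr bi (ci_cball r0 sr bi xs')) ix /bump xs; congr theta; lra.
  by rewrite ix /x addrK scalerA mulVf ?scale1r// gt_eqF// sqrtr_gt0.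
- move=> x /level[[cx _] _]; apply: continuous_scale_sub; exact: chart_map_cts.
Qed.
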